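(* Let $U\subset M$ be an open set and suppose that conditions (A1)–(A4) hold for $U$. Let $\phi$ be any function admissible for $U$ (as defined in the context). Then there are constants $a_2\ge a_1>0$ such that for every $x\in U$ there exists a constant $a_x\in[a_1,a_2]$ with $$\liminf_{t\to0}\frac{\phi\big(x,\sup_{0<s\le t}d(x,X_s)\big)}{t/\log|\log t|}=a_x\qquad \mathbb P^x\text{-a.s.}$$
   Context: Standing setting: $(M,d,\mu)$ is a locally compact separable metric space and $\mu$ is a positive Radon measure on $M$ with full support. Let $M_\partial=M\cup\{\partial\}$ where $\partial$ is a cemetery point; functions on $M$ are extended by $f(\partial)=0$. $X=(\Omega,\mathcal F_t,X_t,\theta_t,t\ge0;\mathbb P^x,x\in M_\partial)$ is a Borel standard Markov process on $M_\partial$ with lifetime $\zeta=\inf\{t>0:X_t=\partial\}$ and shift operators $\theta_t$ ($X_s\circ\theta_t=X_{s+t}$). $X$ admits a Lévy system of the form $(J(x,dy),ds)$: for every $z\in M$, $t>0$ and nonnegative Borel $F$ on $M\times M_\partial$ vanishing on the diagonal, $\mathbb E^z[\sum_{s\le t}F(X_{s-},X_s)]=\mathbb E^z[\int_0^t\int_{M_\partial}F(X_s,y)J(X_s,dy)\,ds]$ (the killing part $J(x,\{\partial\})$ is included in $J$). Notation: $B(x,r)=\{y\in M:d(x,y)<r\}$, $V(x,r)=\mu(B(x,r))$, $\delta_U(x)=\inf\{d(x,y):y\in M\setminus U\}$, and for a Borel set $D$, $\tau_D=\inf\{t>0:X_t\in M_\partial\setminus D\}$. Conditions (A1)–(A4)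 for an open set $U$: there exist constants $R_0>0$, $C_0\in(0,1)$, $C_1>1$, $C_2,\dots,C_7>0$ such that for every $x\in U$ and $0<r<R_0\wedge(C_0\delta_U(x))$: (A1) $C_1^{-1}\mathbb E^y[\tau_{B(y,r)}]\le\mathbb E^x[\tau_{B(x,r)}]\le C_1\mathbb E^y[\tau_{B(y,r)}]$ for all $y\in B(x,r)$; (A2) $\lim_{r\to0}\mathbb E^x[\tau_{B(x,r)}]=0$ and $\mathbb E^x[\tau_{B(x,r)}]\le C_2\mathbb E^x[\tau_{B(x,r/2)}]$; (A3) $J(x,M_\partial\setminus B(x,r))\le C_3/\mathbb E^x[\tau_{B(x,r)}]$; (A4) $C_4e^{-C_5n}\le\mathbb P^x(\tau_{B(x,r)}\ge n\,\mathbb E^x[\tau_{B(x,r)}])\le C_6e^{-C_7n}$ for all $n\ge1$. Admissible $\phi$ for $U$: any function $\phi:U\times(0,R_0)\to(0,\infty)$, increasing in $r$, such that for some constant $C\ge1$, $C^{-1}\mathbb E^x[\tau_{B(x,r)}]\le\phi(x,r)\le C\mathbb E^x[\tau_{B(x,r)}]$ for all $x\in U$ and $0<r<R_0\wedge(C_0\delta_U(x))$. *)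

(* Defs.v *)
From HB Require Import structures.
From mathcomp Require Import all_boot all_order all_algebra.
From mathcomp Require Import all_classical all_reals all_analysis.
From mathcomp Require Import measurable_realfun.
Set Implicit Arguments. Unset Strict Implicit. Unset Printing Implicit Defensive.
Import Order.TTheory GRing.Theory Num.Theory.
Import numFieldNormedType.Exports.
Local Open Scope classical_set_scope.
Local Open Scope ring_scope.

Section Metric.
Context {R : realType} {T : Type} (d : T -> T -> R).

Definition is_metric : Prop :=
  [/\ forall x y, 0 <= d x y, forall x y, d x y = 0 <-> x = y,
      forall x y, d x y = d y x &
      forall x y z, d x z <= d x y + d y z].

Definition mball (x : T) (r : R) : set T := [set y | d x y < r].
Definition cball (x : T) (r : R) : set T := [set y | d x y <= r].

Definition mopen (A : set T) : Prop :=
  forall x, A x -> exists2 r, 0 < r & mball x r `<=` A.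

Definition mseq_cvg (u : nat -> T) (l : T) : Prop :=
  forall e, 0 < e -> exists N, forall n, (N <= n)%N -> d (u n) l < e.

(* compactness (= sequential compactness in a metric space) *)
Definition mcompact (K : set T) : Prop :=
  forall u : nat -> T, (forall n, K (u n)) ->
  exists2 l, K l & exists phi : nat -> nat,
    (forall n m, (n < m)%N -> (phi n < phi m)%N) /\ mseq_cvg (u \o phi) l.

Definition mlocally_compact : Prop :=
  forall x, exists2 r, 0 < r & mcompact (cball x r).

Definition mseparable : Prop :=
  exists D : set T, countable D /\
    forall x e, 0 < e -> exists2 y, D y & d x y < e.
End Metric.

Definition lcs_borel_metric_space {R : realType} {dM : measure_display}
  (M : measurableType dM) (d : M -> M -> R) : Prop :=
  [/\ is_metric d, mlocally_compact d, mseparable d &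
      (@measurable _ M) = <<s mopen d >>].

Definition radon_full_support {R : realType} {dM : measure_display}
  {M : measurableType dM} (d : M -> M -> R)
  (mu : {measure set M -> \bar R}) : Prop :=
  [/\ (forall K, mcompact d K -> (mu K < +oo)%E),
      (forall A, measurable A ->
         mu A = ereal_inf [set mu V | V in [set V | mopen d V /\ A `<=` V]]),
      (forall V, mopen d V ->
         mu V = ereal_sup [set mu K | K in [set K | mcompact d K /\ K `<=` V]]) &
      (forall A, mopen d A -> A !=set0 -> (0 < mu A)%E)].

(* The cemetery space M_∂ = option M (None = ∂), its topology (one-point     *)
(* compactification) expressed through convergence along a filter.          *)
Section Cemetery.
Context {R : realType} {M : Type} (d : M -> M -> R).

Definition ext0 (f : M -> R) (o : option M) : R :=
  if o is Some y then f y else 0.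

Definition ocvg {I : Type} (F : set_system I) (f : I -> option M)
  (l : option M) : Prop :=
  match l with
  | Some y => forall e, 0 < e -> F [set s | exists2 z, f s = Some z & d z y < e]
  | None => forall K, mcompact d K -> F [set s | forall z, f s = Some z -> ~ K z]
  end.

Definition odist (x : M) (o : option M) : \bar R :=
  if o is Some y then (d x y)%:E else +oo%E.
End Cemetery.

Section Process.
Context {R : realType} {dM : measure_display} {M : measurableType dM}
  (d : M -> M -> R)
  {dO : measure_display} {Om : measurableType dO}
  (Ft : R -> set_system Om) (X : R -> Om -> option M)
  (theta : R -> Om -> Om) (P : option M -> probability Om R).

Local Open Scope ereal_scope.

Definition lifetime (w : Om) : \bar R :=
  ereal_inf [set t%:E | t in [set t : R | (0 < t)%R /\ X t w = None]].

Definition exit_time (D : set M) (w : Om) : \bar R :=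
  ereal_inf [set t%:E | t in
    [set t : R | (0 < t)%R /\ ~ (exists2 y, X t w = Some y & D y)]].

Definition Etau (x : M) (r : R) : \bar R :=
  \int[P (Some x)]_w exit_time (mball d x r) w.

Definition stopping_time (T : Om -> \bar R) : Prop :=
  (forall w, 0 <= T w) /\
  (forall t : R, (0 <= t)%R -> Ft t [set w | T w <= t%:E]).

Definition F_at (T : Om -> \bar R) : set_system Om :=
  [set A | measurable A /\
     forall t : R, (0 <= t)%R -> Ft t (A `&` [set w | T w <= t%:E])].

(* X_{s-} (left limit in M_∂ when it exists, ∂ otherwise) *)
Definition Xleft (s : R) (w : Om) : option M :=
  xget None [set l | ocvg d (s^'-) (fun u => X u w) l].

(* Borel standard Markov process (Blumenthal--Getoor) *)
Definition borel_standard_process : Prop :=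
   [/\ (forall t, sigma_algebra setT (Ft t) /\ Ft t `<=` measurable),
       (forall s t : R, (0 <= s)%R -> (s <= t)%R -> Ft s `<=` Ft t),
       (forall t : R, (0 <= t)%R -> Ft t = \bigcap_(s in [set s | (t < s)%R]) Ft s) &
       (forall N, (exists2 A, measurable A /\ (forall x, P x A = 0) & N `<=` A) ->
          forall t : R, (0 <= t)%R -> Ft t N)] /\
   (forall t : R, (0 <= t)%R ->
      (forall B, measurable B -> Ft t [set w | exists2 y, X t w = Some y & B y]) /\
      Ft t [set w | X t w = None]) /\
   (forall (t s : R) w, (0 <= t)%R -> (0 <= s)%R -> X s (theta t w) = X (s + t) w) /\
   (forall A, measurable A -> measurable_fun setT (fun y : M => P (Some y) A)) /\
   (forall x, P x [set w | X 0 w = x] = 1) /\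
   (forall w (t s : R), (0 <= t)%R -> (t <= s)%R -> X t w = None -> X s w = None) /\
   (forall w (t : R), (0 <= t)%R -> ocvg d (t^'+) (fun s => X s w) (X t w)) /\
   (forall x, {ae P x, forall w, forall t : R, (0 < t)%R -> t%:E < lifetime w ->
        exists y, ocvg d (t^'-) (fun s => X s w) (Some y)}) /\
   (forall T, stopping_time T -> forall A, F_at T A -> forall s : R, (0 <= s)%R ->
    forall f : M -> R, measurable_fun setT f -> (exists c, forall y, (`|f y| <= c)%R) ->
    forall x,
      \int[P x]_(w in A `&` [set w | T w < +oo]) (ext0 f (X (fine (T w) + s)%R w))%:E
      = \int[P x]_(w in A `&` [set w | T w < +oo])
            (\int[P (X (fine (T w)) w)]_v (ext0 f (X s v))%:E)) /\
   (forall (Tn : nat -> Om -> \bar R) (T : Om -> \bar R),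
      (forall n, stopping_time (Tn n)) -> stopping_time T ->
      (forall n w, Tn n w <= Tn n.+1 w) ->
      (forall w, T w = ereal_sup (range (fun n => Tn n w))) ->
      forall x, {ae P x, forall w, T w < lifetime w ->
        ocvg d \oo (fun n => X (fine (Tn n w)) w) (X (fine (T w)) w)}).

(* Levy system (J(x,dy), ds); J(x,.) on M_∂ is encoded by its restriction  *)
(* Jm x to M and its mass kill x = J(x,{∂}) at the cemetery.                *)
Definition levy_system (Jm : M -> {measure set M -> \bar R}) (kill : M -> \bar R)
  : Prop :=
  [/\ (forall A, measurable A -> measurable_fun setT (fun x => Jm x A)),
      measurable_fun setT kill, (forall x, 0 <= kill x) &
      forall (F1 : M * M -> \bar R) (F2 : M -> \bar R),
        measurable_fun setT F1 -> measurable_fun setT F2 ->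
        (forall p, 0 <= F1 p) -> (forall x, 0 <= F2 x) ->
        (forall x, F1 (x, x) = 0) ->
        let F (a b : option M) : \bar R :=
          match a, b with
          | Some x, Some y => F1 (x, y)
          | Some x, None => F2 x
          | None, _ => 0
          end in
        let JF (o : option M) : \bar R :=
          match o with
          | Some x => \int[Jm x]_y F1 (x, y) + F2 x * kill x
          | None => 0
          end in
        forall (z : M) (t : R), (0 < t)%R ->
          \int[P (Some z)]_w (\esum_(s in [set s : R | (0 < s <= t)%R])
                                  F (Xleft s w) (X s w))
          = \int[P (Some z)]_w
              (\int[lebesgue_measure]_(s in [set s : R | (0 <= s <= t)%R]) JF (X s w))].

Definition deltaU (U : set M) (x : M) : \bar R :=
  ereal_inf [set (d x y)%:E | y in ~` U].

Definition small_radius (U : set M) (R0 C0 : R) (x : M) (r : R) : Prop :=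
  [/\ (0 < r)%R, (r < R0)%R & r%:E < C0%:E * deltaU U x].

Definition conditions_A (Jm : M -> {measure set M -> \bar R}) (kill : M -> \bar R)
  (U : set M) (R0 C0 : R) : Prop :=
  [/\ (0 < R0)%R, (0 < C0)%R, (C0 < 1)%R &
   exists C1 C2 C3 C4 C5 C6 C7 : R,
   [/\ (1 < C1)%R /\ (0 < C2)%R /\ (0 < C3)%R, (0 < C4)%R /\ (0 < C5)%R,
       (0 < C6)%R /\ (0 < C7)%R &
    forall x r, U x -> small_radius U R0 C0 x r ->
    [/\
        (forall y, mball d x r y ->
           (C1^-1)%:E * Etau y r <= Etau x r /\ Etau x r <= C1%:E * Etau y r),
        (Etau x @ 0%R^'+ --> 0) /\ Etau x r <= C2%:E * Etau x (r / 2),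
        Jm x (~` mball d x r) + kill x <= C3%:E * (Etau x r)^-1 &
        (forall n : nat, (1 <= n)%N ->
           (C4 * expR (- C5 * n%:R))%:E
             <= P (Some x) [set w | n%:R%:E * Etau x r <= exit_time (mball d x r) w]
           /\ P (Some x) [set w | n%:R%:E * Etau x r <= exit_time (mball d x r) w]
             <= (C6 * expR (- C7 * n%:R))%:E)]]].

Definition admissible (U : set M) (R0 C0 : R) (phi : M -> R -> R) : Prop :=
  [/\ (forall x r, U x -> (0 < r)%R -> (r < R0)%R -> (0 < phi x r)%R),
      (forall x r s, U x -> (0 < r)%R -> (r <= s)%R -> (s < R0)%R ->
         (phi x r <= phi x s)%R) &
      exists2 C : R, (1 <= C)%R &
        forall x r, U x -> small_radius U R0 C0 x r ->
          (C^-1)%:E * Etau x r <= (phi x r)%:E /\ (phi x r)%:E <= C%:E * Etau x r].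

Definition sup_disp (x : M) (w : Om) (t : R) : \bar R :=
  ereal_sup [set odist d x (X s w) | s in [set s : R | (0 < s <= t)%R]].

Definition lil_liminf (phi : M -> R -> R) (x : M) (w : Om) : \bar R :=
  limf_einf (fun t : R =>
     ((phi x (fine (sup_disp x w t))) / (t / ln `|ln t|))%:E) 0%R^'+.

End Process.

(* Main.v *)
Require Import Defs.
From HB Require Import structures.
From mathcomp Require Import all_boot all_order all_algebra.
From mathcomp Require Import all_classical all_reals all_analysis.
From mathcomp Require Import measurable_realfun.
From mathcomp Require Import lra ring zify.
Set Implicit Arguments. Unset Strict Implicit. Unset Printing Implicit Defensive.
Import Order.TTheory GRing.Theory Num.Theory.
Import numFieldNormedType.Exports.
Local Open Scope classical_set_scope.
Local Open Scope ring_scope.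

(* Let E(r) be the mean exit time of B(x,r), comparable to phi(x,r).
   Lower bound: at radii with E(r_k) ~ e^-k the upper tail in (A4) makes the
   events {tau(B(x,r_k)) >= c log k E(r_k)} summable, and Borel-Cantelli applies.
   Upper bound: at radii with E(r_k) ~ e^(-B k^2) and times t_k ~ log k E(r_k),
   the lower tail in (A4) and the Markov property at t_{k+1} give conditional
   probability at least c/k of not escaping during [t_{k+1}, t_k], so this
   happens infinitely often.  Leaving early is summable: to reach distance r
   before a time t << E(r), the path either makes N successive moves between
   annuli, each of conditional probability at most 1 - c, or has a large jump,
   which the Levy system and (A3) control.
   The liminf is constant by Blumenthal's zero-one law. *)

(** Exit times are infima over uncountably many times, so even their measurability needs an
    argument; it rests on quasi-left-continuity. The Markov property is applied at deterministic
    times, so the N successive moves are counted along dyadic grids, split by the first grid index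
    at which a chain is complete, and the mesh then tends to 0. The Lévy system sees a jump through
    the left limit before it, but a jump over an annulus may be the one that kills the process,
    where no left limit is given. A path without left limit oscillates forever inside a relatively
    compact ball, and the chain bound with arbitrarily many moves makes this a null event. Cutting a
    ball into 2N+1 annuli costs C2^(N+4) in the time scale, by N+4 uses of doubling. With N = k the
    chain term is geometric in k, and the factor C2^k is absorbed by the superexponential scales
    because B = ln C2 + 1. All constants come from C and C1, ..., C7 only, which makes the final
    bounds uniform in x. *)

(** * Sigma-algebras under connectives and countable quantifiers *)

Section SigmaPredicates.
Context {T : Type} (G : set_system T) (sG : sigma_algebra setT G).

(** The closure lemmas are stated for set-builder predicates, so that membership of an event is
    proved along its syntax. [G] is a bare [set_system] because it is instantiated by [Ft t], by
    [path_event] and by [measurable]. *)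
Lemma sigC A : G A -> G [set w | ~ A w].
Proof. by case: sG => _ /(_ A) h _ /h; rewrite setTD. Qed.

Lemma sig_ex (F : nat -> set T) :
  (forall n, G (F n)) -> G [set w | exists n, F n w].
Proof.
case: sG => _ _ h /h; congr G; apply/seteqP; split=> w /=.
  by case=> n _ ?; exists n.
by case=> n ?; exists n.
Qed.

Lemma sig_all (F : nat -> set T) :
  (forall n, G (F n)) -> G [set w | forall n, F n w].
Proof.
move=> GF; have := sigC (sig_ex (fun n => sigC (GF n))).
congr G; apply/seteqP; split=> w /=.
  by move=> h n; apply: contrapT => nF; apply: h; exists n.
by move=> h [n]; apply.
Qed.

Lemma sig_cst (Q : Prop) : G [set _ | Q].
Proof.
have [q|nq] := pselect Q.
  have -> : [set _ : T | Q] = [set w | ~ set0 w] by apply/seteqP; split=> w //= _ [].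
  by apply: sigC; case: sG.
by have -> : [set _ : T | Q] = set0 by [apply/seteqP; split]; case: sG.
Qed.

Lemma sigU A B : G A -> G B -> G [set w | A w \/ B w].
Proof.
move=> GA GB; have := @sig_ex (fun n => if n is 0%N then A else B).
have -> : [set w | exists n : nat, (if n is 0%N then A else B) w]
   = [set w | A w \/ B w].
  apply/seteqP; split=> w /=; first by case=> -[|n]; [left|right].
  by case; [exists 0%N|exists 1%N].
by apply; case.
Qed.

Lemma sigI A B : G A -> G B -> G [set w | A w /\ B w].
Proof.
move=> GA GB; have := @sig_all (fun n => if n is 0%N then A else B).
have -> : [set w | forall n : nat, (if n is 0%N then A else B) w]
   = [set w | A w /\ B w].
  apply/seteqP; split=> w /=; last by case=> ? ? [|n].
  by move=> h; split; [exact: (h 0%N)|exact: (h 1%N)].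
by apply; case.
Qed.

Lemma sig_imply A B : G A -> G B -> G [set w | A w -> B w].
Proof.
move=> GA GB; have := sigU (sigC GA) GB; congr G; apply/seteqP; split=> w /=.
  by case.
by move=> h; have [/h|] := pselect (A w); [right|left].
Qed.

(** A side condition on indices, such as a grid time lying below t, becomes available while the
    remaining event is treated. *)
Lemma sig_if (Q : Prop) A : (Q -> G A) -> G [set w | Q /\ A w].
Proof.
move=> h; have [q|nq] := pselect Q; first by apply: sigI (sig_cst _) (h q).
by have -> : [set w | Q /\ A w] = [set _ | False];
  [apply/seteqP; split=> w //= -[]|apply: sig_cst].
Qed.

Lemma sig_when (Q : Prop) A : (Q -> G A) -> G [set w | Q -> A w].
Proof.
move=> h; have [q|nq] := pselect Q; first by apply: sig_imply (sig_cst _) (h q).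
by have -> : [set w | Q -> A w] = [set _ | True];
  [apply/seteqP; split=> w //= _ /nq|apply: sig_cst].
Qed.
End SigmaPredicates.

(** * Cylinder sets and the sigma-algebra of path events *)

Section Cylinders.
Context {R : realType} {dM : measure_display} {M : measurableType dM}.
Implicit Types (l : seq (R * set M)) (p : R -> option M).

(** Times are stored as increments: each entry shifts the path, so that one entry corresponds to one
    application of the Markov property. *)
Fixpoint cyl l p : Prop :=
  if l is (s, B) :: l' then
    (exists2 y, p s = Some y & B y) /\ cyl l' (fun u => p (u + s))
  else True.

Fixpoint admissible_cyl l : Prop :=
  if l is (s, B) :: l' then [/\ 0 <= s, measurable B & admissible_cyl l']
  else True.

Definition cylinders : set_system (R -> option M) :=
  [set L | exists2 l, admissible_cyl l & L = cyl l].

Definition path_event : set_system (R -> option M) := <<s cylinders >>.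

Lemma path_event_sigma : sigma_algebra setT path_event.
Proof. exact: smallest_sigma_algebra. Qed.

(** Two lists of increments interleave: the smaller head is emitted and subtracted from the other
    head. This makes the cylinders a pi-system. *)
Lemma merge_cyl l1 l2 : admissible_cyl l1 -> admissible_cyl l2 ->
  exists2 l, admissible_cyl l & forall p, cyl l p <-> cyl l1 p /\ cyl l2 p.
Proof.
have [n] := ubnP (size l1 + size l2)%N.
elim: n l1 l2 => // n IH [|[s B] l1] [|[t C] l2] //.
- by exists [::] => // q /=; split.
- by exists ((t, C) :: l2) => // q; split=> // -[].
- by exists ((s, B) :: l1) => // q; split=> // -[].
move=> /= lt_n [s0 mB g1] [t0 mC g2].
have [st|/ltW ts] := leP s t.
  have [|||l gl lE] := IH l1 ((t - s, C) :: l2) => //=.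
    by split=> //; rewrite subr_ge0.
  exists ((s, B) :: l) => // p /=; rewrite lE /= subrK.
  have -> : (fun u => p (u + (t - s) + s)) = (fun u => p (u + t)).
    by apply/funext => u; rewrite -addrA subrK.
  tauto.
have [|||l gl lE] := IH ((s - t, B) :: l1) l2 => //=.
  by move: lt_n; rewrite addnS ltnS.
  by split=> //; rewrite subr_ge0.
exists ((t, C) :: l) => // p /=; rewrite lE /= subrK.
have -> : (fun u => p (u + (s - t) + t)) = (fun u => p (u + s)).
  by apply/funext => u; rewrite -addrA subrK.
tauto.
Qed.

Lemma cylinders_setI : setI_closed cylinders.
Proof.
move=> _ _ [l1 g1 ->] [l2 g2 ->]; have [l g lE] := merge_cyl g1 g2.
by exists l => //; apply/seteqP; split=> p /= /lE.
Qed.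

Lemma path_event_at s B : 0 <= s -> measurable B ->
  path_event [set p | exists2 y, p s = Some y & B y].
Proof.
move=> s0 mB; apply: sub_sigma_algebra; exists [:: (s, B)] => //.
by apply/seteqP; split=> p //= -[].
Qed.
End Cylinders.

(** The integral of a nonnegative function is a supremum over simple functions below it, so
    monotonicity asks for no measurability. This serves integrands such as the sum over jumps, whose
    measurability is not established. *)
Lemma ge0_le_integral_nomeas d (T : measurableType d) (R : realType)
    (mu : {measure set T -> \bar R}) (D : set T) (f g : T -> \bar R) :
  (forall x, D x -> (0 <= f x)%E) -> (forall x, D x -> (f x <= g x)%E) ->
  (\int[mu]_(x in D) f x <= \int[mu]_(x in D) g x)%E.
Proof.
move=> f0 fg; have g0 x : D x -> (0 <= g x)%E.
  by move=> Dx; apply: le_trans (f0 _ Dx) (fg _ Dx).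
rewrite !ge0_integralE //; apply: le_ereal_sup => _ [h /= hf <-].
exists h => // x; apply: le_trans (hf x) _.
by rewrite /patch; case: ifPn => // /set_mem; exact: fg.
Qed.

(** * The Markov property for path events *)

Section MarkovProperty.
Context {R : realType} {dM : measure_display} {M : measurableType dM}
  (d : M -> M -> R)
  {dO : measure_display} {Om : measurableType dO}
  (Ft : R -> set_system Om) (X : R -> Om -> option M)
  (theta : R -> Om -> Om) (P : option M -> probability Om R).
Context (bsp : borel_standard_process d Ft X theta P).

Lemma filtration_sigma t : sigma_algebra setT (Ft t).
Proof. by case: bsp => -[h _ _ _] _; case: (h t). Qed.

Lemma filtration_measurable t A : Ft t A -> measurable A.
Proof. by case: bsp => -[h _ _ _] _; case: (h t) => _; apply. Qed.

Lemma filtration_mono s t A : 0 <= s -> s <= t -> Ft s A -> Ft t A.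
Proof. by case: bsp => -[_ h _ _] _ s0 st; apply: h. Qed.

Lemma filtration_right_continuous t A : 0 <= t ->
  (forall s, t < s -> Ft s A) -> Ft t A.
Proof. by case: bsp => -[_ _ h _] _ t0 hs; rewrite h // => s /= /hs. Qed.

Lemma filtration_null N A t : 0 <= t -> measurable A ->
  (forall x, P x A = 0%E) -> N `<=` A -> Ft t N.
Proof. by case: bsp => -[_ _ _ h] _ t0 mA PA NA; apply: h => //; exists A. Qed.

Lemma filtration_at s t B : 0 <= s -> s <= t -> measurable B ->
  Ft t [set w | exists2 y, X s w = Some y & B y].
Proof.
case: bsp => _ [h _] s0 st mB; apply: (filtration_mono s0 st).
by case: (h s s0) => hB _; exact: hB.
Qed.

Lemma filtration_None s t : 0 <= s -> s <= t -> Ft t [set w | X s w = None].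
Proof.
case: bsp => _ [h _] s0 st; apply: (filtration_mono s0 st).
by case: (h s s0).
Qed.

Lemma measurable_None s : 0 <= s -> measurable [set w | X s w = None].
Proof. by move=> s0; exact: filtration_measurable (filtration_None s0 (lexx s)). Qed.

Lemma measurable_at s B : 0 <= s -> measurable B ->
  measurable [set w | exists2 y, X s w = Some y & B y].
Proof. by move=> s0 mB; exact: filtration_measurable (filtration_at s0 (lexx s) mB). Qed.

Lemma transition_measurable A : measurable A ->
  measurable_fun setT (fun y : M => P (Some y) A).
Proof. by case: bsp => _ [_ [_ [h _]]]; exact: h. Qed.

Lemma start_at x : P x [set w | X 0 w = x] = 1%E.
Proof. by case: bsp => _ [_ [_ [_ [h _]]]]. Qed.

Lemma absorbed w t s : 0 <= t -> t <= s -> X t w = None -> X s w = None.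
Proof. by case: bsp => _ [_ [_ [_ [_ [h _]]]]]; exact: h. Qed.

Lemma paths_right_continuous w t : 0 <= t -> ocvg d (t^'+) (fun s => X s w) (X t w).
Proof. by case: bsp => _ [_ [_ [_ [_ [_ [h _]]]]]]; exact: h. Qed.

Lemma quasi_left_continuous (Tn : nat -> Om -> \bar R) (T : Om -> \bar R) :
  (forall n, stopping_time Ft (Tn n)) -> stopping_time Ft T ->
  (forall n w, (Tn n w <= Tn n.+1 w)%E) ->
  (forall w, T w = ereal_sup (range (fun n => Tn n w))) ->
  forall x, {ae P x, forall w, (T w < lifetime X w)%E ->
    ocvg d \oo (fun n => X (fine (Tn n w)) w) (X (fine (T w)) w)}.
Proof. by case: bsp => _ [_ [_ [_ [_ [_ [_ [_ [_ h]]]]]]]]; exact: h. Qed.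

Lemma measurable_fun_at t (F : M -> \bar R) c : 0 <= t ->
  measurable_fun setT F -> measurable_fun setT (fun w => oapp F c (X t w)).
Proof.
move=> t0 mF _ Y mY; rewrite setTI.
have -> : (fun w => oapp F c (X t w)) @^-1` Y =
  [set w | exists2 y, X t w = Some y & (F @^-1` Y) y] `|`
  ([set w | X t w = None] `&` [set _ | Y c]).
  apply/seteqP; split=> w /=.
    by case E : (X t w) => [y|] /= h; [left; exists y|right].
  by case=> [[y -> //]|[-> //]].
apply: measurableU; last apply: measurableI.
- by apply: measurable_at => //; rewrite -[_ @^-1` _]setTI; exact: mF.
- exact: measurable_None.
- by apply: sig_cst; exact: sigma_algebra_measurable.
Qed.

Lemma measurable_kernel_at t A : 0 <= t -> measurable A ->
  measurable_fun setT (fun w => P (X t w) A).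
Proof.
move=> t0 mA.
have -> : (fun w => P (X t w) A) =
    (fun w => oapp (fun y => P (Some y) A) (P None A) (X t w)).
  by apply/funext => w; case: (X t w).
by apply: measurable_fun_at => //; exact: transition_measurable.
Qed.

(** The strong Markov hypothesis at the constant stopping time t. *)
Lemma simple_markov t A s (f : M -> R) x : 0 <= t -> Ft t A -> 0 <= s ->
  measurable_fun setT f -> (exists c, forall y, `|f y| <= c) ->
  (\int[P x]_(w in A) (ext0 f (X (t + s) w))%:E =
   \int[P x]_(w in A) \int[P (X t w)]_v (ext0 f (X s v))%:E)%E.
Proof.
move=> t0 FA s0 mf bf.
case: bsp => _ [_ [_ [_ [_ [_ [_ [_ [h _]]]]]]]].
have := h (fun=> t%:E) _ A _ s s0 f mf bf x.
rewrite [A `&` _](_ : _ = A); last first.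
  by apply/seteqP; split=> w; [case|move=> Aw; split=> //=; rewrite ltry].
apply.
  split=> [w|u u0]; first by rewrite lee_fin.
  exact: sig_cst (filtration_sigma u) _.
split=> [|u u0]; first exact: filtration_measurable FA.
have [tu|ut] := leP t u.
  rewrite [_ `&` _](_ : _ = A); first exact: filtration_mono FA.
  by apply/seteqP; split=> w; [case|move=> Aw; split=> //=; rewrite lee_fin].
rewrite [_ `&` _](_ : _ = [set _ | False]); first exact: sig_cst (filtration_sigma u) _.
by apply/seteqP; split=> w //= [_]; rewrite lee_fin leNgt ut.
Qed.

Definition markov_at (L : set (R -> option M)) : Prop :=
  (forall t, 0 <= t -> measurable [set w | L (fun u => X (u + t) w)]) /\
  (forall t A x, 0 <= t -> Ft t A ->
    P x (A `&` [set w | L (fun u => X (u + t) w)]) =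
    (\int[P x]_(w in A) P (X t w) [set v | L (fun u => X u v)])%E).

Lemma path_shift0 w : (fun u => X (u + 0) w) = (fun u => X u w).
Proof. by apply/funext => u; rewrite addr0. Qed.

(** Induction on the list: the tail is handled at time t + s, and what remains is an integral of a
    function of the state at that time, to which the simple Markov property at t applies. *)
Lemma cyl_markov l : admissible_cyl l -> markov_at (cyl l).
Proof.
elim: l => [_|[s B] l IH /= [s0 mB /IH [ml El]]].
  split=> [t t0|t A x t0 FA] /=; first exact: measurableT.
  rewrite setIT.
  rewrite (_ : (fun w => _) = cst 1%E); last first.
    by apply/funext => w; exact: probability_setT.
  rewrite integral_cst ?mul1e //; exact: filtration_measurable FA.
have shiftE t w : (fun u => X (u + s + t) w) = (fun u => X (u + (s + t)) w).
  by apply/funext => u; rewrite addrA.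
have mBl t : 0 <= t -> measurable ([set w | exists2 y, X (s + t) w = Some y & B y]
     `&` [set w | cyl l (fun u => X (u + s + t) w)]).
  move=> t0; apply: measurableI; first by apply: measurable_at => //; exact: addr_ge0.
  rewrite [X in measurable X](_ : _ = [set w | cyl l (fun u => X (u + (s + t)) w)]).
    by apply: ml; exact: addr_ge0.
  by apply/seteqP; split=> w /=; rewrite shiftE.
have mC : measurable [set v | cyl l (fun u => X u v)].
  by have := ml 0 (lexx 0); under eq_fun do rewrite path_shift0.
(* Probability of the tail from y, cut off outside [B], as a bounded real function: the Markov
   hypothesis is stated for these. *)
pose f (y : M) : R := fine (((fun y => P (Some y) [set v | cyl l (fun u => X u v)]) \_ B) y).
have f01 y : 0 <= f y <= 1.
  rewrite /f /patch; case: ifP => _ /=; last by rewrite lexx ler01.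
  rewrite -!lee_fin fineK ?measure_ge0 ?probability_le1 //.
  exact: fin_num_measure.
have fE y : (f y)%:E = ((fun y => P (Some y) [set v | cyl l (fun u => X u v)]) \_ B) y.
  rewrite /f /patch; case: ifP => // _; rewrite fineK //.
  exact: fin_num_measure.
have mf : measurable_fun setT f.
  apply: (measurableT_comp (fine_measurable measurableT)).
  apply/(measurable_restrictT _ _).1 => //.
  apply: measurable_funTS; exact: transition_measurable.
have fX o : (ext0 f (X s o))%:E =
  ((fun w => P (X s w) [set v | cyl l (fun u => X u v)]) \_
     [set w | exists2 y, X s w = Some y & B y]) o.
  rewrite /patch; case: ifPn => [/set_mem /= [y -> By] /=|/negP nB].
    by rewrite fE /patch mem_set.
  case E : (X s o) => [y|] //=; rewrite fE /patch memNset // => By.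
  by apply: nB; apply: mem_set; exists y.
have Eg x : P x [set v | (exists2 y, X s v = Some y & B y) /\
     cyl l (fun u => X (u + s) v)] = (\int[P x]_v (ext0 f (X s v))%:E)%E.
  rewrite -[LHS]/(P x ([set v | exists2 y, X s v = Some y & B y] `&`
    [set v | cyl l (fun u => X (u + s) v)])).
  rewrite El //; last exact: filtration_at.
  rewrite -[X in integral _ X _]setTI integral_mkcondr.
  by apply: eq_integral => v _; rewrite fX.
split=> [t t0|t A x t0 FA] /=; first exact: mBl.
rewrite -[X in P x X]/(A `&` ([set w | exists2 y, X (s + t) w = Some y & B y] `&`
     [set w | cyl l (fun u => X (u + s + t) w)])) setIA.
under [X in _ `&` X]eq_set do rewrite shiftE.
rewrite El; last 2 first.
- exact: addr_ge0.
- apply: sigI; first exact: filtration_sigma.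
    by apply: filtration_mono FA => //; rewrite lerDr.
  by apply: filtration_at => //; exact: addr_ge0.
rewrite integral_mkcondr.
transitivity (\int[P x]_(w in A) (ext0 f (X (t + s) w))%:E)%E.
  apply: eq_integral => w _; rewrite addrC.
  rewrite /patch; case: ifPn => [/set_mem /= [y -> By] /=|/negP nB].
    by rewrite fE /patch mem_set.
  case E : (X (t + s) w) => [y|] //=; rewrite fE /patch memNset // => By.
  by apply: nB; apply: mem_set; exists y => //; rewrite addrC.
rewrite simple_markov //; last by exists 1 => y; have /andP[? ?] := f01 y; rewrite ger0_norm.
by apply: eq_integral => w _; rewrite Eg.
Qed.

(** Both sides of the Markov identity are countably additive in [L], so the sets satisfying it form
    a lambda-system containing the pi-system of cylinders. *)
Lemma path_event_markov L : path_event L -> markov_at L.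
Proof.
apply: (lambda_system_subset (@cylinders_setI _ _ _)) => //; last first.
  by move=> _ [l gl ->]; exact: cyl_markov.
apply/dynkin_lambda_system; split.
- exact: (@cyl_markov [::] Logic.I).
- move=> K [mK EK]; split=> [t t0|t A x t0 FA].
    exact: measurableC (mK t t0).
  have mA := filtration_measurable FA.
  have mK0 : measurable [set v | K (fun u => X u v)].
    by have := mK 0 (lexx 0); under eq_fun do rewrite path_shift0.
  set C := [set w | K (fun u => X (u + t) w)].
  have mAC : measurable (A `&` C) by apply: measurableI => //; exact: mK.
  have fAC : P x (A `&` C) \is a fin_num by exact: fin_num_measure.
  (* Adding the finite mass of the intersection of [A] and [C] to both sides reduces the complement
     to the whole space. *)
  rewrite -[LHS](addeK _ fAC) -[RHS](addeK _ fAC); congr (_ - _)%E.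
  rewrite [in RHS]EK // -ge0_integralD //; last 2 first.
  - by apply: measurable_funTS; apply: measurable_kernel_at => //; exact: measurableC.
  - by apply: measurable_funTS; exact: measurable_kernel_at.
  rewrite -measureU //; last 2 first.
  - by apply: measurableI => //; exact: measurableC (mK t t0).
  - by apply/seteqP; split=> w //= -[[_ nC] [_ /nC]].
  rewrite -setIUr [X in A `&` X](_ : _ = setT); last first.
    by apply/seteqP; split=> w // _; have [|] := pselect (C w); [right|left].
  rewrite setIT -[LHS]mul1e -integral_cst //; apply: eq_integral => w _ /=.
  rewrite -measureU //; last 2 first.
  - exact: measurableC.
  - by apply/seteqP; split=> v //= -[nC /nC].
  transitivity (P (X t w) setT); first by rewrite probability_setT.
  by congr (P _ _); apply/seteqP; split=> v // _; have [|] := pselect (K (fun u => X u v));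
    [right|left].
- move=> K tK HK; split=> [t t0|t A x t0 FA].
    rewrite [X in measurable X](_ : _ =
      \bigcup_n [set w | K n (fun u => X (u + t) w)]) //.
    by apply: bigcupT_measurable => n; case: (HK n) => h _; exact: h.
  have mA := filtration_measurable FA.
  have mK0 n : measurable [set v | K n (fun u => X u v)].
    by case: (HK n) => /(_ 0 (lexx 0)); under eq_fun do rewrite path_shift0.
  have mKt n : measurable [set v | K n (fun u => X (u + t) v)] by case: (HK n) => h _; exact: h.
  rewrite [X in P x X](_ : _ = \bigcup_n (A `&` [set w | K n (fun u => X (u + t) w)])); last first.
    by rewrite -setI_bigcupr.
  rewrite measure_semi_bigcup; last 3 first.
  - by move=> n; exact: measurableI.
  - apply/trivIsetP => i j _ _ ij; apply/seteqP; split=> w //= -[[_ Ki] [_ Kj]].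
    by move/trivIsetP : tK => /(_ i j Logic.I Logic.I ij) /seteqP[/(_ _ (conj Ki Kj))].
  - by apply: bigcupT_measurable => n; exact: measurableI.
  transitivity (\sum_(0 <= i <oo) \int[P x]_(w in A)
      P (X t w) [set v | K i (fun u => X u v)])%E.
    by apply: eq_eseriesr => i _; exact: (proj2 (HK i)).
  rewrite -integral_nneseries //; last first.
    by move=> n; apply: measurable_funTS; exact: measurable_kernel_at.
  apply: eq_integral => w _.
  rewrite -[RHS]/(P (X t w) (\bigcup_n [set v | K n (fun u => X u v)])).
  rewrite measure_semi_bigcup //.
  - apply/trivIsetP => i j _ _ ij; apply/seteqP; split=> v //= -[Ki Kj].
    by move/trivIsetP : tK => /(_ i j Logic.I Logic.I ij) /seteqP[/(_ _ (conj Ki Kj))].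
  - exact: bigcupT_measurable.
Qed.

Lemma path_event_measurable L t : path_event L -> 0 <= t ->
  measurable [set w | L (fun u => X (u + t) w)].
Proof. by move=> /path_event_markov[h _] t0; exact: h. Qed.

Lemma path_event_measurable0 L : path_event L ->
  measurable [set w | L (fun u => X u w)].
Proof.
by move=> /path_event_measurable /(_ (lexx 0)); under eq_fun do rewrite path_shift0.
Qed.

Lemma markov_le t A L x (W : set (option M)) (q : \bar R) :
  0 <= t -> Ft t A -> path_event L -> (0 <= q)%E ->
  (forall w, A w -> W (X t w)) ->
  (forall o, W o -> (P o [set v | L (fun u => X u v)] <= q)%E) ->
  (P x (A `&` [set w | L (fun u => X (u + t) w)]) <= q * P x A)%E.
Proof.
move=> t0 FA pL q0 AW Wq; have [_ ->] // := path_event_markov pL.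
rewrite -integral_cst; last exact: filtration_measurable FA.
by apply: ge0_le_integral_nomeas => // w /AW /Wq.
Qed.

End MarkovProperty.

(** * One-sided neighbourhoods and dyadic times *)

Section OneSidedNeighbourhoods.
Context {R : realType}.

Lemma at_rightP (t : R) (A : set R) :
  (t^'+)%classic A <-> exists2 e, 0 < e & forall s, t < s -> s < t + e -> A s.
Proof.
split.
  move=> /nbhs_ballP[e /= e0 h]; exists e => // s ts se; apply: h => //=.
  by rewrite /ball /= distrC ger0_norm ?subr_ge0 ?ltW // ltrBlDl.
case=> e e0 h; apply/nbhs_ballP; exists e => // s /=; rewrite /ball /= => ab ts.
by apply: h => //; move: ab; rewrite distrC ger0_norm ?subr_ge0 ?ltW // ltrBlDl.
Qed.

Lemma at_leftP (t : R) (A : set R) :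
  (t^'-)%classic A <-> exists2 e, 0 < e & forall s, t - e < s -> s < t -> A s.
Proof.
split.
  move=> /nbhs_ballP[e /= e0 h]; exists e => // s se st; apply: h => //=.
  by rewrite /ball /= ger0_norm ?subr_ge0 ?ltW // ltrBlDl -ltrBlDr.
case=> e e0 h; apply/nbhs_ballP; exists e => // s /=; rewrite /ball /= => ab ts.
by apply: h => //; move: ab; rewrite ger0_norm ?subr_ge0 ?ltW // ltrBlDl -ltrBlDr.
Qed.

Lemma exists_halfpow_lt (e : R) : 0 < e ->
  exists m, forall n, (m <= n)%N -> 2^-1 ^+ n < e.
Proof.
move=> e0.
have : (fun n : nat => 2^-1 ^+ n : R) @ \oo --> (0 : R).
  by apply: cvg_expr; rewrite ger0_norm ?invr_ge0 // invf_lt1 // ltr1n.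
move=> /cvgr_lt /(_ e e0) [m _ h]; exists m => n mn.
exact: h.
Qed.

Definition dyadic (m k : nat) : R := k%:R * 2^-1 ^+ m.

Lemma dyadic_ge0 m k : 0 <= dyadic m k.
Proof. by rewrite mulr_ge0 // exprn_ge0 // invr_ge0. Qed.

Lemma dyadicD m j k : dyadic m (j + k) = dyadic m j + dyadic m k.
Proof. by rewrite /dyadic natrD mulrDl. Qed.

Lemma lt_dyadic m j k : (dyadic m j < dyadic m k) = (j < k)%N.
Proof. by rewrite /dyadic ltr_pM2r ?ltr_nat // exprn_gt0 // invr_gt0. Qed.

Lemma le_dyadic m j k : (dyadic m j <= dyadic m k) = (j <= k)%N.
Proof. by rewrite /dyadic ler_pM2r ?ler_nat // exprn_gt0 // invr_gt0. Qed.

Lemma dyadic_ceil m (s : R) : 0 <= s ->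
  exists k, s < dyadic m k /\ dyadic m k <= s + 2^-1 ^+ m.
Proof.
move=> s0; have h2 : (0 : R) < 2^-1 ^+ m by rewrite exprn_gt0 // invr_gt0.
have s2 : 0 <= s / 2^-1 ^+ m by rewrite divr_ge0 // ltW.
(* The successor keeps the left inequality strict even when s lies on the grid. *)
exists (Num.truncn (s / 2^-1 ^+ m)).+1.
have /andP[h1 h3] := truncn_itv s2.
split; rewrite /dyadic; first by rewrite -ltr_pdivrMr.
rewrite -natr1 mulrDl mul1r lerD2r.
by rewrite -ler_pdivlMr.
Qed.

Lemma dyadic_dense (a b : R) : 0 <= a -> a < b ->
  exists m k, a < dyadic m k /\ dyadic m k < b.
Proof.
move=> a0 ab; have [m hm] := @exists_halfpow_lt (b - a) ltac:(by rewrite subr_gt0).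
have [k [h1 h2]] := dyadic_ceil m a0; exists m, k; split => //.
apply: le_lt_trans h2 _; rewrite -ltrBrDl; exact: hm.
Qed.
End OneSidedNeighbourhoods.

(** * Distance events and right-continuous paths *)

Section MetricEvents.
Context {R : realType} {dM : measure_display} {M : measurableType dM}
  (d : M -> M -> R).
Context (lcs : lcs_borel_metric_space d).

Implicit Types (s t u v r e : R) (x y z : M).

Lemma dist_ge0 x y : 0 <= d x y. Proof. by case: lcs => -[]. Qed.
Lemma distxx x : d x x = 0. Proof. by case: lcs => -[_ h _ _] _ _ _; apply/h. Qed.
Lemma dist_sym x y : d x y = d y x. Proof. by case: lcs => -[]. Qed.
Lemma dist_triangle z x y : d x y <= d x z + d z y. Proof. by case: lcs => -[]. Qed.
Lemma dist_eq0 x y : d x y = 0 -> x = y.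
Proof. by case: lcs => -[_ h _ _] _ _ _ /h. Qed.

Lemma mopen_measurable A : mopen d A -> measurable A.
Proof. by case: lcs => _ _ _ -> ?; exact: sub_sigma_algebra. Qed.

Lemma mopen_ball x r : mopen d (mball d x r).
Proof.
move=> y /= xy; exists (r - d x y) => [|z /= yz]; first by rewrite subr_gt0.
by move: yz; rewrite /mball /=; have := dist_triangle y x z; lra.
Qed.

Lemma measurable_mball x r : measurable (mball d x r).
Proof. exact/mopen_measurable/mopen_ball. Qed.

Lemma measurable_cball x r : measurable [set y | d x y <= r].
Proof.
rewrite [X in measurable X](_ : _ = ~` [set y | r < d x y]).
  apply: measurableC; apply: mopen_measurable => y /= ry.
  exists (d x y - r) => [|z /= yz]; first by rewrite subr_gt0.
  by move: yz; rewrite /mball /=; have := dist_triangle z x y; rewrite (dist_sym z y); lra.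
by apply/seteqP; split=> y /=; rewrite leNgt => /negP.
Qed.

Lemma dense_sequence : exists z : nat -> M, forall x e, 0 < e -> exists n, d x (z n) < e.
Proof.
case: lcs => _ _ [D [/countable_injP[f fi] hD]] _.
exists (fun n => xget point [set y | D y /\ f y = n]) => x e e0.
have [y Dy xy] := hD x e e0; exists (f y).
case: xgetP => [z _ [Dz /= fz]|/(_ y)]; last by move=> /= h; case: h.
by rewrite (fi z y) ?inE.
Qed.

(** A move into the cemetery counts as far, a move out of it does not. *)
Definition far (r : R) (a b : option M) : Prop :=
  if a is Some y then (r%:E < odist d y b)%E else False.

Definition observable {T} (G : set_system T) (Y : T -> option M) :=
  forall B, measurable B -> G [set w | exists2 y, Y w = Some y & B y].

Section Observable.
Context {T : Type} (G : set_system T) (sG : sigma_algebra setT G).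

Lemma sig_le_odist Y x r : observable G Y -> G [set w | (odist d x (Y w) <= r%:E)%E].
Proof.
move=> /(_ _ (measurable_cball x r)); congr G; apply/seteqP; split=> w /=.
  by case=> y ->.
by case: (Y w) => [y|] //= h; exists y.
Qed.

Lemma sig_lt_odist Y x r : observable G Y -> G [set w | (r%:E < odist d x (Y w))%E].
Proof.
move=> /(sig_le_odist x r)/(sigC sG); congr G; apply/seteqP; split=> w /=;
  by rewrite ltNge => /negP.
Qed.

Lemma sig_odist_lt Y x r : observable G Y -> G [set w | (odist d x (Y w) < r%:E)%E].
Proof.
move=> /(_ _ (measurable_mball x r)); congr G; apply/seteqP; split=> w /=.
  by case=> y ->.
by case: (Y w) => [y|] //= h; exists y.
Qed.

Lemma sig_odist_ge Y x r : observable G Y -> G [set w | (r%:E <= odist d x (Y w))%E].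
Proof.
move=> /(sig_odist_lt x r)/(sigC sG); congr G; apply/seteqP; split=> w /=;
  by rewrite leNgt => /negP.
Qed.

(** Both points are random. By separability the first is replaced by a dense point within 2^-m, and
    the same margin 2^-m is asked of the second. *)
Lemma sig_far Y Z r : observable G Y -> observable G Z ->
  G [set w | far r (Y w) (Z w)].
Proof.
move=> oY oZ; have [z hz] := dense_sequence.
have -> : [set w | far r (Y w) (Z w)] = [set w | exists n m,
   (odist d (z n) (Y w) < (2^-1 ^+ m)%:E)%E /\
   ((r + 2^-1 ^+ m)%:E < odist d (z n) (Z w))%E].
  apply/seteqP; split=> w /=.
    case: (Y w) => [y|] //= ryZ.
    have [m hm] : exists m, ((r + 2^-1 ^+ m + 2^-1 ^+ m)%:E <= odist d y (Z w))%E.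
      case: (Z w) ryZ => [u|_] /=; last by exists 0%N; rewrite leey.
      rewrite lte_fin => ryu.
      have [|m hm] := @exists_halfpow_lt R ((d y u - r) / 2).
        by rewrite divr_gt0 // subr_gt0.
      by exists m; rewrite lee_fin; have := hm m (leqnn m); lra.
    have [n hn] := hz y (2^-1 ^+ m) ltac:(by rewrite exprn_gt0 // invr_gt0).
    exists n, m; split; first by rewrite lte_fin dist_sym.
    case: (Z w) hm => [u|_] /=; last by rewrite ltry.
    by rewrite lee_fin lte_fin; have := dist_triangle (z n) y u; lra.
  case=> n [m []]; case: (Y w) => [y|] //=.
  rewrite lte_fin => h1; case: (Z w) => [u|_] /=; last by rewrite ltry.
  by rewrite !lte_fin; have := dist_triangle y (z n) u; lra.
by apply: sig_ex => // n; apply: sig_ex => // m; apply: sigI => //;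
  [exact: sig_odist_lt|exact: sig_lt_odist].
Qed.
End Observable.

Definition regular_path (p : R -> option M) : Prop :=
  (forall t, 0 <= t -> ocvg d (t^'+) p (p t)) /\
  (forall t s, 0 <= t -> t <= s -> p t = None -> p s = None).

Section RegularPath.
Context (p : R -> option M) (rp : regular_path p).

Lemma path_near s y e : 0 <= s -> p s = Some y -> 0 < e ->
  exists2 h, 0 < h & forall u, s <= u -> u < s + h ->
    exists2 z, p u = Some z & d y z < e.
Proof.
move=> s0 ps e0; have := rp.1 s s0; rewrite ps => /(_ e e0) /at_rightP[h h0 hh].
exists h => // u su uh; have [<-|su'] := eqVneq s u.
  by exists y => //; rewrite distxx.
have [|z hz dz] := hh u _ uh; first by rewrite lt_neqAle su'.
by exists z => //; rewrite dist_sym.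
Qed.

Lemma path_lt_odist s x r : 0 <= s -> (r%:E < odist d x (p s))%E ->
  exists2 h, 0 < h & forall u, s <= u -> u < s + h -> (r%:E < odist d x (p u))%E.
Proof.
move=> s0; case E : (p s) => [y|] /=.
  rewrite lte_fin => rxy.
  have [|h h0 hh] := @path_near s y (d x y - r) s0 E; first by rewrite subr_gt0.
  exists h => // u su uh; have [z -> yz] := hh u su uh.
  by rewrite /= lte_fin; have := dist_triangle z x y; rewrite (dist_sym z y); lra.
move=> _; exists 1 => // u su _; rewrite (rp.2 s u s0 su E) /=; exact: ltry.
Qed.

Lemma path_odist_lt s x r : 0 <= s -> (odist d x (p s) < r%:E)%E ->
  exists2 h, 0 < h & forall u, s <= u -> u < s + h -> (odist d x (p u) < r%:E)%E.
Proof.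
move=> s0; case E : (p s) => [y|] //=.
rewrite lte_fin => rxy; have [|h h0 hh] := @path_near s y (r - d x y) s0 E.
  by rewrite subr_gt0.
exists h => // u su uh; have [z -> yz] := hh u su uh.
by rewrite /= lte_fin; have := dist_triangle y x z; lra.
Qed.

Lemma path_far s t r : 0 <= s -> 0 <= t -> far r (p s) (p t) ->
  exists2 h, 0 < h & forall u v, s <= u -> u < s + h -> t <= v -> v < t + h ->
    far r (p u) (p v).
Proof.
move=> s0 t0; case E : (p s) => [y|] //= ryt.
have [e e0 he] : exists2 e, 0 < e & ((r + e)%:E < odist d y (p t))%E.
  case: (p t) ryt => [z|_] /=; last by exists 1; rewrite ?ltry.
  rewrite lte_fin => ryz; exists ((d y z - r) / 2); last by rewrite lte_fin; lra.
  by rewrite divr_gt0 // subr_gt0.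
have [h1 h10 hh1] := path_near s0 E e0; have [h2 h20 hh2] := path_lt_odist t0 he.
exists (Num.min h1 h2); first by rewrite lt_min h10.
move=> u v su uh tv vh.
have [|z -> yz] := hh1 u su; first by apply: lt_le_trans uh _; rewrite lerD2l ge_min lexx.
have {hh2} := hh2 v tv; rewrite /=.
have vh2 : v < t + h2 by apply: lt_le_trans vh _; rewrite lerD2l ge_min lexx orbT.
move=> /(_ vh2); case: (p v) => [a|] /=; last by rewrite !ltry.
by rewrite !lte_fin; have := dist_triangle z y a; lra.
Qed.

End RegularPath.
End MetricEvents.

(** * Measurability of exit times from balls *)

Section ExitTimeMeasurable.
Context {R : realType} {dM : measure_display} {M : measurableType dM}
  (d : M -> M -> R)
  {dO : measure_display} {Om : measurableType dO}
  (Ft : R -> set_system Om) (X : R -> Om -> option M)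
  (theta : R -> Om -> Om) (P : option M -> probability Om R).
Context (lcs : lcs_borel_metric_space d).
Context (bsp : borel_standard_process d Ft X theta P).
Implicit Types (s t u v r e q a c : R) (x y z : M) (w : Om).

Lemma process_regular w : regular_path d (fun u => X u w).
Proof.
split=> [t t0|t s t0 ts]; first exact: (paths_right_continuous bsp).
exact: (absorbed bsp).
Qed.

Lemma process_observable s t : 0 <= s -> s <= t -> observable (Ft t) (X s).
Proof. by move=> s0 st B mB; exact: (filtration_at bsp). Qed.

Lemma lt_lifetime w t : 0 <= t -> X t w <> None -> (t%:E < lifetime X w)%E.
Proof.
move=> t0; case E : (X t w) => [y|] // _.
have [h h0 hh] := path_near lcs (process_regular w) t0 E ltr01.
apply: (@lt_le_trans _ _ (t + h)%:E); first by rewrite lte_fin ltrDl.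
apply/ereal_infP => _ [u [u0 Xu] <-]; rewrite lee_fin leNgt; apply/negP => uth.
have [tu|/ltW ut] := leP t u; first by have [z] := hh u tu uth; rewrite Xu.
by move: E; rewrite ((process_regular w).2 u t (ltW u0) ut Xu).
Qed.

Section FixedBall.
Context (x : M) (r : R) (q : R) (q0 : 0 < q).

(** Dyadic times make the infimum countable. The strict bound at r - 2^-n describes an open
    neighbourhood of the complement of the ball, which right-continuous paths enter at a grid time.
    The delay q > 0 matches [exit_time], which ignores time 0. *)
Let hit_set n w : set R := [set u | exists m k, [/\ u = dyadic m k, q < u &
  ((r - 2^-1 ^+ n)%:E < odist d x (X u w))%E]].

Definition hit n w : \bar R := ereal_inf [set u%:E | u in hit_set n w].

Definition hit_limit w : \bar R := ereal_sup (range (fun n => hit n w)).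

Lemma hit_lt n w (c : \bar R) : (hit n w < c)%E <-> exists m k,
  [/\ q < dyadic m k, ((dyadic m k)%:E < c)%E &
      ((r - 2^-1 ^+ n)%:E < odist d x (X (dyadic m k) w))%E].
Proof.
split.
  by move=> /ereal_inf_ltP[_ [u [m [k [-> qu far_u]]] <-] uc]; exists m, k.
case=> m [k [qu uc far_u]]; apply/ereal_inf_ltP; exists (dyadic m k)%:E => //.
by exists (dyadic m k) => //; exists m, k.
Qed.

Lemma hit_ge n w : (q%:E <= hit n w)%E.
Proof. by apply/ereal_infP => _ [u [m [k [_ /ltW qu _]]] <-]; rewrite lee_fin. Qed.

Lemma hit_mono n w : (hit n w <= hit n.+1 w)%E.
Proof.
apply: ereal_inf_le_tmp => _ [u [m [k [uE qu far_u]]] <-]; exists u => //.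
exists m, k; split=> //; apply: le_lt_trans far_u; rewrite lee_fin lerD2l lerN2.
by rewrite exprS ler_piMl ?exprn_ge0 ?invr_ge0 // invf_le1 // ler1n.
Qed.

Lemma hit_le_limit n w : (hit n w <= hit_limit w)%E.
Proof. by apply: ereal_sup_ubound; exists n. Qed.

Lemma hit_limit_ge w : (q%:E <= hit_limit w)%E.
Proof. exact: le_trans (hit_ge 0%N w) (hit_le_limit _ _). Qed.

Lemma sig_hit_lt n t : Ft t [set w | (hit n w < t%:E)%E].
Proof.
have sF := filtration_sigma bsp t.
have -> : [set w | (hit n w < t%:E)%E] = [set w | exists m k,
    (q < dyadic m k /\ dyadic m k < t) /\
    ((r - 2^-1 ^+ n)%:E < odist d x (X (dyadic m k) w))%E].
  apply/seteqP; split=> w /=.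
    by move/hit_lt => [m [k [qu uc far_u]]]; exists m, k.
  by move=> [m [k [[qu uc] far_u]]]; apply/hit_lt; exists m, k.
apply: sig_ex => // m; apply: sig_ex => // k; apply: sig_if => // -[_ dt].
apply: (sig_lt_odist lcs) => //; apply: process_observable (ltW dt).
exact: dyadic_ge0.
Qed.

Lemma hit_le n w t :
  (hit n w <= t%:E)%E <-> forall j, (hit n w < (t + 2^-1 ^+ j)%:E)%E.
Proof.
split=> [ht j|ht].
  by apply: le_lt_trans ht _; rewrite lte_fin ltrDl exprn_gt0 // invr_gt0.
apply/lee_addgt0Pr => e e0; have [j hj] := exists_halfpow_lt e0.
apply: le_trans (ltW (ht j)) _; rewrite -EFinD lee_fin lerD2l; exact/ltW/hj.
Qed.

Lemma sig_hit_le n t : 0 <= t -> Ft t [set w | (hit n w <= t%:E)%E].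
Proof.
move=> t0; apply: (filtration_right_continuous bsp) => // s ts.
have [N hN] := @exists_halfpow_lt R (s - t) ltac:(by rewrite subr_gt0).
have -> : [set w | (hit n w <= t%:E)%E] =
    [set w | forall j, (hit n w < (t + 2^-1 ^+ (N + j))%:E)%E].
  apply/seteqP; split=> w /=; first by move/hit_le => h j; exact: h.
  move=> h; apply/hit_le => j; apply: lt_le_trans (h j) _; rewrite lee_fin lerD2l.
  by rewrite addnC exprD ler_piMr ?exprn_ge0 ?exprn_ile1 ?invr_ge0 ?invf_le1 ?ler1n.
apply: sig_all; first exact: (filtration_sigma bsp).
move=> j; apply: (filtration_mono bsp) (sig_hit_lt _ _).
  by rewrite addr_ge0 // exprn_ge0 // invr_ge0.
by rewrite -lerBrDl; apply/ltW/hN; rewrite leq_addr.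
Qed.

Lemma hit_limit_le w (c : \bar R) : (hit_limit w <= c)%E <-> forall n, (hit n w <= c)%E.
Proof.
split=> [h n|h]; first exact: le_trans (hit_le_limit n w) h.
by apply/ereal_supP => _ [n _ <-].
Qed.

Lemma sig_hit_limit_le t : 0 <= t -> Ft t [set w | (hit_limit w <= t%:E)%E].
Proof.
move=> t0; have -> : [set w | (hit_limit w <= t%:E)%E] =
    [set w | forall n, (hit n w <= t%:E)%E].
  by apply/seteqP; split=> w /= /hit_limit_le.
by apply: sig_all => [|n]; [exact: (filtration_sigma bsp)|exact: sig_hit_le].
Qed.

Lemma hit_stopping n : stopping_time Ft (hit n).
Proof.
split=> [w|t t0]; last exact: sig_hit_le.
by apply: le_trans (hit_ge n w); rewrite lee_fin ltW.
Qed.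

Lemma hit_limit_stopping : stopping_time Ft hit_limit.
Proof.
split=> [w|t t0]; last exact: sig_hit_limit_le.
by apply: le_trans (hit_limit_ge w); rewrite lee_fin ltW.
Qed.

Lemma hit_odist n w t : hit n w = t%:E ->
  ((r - 2^-1 ^+ n)%:E <= odist d x (X t w))%E.
Proof.
move=> ht; have t0 : 0 <= t.
  by have := hit_ge n w; rewrite ht lee_fin; apply: le_trans; exact: ltW.
rewrite leNgt; apply/negP => lt_d.
have [h h0 hh] := path_odist_lt lcs (process_regular w) t0 lt_d.
have : (hit n w < (t + h)%:E)%E by rewrite ht lte_fin ltrDl.
move=> /ereal_inf_ltP[_ [u hu <-]]; rewrite lte_fin => uth.
have tu : t <= u.
  by rewrite -lee_fin -ht; apply: ereal_inf_lbound; exists u.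
case: hu => m [k [_ _]]; have := hh u tu uth.
by move=> h1 h2; have := lt_trans h1 h2; rewrite ltxx.
Qed.

Definition hit_inside : set Om := [set w | exists2 t, hit_limit w = t%:E &
  (odist d x (X t w) < r%:E)%E].

Lemma hit_limitP w : (exists2 t, 0 < t & hit_limit w = t%:E) \/ hit_limit w = +oo%E.
Proof.
have := hit_limit_ge w; case: (hit_limit w) => [t| |] //; last by right.
by rewrite lee_fin => qt; left; exists t => //; exact: lt_le_trans q0 qt.
Qed.

Lemma measurable_hit_limit_le t : measurable [set w | (hit_limit w <= t%:E)%E].
Proof.
have [t0|t0] := leP 0 t; first exact: (filtration_measurable bsp (sig_hit_limit_le t0)).
rewrite [X in measurable X](_ : _ = set0) //; apply/seteqP; split=> w //= h.
have := le_trans (hit_limit_ge w) h; rewrite lee_fin => /(lt_le_trans q0) /lt_trans /(_ t0).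
by rewrite ltxx.
Qed.

Lemma measurable_hit_limit_lt a : measurable [set w | (hit_limit w < a%:E)%E].
Proof.
have -> : [set w | (hit_limit w < a%:E)%E] =
     [set w | exists j, (hit_limit w <= (a - 2^-1 ^+ j)%:E)%E].
  apply/seteqP; split=> w /=.
    case: (hit_limitP w) => [[t t0 ->]|->] //; rewrite lte_fin => ta.
    have [|j hj] := @exists_halfpow_lt R (a - t); first by rewrite subr_gt0.
    by exists j; rewrite lee_fin; have := hj j (leqnn j); lra.
  case=> j /le_lt_trans; apply; rewrite lte_fin ltrBlDr ltrDl exprn_gt0 //.
apply: sig_ex => [|j]; first exact: sigma_algebra_measurable.
exact: measurable_hit_limit_le.
Qed.

(** The position at the random time [hit_limit] is read, by right continuity, at the grid point
    [k.+2] just after it. Two mesh steps are allowed, not one, so that the grid point [k] lies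
    strictly before the limit even when the limit is on the grid. *)
Lemma measurable_hit_inside : measurable hit_inside.
Proof.
have smeas := @sigma_algebra_measurable _ Om.
have -> : hit_inside = [set w | exists j N, forall m, (N <= m)%N -> exists k,
   ((hit_limit w <= (dyadic m k.+2)%:E)%E /\ ~ (hit_limit w <= (dyadic m k)%:E)%E) /\
   (odist d x (X (dyadic m k.+2) w) <= (r - 2^-1 ^+ j)%:E)%E].
  apply/seteqP; split=> w.
    case=> t hT dXt.
    have t0 : 0 < t by have := hit_limit_ge w; rewrite hT lee_fin; exact: lt_le_trans.
    have [j hj] : exists j, (odist d x (X t w) < (r - 2^-1 ^+ j)%:E)%E.
      move: dXt; case: (X t w) => [y|] //=; rewrite lte_fin => dxy.
      have [|j hj] := @exists_halfpow_lt R (r - d x y); first by rewrite subr_gt0.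
      by exists j; rewrite lte_fin; have := hj j (leqnn j); lra.
    have [h h0 hh] := path_odist_lt lcs (process_regular w) (ltW t0) hj.
    have [|N hN] := @exists_halfpow_lt R (Num.min t h); first by rewrite lt_min t0.
    exists j, N => m Nm; have := hN m Nm; rewrite lt_min => /andP[mt mh].
    have [[|[|k]] [k1 k2]] := dyadic_ceil m (ltW t0).
    - by move: k1; rewrite /dyadic mul0r ltNge (ltW t0).
    - by move: k1; rewrite /dyadic mul1r => /(lt_trans mt); rewrite ltxx.
    exists k; split; first split.
    - by rewrite hT lee_fin ltW.
    - apply/negP; rewrite hT lee_fin -ltNge.
      have : (0 : R) < 2^-1 ^+ m by rewrite exprn_gt0.
      by move: k1 k2; rewrite /dyadic -addn2 natrD mulrDl; lra.
    - by apply/ltW/hh; [exact: ltW|apply: le_lt_trans k2 _; rewrite ltrD2l].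
  case=> j [N hw].
  case: (hit_limitP w) => [[t t0 hT]|hT]; last first.
    by have [k [[]]] := hw N (leqnn N); rewrite hT.
  exists t => //; rewrite ltNge; apply/negP => rX.
  have rjX : ((r - 2^-1 ^+ j)%:E < odist d x (X t w))%E.
    apply: lt_le_trans rX; rewrite lte_fin ltrBlDr ltrDl exprn_gt0 //.
  have [h h0 hh] := path_lt_odist lcs (process_regular w) (ltW t0) rjX.
  have [|m0 hm0] := @exists_halfpow_lt R (h / 2); first by rewrite divr_gt0.
  have := hm0 (maxn N m0) (leq_maxr _ _).
  have [k [[k1 /negP k2] k3]] := hw (maxn N m0) (leq_maxl _ _) => mh.
  move: k1 k2; rewrite hT !lee_fin -ltNge => k1 k2.
  suff /(hh _ k1)/lt_le_trans /(_ k3) : dyadic (maxn N m0) k.+2 < t + h.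
    by rewrite ltxx.
  by move: k1 k2 mh; rewrite /dyadic -addn2 natrD mulrDl; lra.
apply: sig_ex => // j; apply: sig_ex => // N; apply: sig_all => // m.
apply: sig_when => // _; apply: sig_ex => // k; apply: sigI => //.
  apply: sigI => //; first exact: measurable_hit_limit_le.
  by apply: sigC => //; exact: measurable_hit_limit_le.
apply: (sig_le_odist lcs) => // B mB; apply: (measurable_at bsp) => //.
exact: dyadic_ge0.
Qed.

(* By quasi-left-continuity the process does not sit inside the ball at the
   limit of the hitting times of the neighbourhoods of its complement. *)
Lemma hit_inside_null o : P o hit_inside = 0%E.
Proof.
apply/(negligibleP _ measurable_hit_inside).
have [N [mN N0 hN]] := quasi_left_continuous bsp hit_stopping hit_limit_stopping
  (fun n => hit_mono n) (fun w => erefl) o.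
exists N; split => //; apply: subset_trans hN => w [t hT dXt] /= conv.
have t0 : 0 < t by have := hit_limit_ge w; rewrite hT lee_fin; exact: lt_le_trans.
have : (hit_limit w < lifetime X w)%E.
  by rewrite hT; apply: lt_lifetime; [exact: ltW|move: dXt; case: (X t w)].
move=> /conv; rewrite hT /=; case E : (X t w) dXt => [y|] //=.
rewrite lte_fin => dxy cvgy.
have e0 : 0 < (r - d x y) / 2 by rewrite divr_gt0 // subr_gt0.
have [n1 _ h1] := cvgy _ e0; have [n2 h2] := exists_halfpow_lt e0.
set n := maxn n1 n2; have [z] := h1 n (leq_maxl _ _).
have := h2 n (leq_maxr _ _).
have hn : hit n w = (fine (hit n w))%:E.
  have := hit_le_limit n w; have := hit_ge n w; rewrite hT.
  by case: (hit n w).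
move=> hn2 Xz; rewrite dist_sym // => dyz.
have := hit_odist hn; rewrite Xz /= lee_fin.
by have := dist_triangle lcs y x z; lra.
Qed.
End FixedBall.

Lemma exit_time_ltP x r a w :
  (exit_time X (mball d x r) w < a%:E)%E <->
  exists s, [/\ 0 < s, s < a & (r%:E <= odist d x (X s w))%E].
Proof.
split.
  move=> /ereal_inf_ltP[_ [s [s0 ns] <-] sa]; exists s; split=> //.
  case E : (X s w) ns => [y|] /= ns; last exact: leey.
  by rewrite lee_fin leNgt; apply/negP => ?; apply: ns; exists y.
case=> s [s0 sa rX]; apply/ereal_inf_ltP; exists s%:E => //; exists s => //.
split=> // -[y Xy]; move: rX; rewrite Xy lee_fin /mball /= => /le_lt_trans h /h.
by rewrite ltxx.
Qed.

(** An exit at s bounds every [hit_limit] started at q < s, so [E] lies in [U]. Conversely the path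
    has left the ball at the limit time unless [hit_inside] holds. The discrepancy lies in a set
    null under every law, and completeness of the filtration makes each of its subsets
    measurable. *)
Lemma exit_time_measurable x r a :
  measurable [set w | (exit_time X (mball d x r) w < a%:E)%E].
Proof.
have smeas := @sigma_algebra_measurable _ Om.
set E := [set w | _].
pose U := [set w | exists m k, 0 < dyadic m k :> R /\
   (hit_limit x r (dyadic m k) w < a%:E)%E].
pose B := [set w | exists m k, 0 < dyadic m k :> R /\ hit_inside x r (dyadic m k) w].
have mU : measurable U.
  apply: sig_ex => // m; apply: sig_ex => // k; apply: sig_if => // q0.
  exact: measurable_hit_limit_lt.
have mB : measurable B.
  apply: sig_ex => // m; apply: sig_ex => // k; apply: sig_if => // q0.
  exact: measurable_hit_inside.
have B0 o : P o B = 0%E.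
  apply/(negligibleP _ mB).
  apply: (@negligibleS _ _ _ _ (\bigcup_m \bigcup_k
     [set w | 0 < dyadic m k :> R /\ hit_inside x r (dyadic m k) w])).
    by move=> w [m [k h]]; exists m => //; exists k.
  apply: negligible_bigcup => m; apply: negligible_bigcup => k.
  have [q0|nq0] := pselect (0 < dyadic m k :> R); last first.
    by apply: (@negligibleS _ _ _ _ set0); [move=> w []|exact: negligible_set0].
  apply: (@negligibleS _ _ _ _ (hit_inside x r (dyadic m k))); first by move=> w [].
  by apply/negligibleP; [exact: measurable_hit_inside|exact: hit_inside_null].
have EU : E `<=` U.
  move=> w /exit_time_ltP[s [s0 sa rX]].
  have [m [k [q0 qs]]] := dyadic_dense (lexx 0) s0.
  exists m, k; split=> //; apply: (@le_lt_trans _ _ s%:E); last by rewrite lte_fin.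
  apply/hit_limit_le => n; apply/lee_addgt0Pr => e e0.
  have nX : ((r - 2^-1 ^+ n)%:E < odist d x (X s w))%E.
    apply: lt_le_trans rX; rewrite lte_fin ltrBlDr ltrDl exprn_gt0 //.
  have [h h0 hh] := path_lt_odist lcs (process_regular w) (ltW s0) nX.
  have [|m' [k' [k1 k2]]] := @dyadic_dense R s (s + Num.min e h) (ltW s0).
    by rewrite ltrDl lt_min e0.
  apply/ltW; rewrite -EFinD; apply/hit_lt; exists m', k'; split.
  - exact: lt_trans qs k1.
  - by rewrite lte_fin; apply: lt_le_trans k2 _; rewrite lerD2l ge_min lexx.
  - apply: hh; first exact: ltW.
    by apply: lt_le_trans k2 _; rewrite lerD2l ge_min lexx orbT.
have UE : U `\` B `<=` E.
  move=> w [[m [k [q0 ha]]] nB]; apply/exit_time_ltP.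
  case: (hit_limitP x r q0 w) ha => [[t t0 hT]|->] //; rewrite hT lte_fin => ta.
  exists t; split=> //; rewrite leNgt; apply/negP => rX; apply: nB.
  by exists m, k; split=> //; exists t.
have -> : E = (U `\` B) `|` (E `&` B).
  apply/seteqP; split=> w; last by case=> [/UE|[]].
  by move=> Ew; have [Bw|nB] := pselect (B w); [right|left; split=> //; exact: EU].
apply: measurableU; first exact: measurableD.
by apply: (filtration_measurable bsp (filtration_null bsp (lexx 0) mB B0 _)) => w [].
Qed.

Lemma exit_time_ge_measurable x r a :
  measurable [set w | (a%:E <= exit_time X (mball d x r) w)%E].
Proof.
have := measurableC (exit_time_measurable x r a); congr (measurable _).
by apply/seteqP; split=> w /=; rewrite leNgt => /negP.
Qed.
End ExitTimeMeasurable.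

(** * Escapes and chains of large moves *)

Section Escape.
Context {R : realType} {dM : measure_display} {M : measurableType dM}
  (d : M -> M -> R)
  {dO : measure_display} {Om : measurableType dO}
  (Ft : R -> set_system Om) (X : R -> Om -> option M)
  (theta : R -> Om -> Om) (P : option M -> probability Om R).
Context (lcs : lcs_borel_metric_space d).
Context (bsp : borel_standard_process d Ft X theta P).
Implicit Types (s t u v r e q a c : R) (x y z : M) (w : Om).

Lemma path_observable s : 0 <= s ->
  observable (@path_event R dM M) (fun p : R -> option M => p s).
Proof. by move=> s0 B mB; exact: path_event_at. Qed.

Lemma probability_full_setI (Q : probability Om R) (A B : set Om) :
  measurable A -> measurable B -> Q B = 1%E -> Q A = Q (A `&` B).
Proof.
move=> mA mB QB; rewrite [LHS](measureDI Q mA mB) [X in (X + _)%E](_ : _ = 0%E) ?add0e //.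
apply/eqP; rewrite -measure_le0; apply: (@le_trans _ _ (Q (~` B))).
  by apply: le_measure; rewrite ?inE; [exact: measurableD|exact: measurableC|move=> w []].
by rewrite probability_setC // QB subee.
Qed.

Lemma filtration_start x : Ft 0 [set w | X 0 w = Some x].
Proof.
have := filtration_at bsp (lexx 0) (lexx 0) (measurable_cball lcs x 0).
congr Ft; apply/seteqP; split=> w /=.
  case=> y -> xy; congr Some; apply/esym/(dist_eq0 lcs)/eqP.
  by rewrite eq_le xy (dist_ge0 lcs).
by move=> ->; exists x => //=; rewrite (distxx lcs).
Qed.

Lemma measurable_start x : measurable [set w | X 0 w = Some x].
Proof. exact: (filtration_measurable bsp (filtration_start x)). Qed.

Lemma start_setI x A : measurable A ->
  P (Some x) A = P (Some x) (A `&` [set w | X 0 w = Some x]).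
Proof.
move=> mA; apply: probability_full_setI => //; first exact: measurable_start.
exact: (start_at bsp).
Qed.

(** Measured from the initial point of the path, so that it can be applied after a time shift;
    dyadic times make it a path event. *)
Definition escape r t : set (R -> option M) :=
  [set p | exists m k, dyadic m k < t /\ far d r (p 0) (p (dyadic m k))].

Lemma path_event_escape r t : path_event (escape r t).
Proof.
have sP := @path_event_sigma R dM M.
apply: sig_ex => // m; apply: sig_ex => // k; apply: sig_if => // _.
by apply: (sig_far lcs sP); apply: path_observable => //; exact: dyadic_ge0.
Qed.

Lemma escape_le_exit x r t a : t <= a -> 0 <= r ->
  (P (Some x) [set w | escape r t (fun u => X u w)] <=
   1 - P (Some x) [set w | a%:E <= exit_time X (mball d x r) w])%E.
Proof.
move=> ta r0; set F := [set w | (_ <= _)%E].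
have mF : measurable F by exact: (exit_time_ge_measurable lcs bsp).
have mE : measurable [set w | escape r t (fun u => X u w)].
  exact: (path_event_measurable0 bsp (path_event_escape r t)).
rewrite -probability_setC // start_setI //; apply: le_measure; rewrite ?inE.
- by apply: measurableI => //; exact: measurable_start.
- exact: measurableC.
move=> w [[m [k [kt far_k]]] X0] /= Fw; rewrite /= X0 /= in far_k.
have k0 : 0 < dyadic m k :> R.
  rewrite lt_neqAle dyadic_ge0 andbT; apply: contraPneq far_k => <-.
  by rewrite X0 /= (distxx lcs) lte_fin ltNge r0.
have : (exit_time X (mball d x r) w < a%:E)%E.
  apply/exit_time_ltP; exists (dyadic m k); split=> //; last exact: ltW.
  exact: lt_le_trans kt ta.
by rewrite ltNge Fw.
Qed.

Section Chains.
Context (W : set M) (mW : measurable W) (r t q : R) (q0 : 0 <= q).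
Context (escape_le : forall z, W z ->
  (P (Some z) [set w | escape r t (fun u => X u w)] <= q%:E)%E).

(** Only grid times are read, so the event is decided at [dyadic m k] and a first index of
    completion exists. *)
Fixpoint chain m N k w : Prop :=
  (forall j, (j <= k)%N -> exists2 y, X (dyadic m j) w = Some y & W y) /\
  if N is N'.+1 then exists j, (j < k)%N /\
    (chain m N' j w /\ far d (r + r) (X (dyadic m j) w) (X (dyadic m k) w))
  else True.

Lemma chain_inside m N k w : chain m N k w ->
  exists2 y, X (dyadic m k) w = Some y & W y.
Proof. by case: N => [|N] [h _]; exact: h. Qed.

Lemma sig_chain m N k : Ft (dyadic m k) (chain m N k).
Proof.
have sF j := filtration_sigma bsp j.
elim: N k => [|N IH] k.
  apply: sigI => //; last exact: sig_cst.
  apply: sig_all => // j; apply: sig_when => // jk.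
  by apply: (filtration_at bsp) => //; rewrite ?dyadic_ge0 ?le_dyadic.
apply: sigI => //.
  apply: sig_all => // j; apply: sig_when => // jk.
  by apply: (filtration_at bsp) => //; rewrite ?dyadic_ge0 ?le_dyadic.
apply: sig_ex => // j; apply: sig_if => // jk; apply: sigI => //.
  by apply: (filtration_mono bsp) (IH j); rewrite ?dyadic_ge0 // le_dyadic ltnW.
apply: (sig_far lcs) => //; apply: (process_observable bsp);
  by rewrite ?dyadic_ge0 // le_dyadic ltnW.
Qed.

Definition chain_before m N : set Om :=
  [set w | exists k, dyadic m k < t /\ chain m N k w].

Lemma measurable_chain_before m N : measurable (chain_before m N).
Proof.
have sm := @sigma_algebra_measurable _ Om.
apply: sig_ex => // k; apply: sig_if => // _.
exact: (filtration_measurable bsp (sig_chain m N k)).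
Qed.

(** Split by the first index i at which N moves are complete. One more move longer than r + r, from
    j >= i to k, leaves the position at j or at k farther than r from the position at i. Hence an
    escape by r follows time i, and the Markov property there gives the factor q. *)
Lemma chain_before_succ m N o :
  (P o (chain_before m N.+1) <= q%:E * P o (chain_before m N))%E.
Proof.
have sF j := filtration_sigma bsp j.
pose A k : set Om := [set w | dyadic m k < t /\
   (chain m N k w /\ forall j, (j < k)%N -> ~ chain m N j w)].
have FA k : Ft (dyadic m k) (A k).
  apply: sig_if => // _; apply: sigI => //; first exact: sig_chain.
  apply: sig_all => // j; apply: sig_when => // jk; apply: sigC => //.
  by apply: (filtration_mono bsp) (sig_chain m N j); rewrite ?dyadic_ge0 // le_dyadic ltnW.
have mA k : measurable (A k) by exact: (filtration_measurable bsp (FA k)).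
pose B k : set Om := A k `&` [set w | escape r t (fun u => X (u + dyadic m k) w)].
have mB k : measurable (B k).
  apply: measurableI => //; apply: (path_event_measurable bsp) (dyadic_ge0 m k).
  exact: path_event_escape.
have trA : trivIset setT A.
  apply/trivIsetP => i j _ _ ij; apply/seteqP; split=> w //= -[[_ [ci ni]] [_ [cj nj]]].
  by move: ij; rewrite neq_ltn => /orP[/nj|/ni].
have UA : \bigcup_k A k = chain_before m N.
  apply/seteqP; split=> w; first by move=> [k _ [kt [ck _]]]; exists k.
  move=> [k [kt ck]]; have [n] := ubnP k; elim: n k kt ck => // n IH k kt ck kn.
  have [[j [jk cj]]|nj] := pselect (exists j, (j < k)%N /\ chain m N j w).
    apply: (IH j) => //; last exact: leq_trans jk _.
    by apply: lt_trans kt; rewrite lt_dyadic.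
  by exists k => //; split=> //; split=> // j jk cj; apply: nj; exists j.
have sub : chain_before m N.+1 `<=` \bigcup_k B k.
  move=> w [k [kt [inW [j [jk [cj fjk]]]]]].
  have : (\bigcup_k A k) w.
    rewrite UA; exists j; split=> //; apply: lt_trans kt; rewrite lt_dyadic //.
  move=> [i _ [it [ci ni]]]; exists i => //; split; first by split.
  have ij : (i <= j)%N by rewrite leqNgt; apply/negP => /ni.
  have shiftd l : (i <= l)%N -> dyadic m (l - i) + dyadic m i = dyadic m l :> R.
    by move=> il; rewrite -dyadicD subnK.
  have ltd l : (i <= l)%N -> (l <= k)%N -> dyadic m (l - i) < t :> R.
    move=> il lk; apply: le_lt_trans kt; rewrite le_dyadic.
    exact: leq_trans (leq_subr _ _) lk.
  have [yi Xi Wi] := inW i (leq_trans ij (ltnW jk)).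
  have [yj Xj Wj] := inW j (ltnW jk).
  have [y' Xk Wk] := inW k (leqnn k).
  have ik := leq_trans ij (ltnW jk).
  move: fjk; rewrite Xj Xk /= lte_fin => fjk.
  have [ri|ri] := ltP r (d yi yj).
    exists m, (j - i)%N; split; first by apply: ltd => //; exact: ltnW.
    by rewrite add0r shiftd // Xi Xj /= lte_fin.
  exists m, (k - i)%N; split; first exact: ltd.
  rewrite add0r shiftd // Xi Xk /= lte_fin.
  by have := dist_triangle lcs yi yj y'; rewrite (dist_sym lcs yj yi); lra.
apply: (@le_trans _ _ (\sum_(0 <= k <oo) P o (B k))%E).
  apply: measure_sigma_subadditive => //; exact: measurable_chain_before.
apply: (@le_trans _ _ (\sum_(0 <= k <oo) q%:E * P o (A k))%E).
  apply: lee_nneseries => // k _.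
  apply: (@markov_le _ _ _ _ _ _ _ _ _ _ bsp _ _ _ _
    [set o' | exists2 z, o' = Some z & W z]) => //.
  - exact: dyadic_ge0.
  - exact: path_event_escape.
  - by move=> w [_ [/chain_inside]].
  - by move=> _ [z -> /escape_le].
rewrite nneseriesZl // -UA measure_semi_bigcup //.
exact: bigcupT_measurable.
Qed.

Lemma chain_before_le m N o : (P o (chain_before m N) <= (q ^+ N)%:E)%E.
Proof.
elim: N => [|N IH].
  by rewrite expr0; apply: probability_le1; exact: measurable_chain_before.
apply: le_trans (chain_before_succ m N o) _; rewrite exprS EFinM.
by apply: lee_pmul; rewrite ?lee_fin.
Qed.

Definition full_chain (p : R -> option M) N c : Prop :=
  (forall u, 0 <= u -> u < c -> exists2 y, p u = Some y & W y) /\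
  exists s : nat -> R, [/\ 0 <= s 0%N, forall i, (i < N)%N -> s i < s i.+1, s N < c &
    forall i, (i < N)%N -> far d (r + r) (p (s i)) (p (s i.+1))].

(** Distances that exceed r + r persist shortly after [s i], so on every fine enough grid each [s i]
    can be moved to the next grid time; [key] keeps the window after [s n] in which this is
    allowed. *)
Lemma full_chain_before w N c : c <= t -> full_chain (fun u => X u w) N c ->
  exists m0, forall m, (m0 <= m)%N -> chain_before m N w.
Proof.
move=> ct [inW [s [s0 s_lt sNc s_far]]].
have s_ge0 i : (i <= N)%N -> 0 <= s i.
  elim: i => // i IH iN; apply: le_trans (IH (ltnW iN)) _; exact/ltW/s_lt.
have s_c i : (i <= N)%N -> s i < c.
  move=> iN; rewrite -(subKn iN); elim: (N - i)%N => [|j IH]; first by rewrite subn0.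
  have [Nj|jN] := leqP N j.
    by move: IH; rewrite (eqP Nj) (eqP (leqW Nj)).
  apply: lt_trans IH; rewrite subnS; apply: lt_le_trans (s_lt _ _) _.
    by rewrite prednK ?subn_gt0 // leq_subr.
  by rewrite prednK // subn_gt0.
have inWd m k : dyadic m k < c ->
    forall j, (j <= k)%N -> exists2 y, X (dyadic m j) w = Some y & W y.
  move=> kc j jk; apply: inW; first exact: dyadic_ge0.
  by apply: le_lt_trans kc; rewrite le_dyadic.
have key n : (n <= N)%N -> exists2 h, 0 < h & exists m0, forall m k, (m0 <= m)%N ->
    s n <= dyadic m k -> dyadic m k < s n + h -> dyadic m k < c -> chain m n k w.
  elim: n => [|n IH] nN.
    by exists 1 => //; exists 0%N => m k _ _ _ kc; split=> //; exact: inWd kc.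
  have [h h0 [m0 hm0]] := IH (ltnW nN).
  have [h' h'0 hh'] := path_far lcs (process_regular bsp w) (s_ge0 n (ltnW nN))
    (s_ge0 n.+1 nN) (s_far n nN).
  exists h' => //.
  have [|m1 hm1] := @exists_halfpow_lt R (Num.min (Num.min h h') (s n.+1 - s n)).
    by rewrite !lt_min h0 h'0 subr_gt0 s_lt.
  exists (maxn m0 m1) => m k; rewrite geq_max => /andP[m0m m1m] k1 k2 kc.
  split; first exact: inWd kc.
  have := hm1 m m1m; rewrite !lt_min => /andP[/andP[mh mh'] ms].
  have [j [j1 j2]] := dyadic_ceil m (s_ge0 n (ltnW nN)).
  have js : dyadic m j < s n.+1.
    by apply: le_lt_trans j2 _; rewrite addrC -ltrBrDr.
  exists j; split; first by rewrite -(@lt_dyadic R m); exact: lt_le_trans js k1.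
  split.
    apply: hm0 => //; [exact: ltW| |exact: lt_trans js (s_c _ nN)].
    by apply: le_lt_trans j2 _; rewrite ltrD2l.
  apply: hh' => //; first exact: ltW.
  by apply: le_lt_trans j2 _; rewrite ltrD2l.
have [h h0 [m0 hm0]] := key N (leqnn N).
have [|m1 hm1] := @exists_halfpow_lt R (Num.min h (c - s N)).
  by rewrite lt_min h0 subr_gt0.
exists (maxn m0 m1) => m; rewrite geq_max => /andP[m0m m1m].
have := hm1 m m1m; rewrite lt_min => /andP[mh mc].
have [k [k1 k2]] := dyadic_ceil m (s_ge0 N (leqnn N)).
have kc : dyadic m k < c by apply: le_lt_trans k2 _; rewrite addrC -ltrBrDr.
exists k; split; first exact: lt_le_trans kc ct.
apply: hm0 => //; first exact: ltW.
by apply: le_lt_trans k2 _; rewrite ltrD2l.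
Qed.

Definition chain_liminf N : set Om :=
  [set w | exists m0, forall m, (m0 <= m)%N -> chain_before m N w].

Lemma measurable_chain_liminf N : measurable (chain_liminf N).
Proof.
have sm := @sigma_algebra_measurable _ Om.
apply: sig_ex => // m0; apply: sig_all => // m; apply: sig_when => // _.
exact: measurable_chain_before.
Qed.

(** A Fatou argument: [D n] increases to the event and is contained in [chain_before n N], so the
    bound does not depend on the mesh. *)
Lemma chain_liminf_le N o : (P o (chain_liminf N) <= (q ^+ N)%:E)%E.
Proof.
have sm := @sigma_algebra_measurable _ Om.
pose D m0 : set Om := [set w | forall m, (m0 <= m)%N -> chain_before m N w].
have mD m0 : measurable (D m0).
  by apply: sig_all => // m; apply: sig_when => // _; exact: measurable_chain_before.
have UD : \bigcup_n D n = chain_liminf N.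
  by apply/seteqP; split=> w [m0]; [move=> _ h; exists m0|exists m0].
have := @nondecreasing_cvg_mu _ _ _ (P o) D mD.
rewrite UD => /(_ (measurable_chain_liminf N)) cvD.
have {}cvD : (P o \o D) @ \oo --> P o (chain_liminf N).
  by apply: cvD => i j ij; apply/subsetPset => w h m jm; apply: h; exact: leq_trans jm.
rewrite -(cvg_lim _ cvD) //; apply: lime_le; first by apply/cvg_ex; eexists; exact: cvD.
near=> n; apply: le_trans (chain_before_le n N o).
apply: le_measure; rewrite ?inE //; first exact: measurable_chain_before.
by move=> w /(_ n (leqnn n)).
Unshelve. all: by end_near. Qed.

Lemma full_chain_liminf w N c : c <= t -> full_chain (fun u => X u w) N c ->
  chain_liminf N w.
Proof. exact: full_chain_before. Qed.
End Chains.
End Escape.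

(** * Deterministic geometry of a single path *)

Section PathGeometry.
Context {R : realType} {dM : measure_display} {M : measurableType dM}
  (d : M -> M -> R) (lcs : lcs_borel_metric_space d).
Context (p : R -> option M) (rp : regular_path d p).
Implicit Types (s t u v r e q a c l : R) (x y z : M).

Lemma first_passage x l s : 0 <= s -> (l%:E <= odist d x (p s))%E ->
  exists c, [/\ 0 <= c, c <= s, (l%:E <= odist d x (p c))%E &
    forall u, 0 <= u -> u < c -> (odist d x (p u) < l%:E)%E].
Proof.
move=> s0 ls; pose S := [set u | 0 <= u /\ (l%:E <= odist d x (p u))%E].
have hS : has_inf S by split; [exists s|exists 0 => u []].
have c0 : 0 <= inf S by apply: lb_le_inf; [exists s|move=> u []].
exists (inf S); split=> //.
- by apply: ge_inf; [case: hS|].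
- rewrite leNgt; apply/negP => lt_c.
  have [h h0 hh] := path_odist_lt lcs rp c0 lt_c.
  have [u [u0 lu] uh] := inf_adherent h0 hS.
  have cu : inf S <= u by apply: ge_inf; [case: hS|].
  by have := lt_le_trans (hh u cu uh) lu; rewrite ltxx.
- move=> u u0 uc; rewrite ltNge; apply/negP => lu.
  have : inf S <= u by apply: ge_inf; [case: hS|].
  by rewrite leNgt uc.
Qed.

Lemma odist_ltP x l o : (odist d x o < l%:E)%E <-> exists2 y, o = Some y & d x y < l.
Proof.
split; first by case: o => [y|] //=; rewrite lte_fin => h; exists y.
by case=> y ->; rewrite /= lte_fin.
Qed.

(* Either every annulus is visited before the next one is left, and every
   second visit gives a chain of large moves, or some annulus is jumped over. *)
Lemma exit_chain_or_jump x L r N s : p 0 = Some x -> 0 < L -> r + r < L -> 0 <= s ->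
  (((2 * N).+1%:R * L)%:E <= odist d x (p s))%E ->
  (exists2 c, c <= s & full_chain d (mball d x ((2 * N).+1%:R * L)) r p N c) \/
  (exists i c, [/\ (i < (2 * N).+1)%N, 0 < c, c <= s,
    forall u, 0 <= u -> u < c -> (odist d x (p u) < (i%:R * L)%:E)%E &
    ((i.+1%:R * L)%:E <= odist d x (p c))%E]).
Proof.
move=> p0 L0 rL s0; set K := (2 * N).+1 => exit_s.
have /choice[c hc] : forall i, exists c, (i <= K)%N -> [/\ 0 <= c, c <= s,
     ((i%:R * L)%:E <= odist d x (p c))%E &
      forall u, 0 <= u -> u < c -> (odist d x (p u) < (i%:R * L)%:E)%E].
  move=> i.
  have [iK|_] := leqP i K; last by exists 0.
  have [|c hc] := @first_passage x (i%:R * L) s s0; last by exists c.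
  by apply: le_trans exit_s; rewrite lee_fin ler_pM2r // ler_nat.
have [[i [iK hi]]|nojump] := pselect (exists i, (i < K)%N /\
    forall u, 0 <= u -> u < c i.+1 -> (odist d x (p u) < (i%:R * L)%:E)%E).
  right; exists i, (c i.+1); have [c0 cs lc _] := hc i.+1 iK; split=> //.
  rewrite lt_neqAle c0 andbT; apply: contraPneq lc => <-.
  by rewrite p0 /= (distxx lcs) lee_fin leNgt mulr_gt0.
left; exists (c K); first by case: (hc K (leqnn K)).
have /choice[s' hs'] : forall i, exists s', (i < K)%N ->
    [/\ 0 <= s', s' < c i.+1 & ((i%:R * L)%:E <= odist d x (p s'))%E].
  move=> i.
  have [iK|_] := ltnP i K; last by exists 0.
  have [[u [u0 uc lu]]|nu] := pselect (exists u,
      [/\ 0 <= u, u < c i.+1 & ((i%:R * L)%:E <= odist d x (p u))%E]).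
    by exists u.
  exfalso; apply: nojump; exists i; split=> // u u0 uc; rewrite ltNge.
  by apply/negP => lu; apply: nu; exists u.
have step i : (i.+1 < K)%N -> s' i < s' i.+1.
  move=> iK; have [_ sc _] := hs' i (ltnW iK); apply: lt_le_trans sc _.
  have [u0 _ lu] := hs' i.+1 iK; rewrite leNgt; apply/negP => uc.
  have [_ _ _ /(_ _ u0 uc)] := hc i.+1 (ltnW iK).
  by move=> h; have := lt_le_trans h lu; rewrite ltxx.
split.
  by move=> u u0 uc; apply/odist_ltP; have [_ _ _] := hc K (leqnn K); apply.
(* Consecutive visits may be close together. But [s' (2j)] precedes the passage of level 2j+1 while
   [s' (2j+2)] is beyond level 2j+2, so every second visit is separated by a full annulus of width L
   > r + r. *)
exists (fun j => s' (2 * j)%N); split.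
- by rewrite muln0; case: (hs' 0%N isT).
- move=> j jN; rewrite mulnS; apply: (@lt_trans _ _ (s' (2 * j).+1)).
    by apply: step; rewrite ltnS ltn_mul2l.
  by rewrite addSn add1n; apply: step; rewrite !ltnS -[(2 * j).+2]/(2 + 2 * j)%N -mulnS leq_mul2l.
- by case: (hs' (2 * N)%N (leqnn _)).
- move=> j jN; rewrite mulnS !addSn add0n.
  have jK2 : ((2 * j).+2 < K)%N.
    by rewrite !ltnS -[(2 * j).+2]/(2 + 2 * j)%N -mulnS leq_mul2l.
  have [u0 uc _] := hs' (2 * j)%N (ltn_trans (ltnSn _) (ltn_trans (ltnSn _) jK2)).
  have [_ _ _ /(_ _ u0 uc)/odist_ltP[y -> dxy]] := hc (2 * j).+1 (ltnW (ltn_trans (ltnSn _) jK2)).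
  have [_ _] := hs' (2 * j).+2 jK2.
  rewrite /=; case: (p (s' (2 * j).+2)) => [z|] /=; last by rewrite ltry.
  rewrite lee_fin lte_fin => dxz; have := dist_triangle lcs y x z.
  move: dxy dxz; rewrite -[(2 * j).+2]addn1 natrD mulrDl mul1r.
  by move: (_.+1%:R * L) => lev; lra.
Qed.

(** Relative compactness: the limit may lie outside [W], which will be an open ball. *)
Definition sequentially_compact_in (W : set M) :=
  forall u : nat -> M, (forall n, W (u n)) ->
  exists l : M, exists phi : nat -> nat,
    (forall n m, (n < m)%N -> (phi n < phi m)%N) /\ mseq_cvg d (u \o phi) l.

(* Without a left limit, a path staying in a relatively compact set keeps
   oscillating between a cluster point and the complement of a neighbourhood. *)
Lemma left_limit_or_oscillation (W : set M) c : sequentially_compact_in W -> 0 < c ->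
  (forall u, 0 <= u -> u < c -> exists2 y, p u = Some y & W y) ->
  (exists y, ocvg d (c^'-) p (Some y)) \/
  (exists2 e, 0 < e & forall r N, r + r < e -> full_chain d W r p N c).
Proof.
move=> cW c0 inW.
pose tm n : R := c - c * 2^-1 ^+ n.
have tm0 n : 0 <= tm n.
  by rewrite /tm subr_ge0 ger_pMr // exprn_ile1 // ?invr_ge0 // invf_le1 // ler1n.
have tmc n : tm n < c by rewrite /tm ltrBlDr ltrDl mulr_gt0 // exprn_gt0.
have /choice[y hy] : forall n, exists y, p (tm n) = Some y /\ W y.
  by move=> n; have [y py Wy] := inW _ (tm0 n) (tmc n); exists y.
have [l [phi [phi_lt phi_l]]] := cW y (fun n => (hy n).2).
have [cv|ncv] := pselect (ocvg d (c^'-) p (Some l)); first by left; exists l.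
right.
have {ncv} [e e0 far_e] : exists2 e, 0 < e & forall v, v < c -> exists u,
    [/\ v < u, u < c & ~ (exists2 z, p u = Some z & d z l < e)].
  apply: contrapT => nex; apply: ncv => e e0.
  apply: contrapT => ncv; apply: nex; exists e => // v vc; apply: contrapT => nu.
  apply: ncv; apply/at_leftP; exists (c - v); first by rewrite subr_gt0.
  move=> s; rewrite subKr => vs sc; apply: contrapT => ns; apply: nu.
  by exists s.
have near_e v : v < c -> exists u, [/\ v < u, u < c &
    exists2 z, p u = Some z & d z l < e / 4].
  move=> vc; have e4 : 0 < e / 4 by rewrite divr_gt0.
  have [n1 h1] := phi_l _ e4.
  have [|n2 h2] := @exists_halfpow_lt R ((c - v) / c).
    by rewrite divr_gt0 // subr_gt0.
  have phi_ge n : (n <= phi n)%N.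
    by elim: n => // n IH; apply: leq_ltn_trans IH _; exact: phi_lt.
  set n := maxn n1 n2; exists (tm (phi n)); split=> //.
    have := h2 (phi n) (leq_trans (leq_maxr n1 n2) (phi_ge _)).
    by rewrite ltr_pdivlMr // /tm mulrC; lra.
  by exists (y (phi n)); [case: (hy (phi n))|exact: h1 (leq_maxl _ _)].
exists (e / 2) => [|r N re]; first by rewrite divr_gt0.
split=> //.
pose good b u := if b then ~ (exists2 z, p u = Some z & d z l < e)
  else exists2 z, p u = Some z & d z l < e / 4.
have /choice[f hf] : forall bv : bool * R, exists u, bv.2 < c ->
    [/\ bv.2 < u, u < c & good bv.1 u].
  move=> [b v] /=.
  have [vc|_] := ltP v c; last by exists 0.
  by case: b; [have [u hu] := far_e v vc|have [u hu] := near_e v vc]; exists u.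
(* After time 0 the sequence alternates between being within e/4 of l and not being within e of it,
   so consecutive positions are at least 3e/4 apart. *)
pose s := fix s n := if n is n'.+1 then f (odd n', s n') else 0 : R.
have sc n : s n < c by elim: n => //= n IH; have [] := hf (odd n, s n) IH.
have s_lt n : s n < s n.+1 by have [] := hf (odd n, s n) (sc n).
have s_good n : good (odd n) (s n.+1) by have [] := hf (odd n, s n) (sc n).
have s_ge0 n : 0 <= s n by elim: n => // n IH; exact: le_trans IH (ltW (s_lt n)).
exists (fun n => s n.+1); split=> // n _.
have [y1 p1 _] := inW _ (s_ge0 n.+1) (sc _); have [y2 p2 _] := inW _ (s_ge0 n.+2) (sc _).
rewrite p1 p2 /= lte_fin; have := s_good n; have := s_good n.+1.
have noteq b v z : good b v -> p v = Some z -> if b then e <= d z l else d z l < e / 4.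
  case: b => /=; last by case=> z' -> + [<-].
  by move=> ng pz; rewrite leNgt; apply/negP => dz; apply: ng; exists z.
move=> /noteq /(_ p2) /= + /noteq /(_ p1).
have := dist_triangle lcs y1 y2 l; have := dist_triangle lcs y2 y1 l.
rewrite (dist_sym lcs y2 y1); case: (odd n) => /=; lra.
Qed.

Lemma left_limit_unique c y o : 0 < c ->
  ocvg d (c^'-) p (Some y) -> ocvg d (c^'-) p o -> o = Some y.
Proof.
move=> c0 cy co.
have common A B : (c^'-)%classic A -> (c^'-)%classic B -> exists u, A u /\ B u.
  move=> /at_leftP[h h0 hA] /at_leftP[h' h'0 hB].
  pose m := Num.min h h'; have m0 : 0 < m by rewrite lt_min h0.
  exists (c - m / 2); split.
    have : m <= h by rewrite ge_min lexx.
    by move=> mh; apply: hA; lra.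
  have : m <= h' by rewrite ge_min lexx orbT.
  by move=> mh; apply: hB; lra.
case: o co => [z|] co.
  congr Some; apply: (dist_eq0 lcs); apply/eqP/negPn/negP => zy0.
  have dzy : 0 < d z y by rewrite lt_neqAle eq_sym zy0 (dist_ge0 lcs).
  have e0 : 0 < d z y / 2 by rewrite divr_gt0.
  have [u [[a pa day] [b pb dbz]]] := common _ _ (cy _ e0) (co _ e0).
  move: pb; rewrite pa => -[ab]; rewrite -{}ab in dbz.
  by have := dist_triangle lcs a z y; rewrite (dist_sym lcs z a); lra.
(* Convergence to the cemetery means leaving every compact set; local compactness supplies a compact
   ball around y that is not left. *)
have [r r0 cr] : exists2 r, 0 < r & mcompact d (cball d y r) by case: lcs => _ + _ _; exact.
have [u [[a pa day] h]] := common _ _ (cy _ r0) (co _ cr).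
by case: (h a pa); rewrite /cball /= (dist_sym lcs) ltW.
Qed.

Lemma left_limit_le c y x l : 0 < c -> ocvg d (c^'-) p (Some y) ->
  (forall u, 0 <= u -> u < c -> (odist d x (p u) < l%:E)%E) -> d x y <= l.
Proof.
move=> c0 cy lt_l; apply/ler_addgt0Pr => e e0.
have /at_leftP[h h0 hh] := cy e e0.
pose m := Num.min h c; have m0 : 0 < m by rewrite lt_min h0.
have mh : m <= h by rewrite ge_min lexx.
have mc : m <= c by rewrite ge_min lexx orbT.
have [||a pa day] := hh (c - m / 2); [by lra|by lra|].
have := lt_l (c - m / 2); rewrite pa /= lte_fin => h2.
have : d x a < l by apply: h2; lra.
by have := dist_triangle lcs a x y; lra.
Qed.
End PathGeometry.

(** * Jumps over annuli and the probability of an early exit *)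

Section Survival.
Context {R : realType} {dM : measure_display} {M : measurableType dM}
  (d : M -> M -> R)
  {dO : measure_display} {Om : measurableType dO}
  (Ft : R -> set_system Om) (X : R -> Om -> option M)
  (theta : R -> Om -> Om) (P : option M -> probability Om R)
  (Jm : M -> {measure set M -> \bar R}) (kill : M -> \bar R).
Context (lcs : lcs_borel_metric_space d).
Context (bsp : borel_standard_process d Ft X theta P).
Context (levy : levy_system d X P Jm kill).
Implicit Types (s t u v r e q a c L : R) (x y z : M) (w : Om).

Lemma measurable_dist_le x r : measurable [set y | d x y <= r].
Proof. exact: (measurable_cball lcs). Qed.

Lemma measurable_dist_ge x r : measurable [set y | r <= d x y].
Proof.
have := measurableC (measurable_mball lcs x r); congr (measurable _).
by apply/seteqP; split=> y /=; rewrite /mball /= leNgt => /negP.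
Qed.

(** The probability of [D] is at most the expected number of jumps over one of the K annuli. Such a
    jump has length at least L or kills the process, so the Lévy system bounds its rate by c. *)
Lemma jump_le x L K c t (D : set Om) : 0 < L -> 0 < t -> 0 <= c -> measurable D ->
  (forall z, d x z < K%:R * L -> (Jm z (~` mball d z L) + kill z <= c%:E)%E) ->
  (forall w, D w -> exists s (a : M) i, [/\ 0 < s <= t, Xleft d X s w = Some a, (i < K)%N,
     d x a <= i%:R * L & ((i.+1%:R * L)%:E <= odist d x (X s w))%E]) ->
  (P (Some x) D <= (c * t)%:E)%E.
Proof.
move=> L0 t0 c0 mD HJ HD.
pose S := [set p : M * M | exists i, (i < K)%N /\
  (d x p.1 <= i%:R * L /\ i.+1%:R * L <= d x p.2)].
pose S2 := [set z | exists i, (i < K)%N /\ d x z <= i%:R * L].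
have mS : measurable S.
  apply: sig_ex => [|i]; first exact: sigma_algebra_measurable.
  apply: sig_if => [|_]; first exact: sigma_algebra_measurable.
  have := measurableX (measurable_dist_le x (i%:R * L)) (measurable_dist_ge x (i.+1%:R * L)).
  by congr (measurable _); apply/seteqP; split=> -[y z].
have mS2 : measurable S2.
  apply: sig_ex => [|i]; first exact: sigma_algebra_measurable.
  apply: sig_if => [|_]; first exact: sigma_algebra_measurable.
  exact: measurable_dist_le.
pose F1 p := (\1_S p)%:E : \bar R; pose F2 z := (\1_S2 z)%:E : \bar R.
have mF1 : measurable_fun setT F1 by apply/measurable_EFinP; exact: measurable_indic.
have mF2 : measurable_fun setT F2 by apply/measurable_EFinP; exact: measurable_indic.
have F10 p : (0 <= F1 p)%E by rewrite lee_fin indicE.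
have F20 z : (0 <= F2 z)%E by rewrite lee_fin indicE.
have F1d z : F1 (z, z) = 0%E.
  rewrite /F1 indicE memNset //= => -[i [_ /= [h1 h2]]].
  have := le_trans h2 h1; rewrite ler_pM2r // ler_nat ltnn //.
have [mJ mk k0 /(_ F1 F2 mF1 mF2 F10 F20 F1d x t t0)] := levy.
pose JF (o : option M) : \bar R :=
  if o is Some z then (\int[Jm z]_y F1 (z, y) + F2 z * kill z)%E else 0%E.
move=> Elevy.
have JF0 o : (0 <= JF o)%E.
  case: o => [z|] //=; apply: adde_ge0; first by apply: integral_ge0.
  exact: mule_ge0.
have JFc o : (JF o <= c%:E)%E.
  case: o => [z|] /=; last by rewrite lee_fin.
  pose Sz := [set y | S (z, y)].
  have mSz : measurable Sz.
    apply: sig_ex => [|i]; first exact: sigma_algebra_measurable.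
    apply: sig_if => [|_]; first exact: sigma_algebra_measurable.
    rewrite /=; apply: sig_if => [|_]; first exact: sigma_algebra_measurable.
    exact: measurable_dist_ge.
  have -> : (\int[Jm z]_y F1 (z, y))%E = Jm z Sz.
    transitivity (Jm z (Sz `&` setT)); last by rewrite setIT.
    rewrite -(integral_indic _ measurableT mSz).
    apply: eq_integral => y _; rewrite /F1 !indicE; congr (_%:R%:E).
  (* Counted jumps start from [S2] only, where the rate bound is available; elsewhere the rate is
     0. *)
  have [zS|nzS] := pselect (S2 z).
    have dz : d x z < K%:R * L.
      case: zS => i [iK] /le_lt_trans; apply; by rewrite ltr_pM2r // ltr_nat.
    apply: le_trans (HJ z dz); rewrite /F2 indicE mem_set // mul1e.
    apply: leeD => //; apply: le_measure; rewrite ?inE //.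
      by apply: measurableC; exact: (measurable_mball lcs).
    move=> y [i [_ /= [h1 h2]]]; rewrite /mball /= => zy.
    have := dist_triangle lcs z x y; move: h2; rewrite -natr1 mulrDl mul1r.
    by move: h1 zy; move: (i%:R * L) => lev; lra.
  rewrite /F2 indicE memNset // mul0e adde0.
  rewrite (_ : Sz = set0) ?measure0 ?lee_fin //.
  by apply/seteqP; split=> y //= [i [iK [/= h1 _]]]; apply: nzS; exists i.
have le_t : (\int[P (Some x)]_w (\int[lebesgue_measure]_(s in [set s : R | (0 <= s <= t)%R])
    JF (X s w)) <= (c * t)%:E)%E.
  apply: (@le_trans _ _ (\int[P (Some x)]_w (cst (c * t)%:E w))%E); last first.
    rewrite integral_cst // [X in (_ * X <= _)%E](_ : _ = 1%E) ?mule1 //.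
  exact: probability_setT.
  apply: ge0_le_integral_nomeas => w _; first exact: integral_ge0.
  apply: (@le_trans _ _ (\int[lebesgue_measure]_(s in [set s : R | (0 <= s <= t)%R]) (cst c%:E s))%E).
    exact: ge0_le_integral_nomeas.
  have -> : [set s : R | (0 <= s <= t)%R] = `[0, t]%classic.
    by apply/seteqP; split=> s /=; rewrite in_itv.
  rewrite integral_cst // [X in (_ * X <= _)%E](_ : _ = t%:E) ?EFinM //.
  transitivity (lebesgue_measure `[0, t]%classic : \bar R) => //.
  by rewrite lebesgue_measure_itv /= lte_fin t0 sube0.
apply: le_trans le_t; rewrite /JF -Elevy.
rewrite -[X in P _ X](setIT D) -(integral_indic _ measurableT mD).
apply: ge0_le_integral_nomeas => w _; first by rewrite lee_fin indicE.
rewrite indicE; have [Dw|nD] := pselect (D w); last first.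
  rewrite memNset //; apply: esum_ge0 => s _.
  by case: (Xleft d X s w) => [a|//]; case: (X s w).
rewrite mem_set //.
have [s [a [i [st Xs iK dxa dxX]]]] := HD w Dw.
(* The one jump at s already contributes 1 to the sum. *)
apply: esum_ge; exists [set s].
  by split; [exact: finite_set1|move=> s' ->].
rewrite fsbig_set1 Xs.
case: (X s w) dxX => [y|] /=; last first.
  by move=> _; rewrite /F2 indicE mem_set //; exists i.
by rewrite lee_fin => h; rewrite /F1 indicE mem_set //; exists i.
Qed.

Definition exits_before x l t : set Om :=
  [set w | exists m k, dyadic m k < t /\ (l%:E <= odist d x (X (dyadic m k) w))%E].

Lemma measurable_exits_before x l t : measurable (exits_before x l t).
Proof.
have sm := @sigma_algebra_measurable _ Om.
apply: sig_ex => // m; apply: sig_ex => // k; apply: sig_if => // _.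
apply: (sig_odist_ge lcs) => // B mB; apply: (measurable_at bsp) => //.
exact: dyadic_ge0.
Qed.

(** The term q^N is the cost of a chain of N moves and c t that of a jump over an annulus. The
    escape bounds at arbitrarily small radii, with some q' < 1 each, make endless oscillation a null
    event; this provides the left limit at the jump, also when the jump is the killing. *)
Lemma exits_before_le x L r N t q c : let K := (2 * N).+1 in
  0 < L -> r + r < L -> 0 < t -> 0 <= q -> 0 <= c ->
  (forall z, d x z < K%:R * L -> (Jm z (~` mball d z L) + kill z <= c%:E)%E) ->
  (forall z, d x z < K%:R * L ->
     (P (Some z) [set w | escape d r t (fun u => X u w)] <= q%:E)%E) ->
  (forall e, 0 < e -> exists r' q', [/\ r' + r' < e, 0 <= q', q' < 1 &
     forall z, d x z < K%:R * L ->
     (P (Some z) [set w | escape d r' t (fun u => X u w)] <= q'%:E)%E]) ->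
  sequentially_compact_in d (mball d x (K%:R * L)) ->
  (P (Some x) (exits_before x (K%:R * L) t) <= (q ^+ N + c * t)%:E)%E.
Proof.
move=> K L0 rL t0 q0 c0 HJ HE HO cW.
have sm := @sigma_algebra_measurable _ Om.
set W := mball d x (K%:R * L); have mW : measurable W by exact: (measurable_mball lcs).
(* The amplitudes 2^-j exhaust all oscillations by countably many events. *)
have /choice[rq hrq] : forall j : nat, exists rq : R * R,
  [/\ rq.1 + rq.1 < 2^-1 ^+ j, 0 <= rq.2, rq.2 < 1 &
     forall z, d x z < K%:R * L ->
     (P (Some z) [set w | escape d rq.1 t (fun u => X u w)] <= rq.2%:E)%E].
  move=> j; have [|r' [q' h]] := HO (2^-1 ^+ j); first by rewrite exprn_gt0.
  by exists (r', q').
pose osc j : set Om := [set w | forall n, chain_liminf d X W (rq j).1 t n w].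
have mliminf r' n : measurable (chain_liminf d X W r' t n).
  exact: (measurable_chain_liminf lcs bsp).
have mosc j : measurable (osc j) by apply: sig_all.
have osc0 j : P (Some x) (osc j) = 0%E.
  have [_ q'0 q'1 h] := hrq j; apply/eqP; rewrite -measure_le0.
  apply/lee_addgt0Pr => e e0; rewrite add0e.
  have cv : (fun n : nat => (rq j).2 ^+ n : R) @ \oo --> (0 : R).
    by apply: cvg_expr; rewrite ger0_norm.
  have [n _ hn] := cvgr_lt _ cv _ e0.
  apply: (@le_trans _ _ ((rq j).2 ^+ n)%:E); last by rewrite lee_fin; exact/ltW/hn/leqnn.
  apply: le_trans (chain_liminf_le lcs bsp mW q'0 h n (Some x)).
  by apply: le_measure; rewrite ?inE // => w.
pose Z := \bigcup_j osc j.
have mZ : measurable Z by exact: bigcupT_measurable.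
have Z0 : P (Some x) Z = 0%E.
  apply/(negligibleP _ mZ)/negligible_bigcup => j.
  by apply/negligibleP => //; exact: osc0.
set H := exits_before x (K%:R * L) t.
have mH : measurable H by exact: measurable_exits_before.
pose C := chain_liminf d X W r t N.
have mC : measurable C by exact: mliminf.
pose X0 := [set w | X 0 w = Some x].
have mX0 : measurable X0 by exact: (measurable_start lcs bsp).
pose D := ((H `&` X0) `\` C) `\` Z.
have mD : measurable D.
  apply: measurableD => //; apply: measurableD => //; exact: measurableI.
rewrite (start_setI lcs bsp) // -/X0.
apply: (@le_trans _ _ (P (Some x) ((C `|` D) `|` Z))).
  apply: le_measure; rewrite ?inE //; first exact: measurableI.
    by apply: measurableU => //; exact: measurableU.
  move=> w Hw; have [Cw|nC] := pselect (C w); first by left; left.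
  by have [Zw|nZ] := pselect (Z w); [right|left; right].
apply: le_trans (measureU2 _ _ _) _ => //; first exact: measurableU.
rewrite [X in (_ + X <= _)%E](_ : _ = 0%E) ?adde0; last exact: Z0.
apply: le_trans (measureU2 _ _ _) _ => //.
rewrite EFinD; apply: leeD; first exact: (chain_liminf_le lcs bsp mW q0 HE N).
apply: (jump_le (L := L) (K := K)) => //.
move=> w [[[[m [k [kt kX]]] w0] nC] nZ].
have rp := process_regular bsp w.
have [[c' c'k chc]|[i [c' [iK c'0 c'k lt_i ge_i]]]] :=
  exit_chain_or_jump lcs rp w0 L0 rL (dyadic_ge0 m k) kX.
  exfalso; apply: nC; apply: (full_chain_liminf lcs bsp) chc.
  exact: le_trans c'k (ltW kt).
have inW u : 0 <= u -> u < c' -> exists2 y, X u w = Some y & W y.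
  move=> u0 uc; have /odist_ltP[y Xy dy] := lt_i u u0 uc.
  exists y => //; rewrite /W /mball /=; apply: lt_trans dy _.
  by rewrite ltr_pM2r // ltr_nat.
have c't : c' <= t by exact: le_trans c'k (ltW kt).
have [[y cy]|[e e0 he]] := left_limit_or_oscillation lcs cW c'0 inW; last first.
  exfalso; apply: nZ; have [j hj] := exists_halfpow_lt e0.
  exists j => // n; apply: (full_chain_liminf lcs bsp) c't _.
  apply: he; have [h _ _ _] := hrq j; apply: lt_trans h _; exact: hj.
exists c', y, i; split=> //; first by rewrite c'0.
- rewrite /Xleft; case: xgetP => [v _ /= cv|/(_ (Some y)) //].
  exact: (left_limit_unique lcs c'0 cy cv).
- exact: (left_limit_le lcs c'0 cy lt_i).
Qed.
End Survival.

(** * Logarithmic estimates for the time scales *)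

Section Arithmetic.
Context {R : realType}.
Implicit Types (a b c e t y : R) (j k n : nat).

Lemma le_truncnS y : 0 <= y -> y <= (Num.truncn y).+1%:R.
Proof. by move=> /truncn_itv/andP[_ /ltW]. Qed.

Lemma truncnS_le y : 0 <= y -> (Num.truncn y).+1%:R <= y + 1.
Proof. by move=> /truncn_itv/andP[h _]; rewrite -natr1 lerD2r. Qed.

Lemma ln_succ_le j : ln (j.+1%:R : R) <= j%:R.
Proof. by rewrite -natr1 addrC; apply: le_ln1Dx; apply: lt_le_trans (_ : 0 <= _); rewrite ?ltrN10. Qed.

Lemma ln_succ_ge0 j : 0 <= ln (j.+1%:R : R).
Proof. by apply: ln_ge0; rewrite ler1n. Qed.

Lemma ln_succ_ge j : (1 <= j)%N -> 2^-1 <= ln (j.+1%:R : R).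
Proof.
move=> j1; have j0 : (0 : R) < j.+1%:R by rewrite ltr0n.
have : ln (1 + (j.+1%:R^-1 - 1) : R) <= j.+1%:R^-1 - 1.
  by apply: le_ln1Dx; rewrite ltrDr invr_gt0.
rewrite addrC subrK lnV ?posrE // => h.
have : (j.+1%:R^-1 : R) <= 2^-1 by rewrite lef_pV2 ?posrE // ler_nat.
by move: h; move: (ln _) (_.+1%:R^-1) => l v; lra.
Qed.

(* exp(j/2) >= (1 + j/4)^2 beats any affine function *)
Lemma affine_le_exp a b : exists J, forall j, (J <= j)%N ->
  a * j%:R + b <= expR (j%:R / 2).
Proof.
exists (16 * (Num.truncn `|a|).+1 + 16 * (Num.truncn `|b|).+1)%N => j Jj.
have h4 : expR (j%:R / 2 : R) = expR (j%:R / 4) ^+ 2.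
  by rewrite expr2 -expRD -mulrDl; congr expR; lra.
have j0 : (0 : R) <= j%:R by [].
have h1 : 1 + j%:R / 4 <= expR (j%:R / 4 : R) by exact: expR_ge1Dx.
rewrite h4; apply: (@le_trans _ _ ((1 + j%:R / 4) ^+ 2)); last first.
  by rewrite lerXn2r ?nnegrE ?expR_ge0 // addr_ge0 // divr_ge0.
have aj := le_truncnS (normr_ge0 a); have bj := le_truncnS (normr_ge0 b).
have a' := ler_norm a; have b' := ler_norm b.
move: Jj; rewrite -(ler_nat R) natrD !natrM => Jj.
set A : R := (_.+1)%:R in aj Jj; set B : R := (_.+1)%:R in bj Jj.
have A0 : 0 <= A by rewrite /A. have B1 : 1 <= B by rewrite /B ler1n.
have : a * j%:R <= A * j%:R by rewrite ler_wpM2r // (le_trans a').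
have : A * j%:R + B * j%:R <= j%:R / 16 * j%:R by rewrite -mulrDl ler_wpM2r //; lra.
have : B <= B * j%:R.
  by rewrite ler_peMr //; lra.
rewrite expr2; lra.
Qed.

Lemma abs_ln_gt t c : 0 < t -> t <= expR (- c) -> 0 <= c -> c <= `|ln t|.
Proof.
move=> t0 tc c0; have : ln t <= - c by rewrite -[- c]expRK ler_ln ?posrE ?expR_gt0.
by move=> h; rewrite ler0_norm; lra.
Qed.

(** Since |ln t| >= j/2, it suffices that (j/2)^2 >= j + 1, which holds from j = 6 on. *)
Lemma lnln_ge j t : (6 <= j)%N -> 0 < t -> t <= expR (- (j%:R / 2)) ->
  ln (j.+1%:R : R) / 2 <= ln `|ln t|.
Proof.
move=> j6 t0 tj; have jR : (6 : R) <= j%:R by rewrite ler_nat.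
have hj : j%:R / 2 <= `|ln t| by apply: abs_ln_gt => //; lra.
have h : ln (j%:R / 2) <= ln `|ln t| by rewrite ler_ln ?posrE; lra.
apply: le_trans h; rewrite ler_pdivrMr // mulr_natr -lnXn ?divr_gt0 ?ltr0n //; last by lia.
by rewrite ler_ln ?posrE ?exprn_gt0 ?divr_gt0 ?ltr0n //; [rewrite -natr1 expr2; nra|lia].
Qed.

(** The number n of mean exit times at which e^(-c n) is of order 1/(k+1). With c = C7/2 the upper
    tail becomes summable, with c = C5 the lower tail stays harmonic. *)
Definition log_count c k : nat := (Num.truncn (ln (k.+1%:R : R) / c)).+1.

Lemma log_count_ge c k : 0 < c -> ln (k.+1%:R : R) <= c * (log_count c k)%:R.
Proof.
by move=> c0; rewrite mulrC -ler_pdivrMr //; apply: le_truncnS; rewrite divr_ge0 ?ln_succ_ge0 // ltW.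
Qed.

Lemma log_count_le c k : 0 < c -> (log_count c k)%:R <= ln (k.+1%:R : R) / c + 1.
Proof. by move=> c0; apply: truncnS_le; rewrite divr_ge0 ?ln_succ_ge0 // ltW. Qed.

Lemma log_count_affine c k : 0 < c -> (log_count c k)%:R <= c^-1 * k%:R + 1 :> R.
Proof.
move=> c0; apply: le_trans (log_count_le k c0) _; rewrite lerD2r mulrC.
by rewrite ler_pM2l ?invr_gt0 // ln_succ_le.
Qed.

(** The constant: l = ln (j+1) is at most 2 log|log t| and at least 1/2, so l/c + 1 is at most (2/c
    + 4) log|log t|. *)
Lemma lower_scale c : 0 < c -> exists J, forall j, (J <= j)%N -> forall t, 0 < t ->
  t <= (log_count c j)%:R * expR (- j%:R) ->
  t <= expR (- (j%:R / 2)) /\ (log_count c j)%:R <= (2 / c + 4) * ln `|ln t|.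
Proof.
move=> c0; have [J hJ] := affine_le_exp c^-1 1.
exists (maxn J 6) => j; rewrite geq_max => /andP[Jj j6] t t0 tj.
have tj2 : t <= expR (- (j%:R / 2)).
  apply: le_trans tj _; have -> : - (j%:R / 2) = j%:R / 2 + - j%:R :> R by lra.
  by rewrite expRD ler_pM2r ?expR_gt0 // (le_trans (log_count_affine j c0)) // hJ.
split=> //; have := lnln_ge j6 t0 tj2; have := log_count_le j c0.
have := @ln_succ_ge j (leq_trans _ j6) => /(_ isT).
set l := ln _; set n := (_)%:R; set u := ln _ => h1 h2 h3.
have ci : 0 < c^-1 by rewrite invr_gt0.
have : l / c <= 2 * u / c by rewrite ler_pM2r //; lra.
have -> : 2 * u / c = 2 / c * u by rewrite mulrAC.
by rewrite mulrDl; lra.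
Qed.

(** Here |ln t| is about B k^2. Bounding it by (k+1)^3 absorbs B and ln e for large k and costs only
    the factor 3 after taking the logarithm. *)
Lemma upper_scale c (B : R) e : 0 < c -> 0 < B -> 0 < e -> exists J, forall k, (J <= k)%N -> forall t,
  t = e * (log_count c k)%:R * expR (- (B * k%:R ^+ 2)) ->
  [/\ 0 < t, t < 1, 0 < ln `|ln t| & ln `|ln t| <= 3 * c * (log_count c k)%:R].
Proof.
move=> c0 B0 e0; have [J hJ] := affine_le_exp (e / c) e.
have BV0 : 0 < B^-1 by rewrite invr_gt0.
pose z := 3 / B; have z0 : 0 < z by rewrite divr_gt0.
have zB : z * B = 3 by rewrite divfK // gt_eqF.
have le0 := normr_ge0 (ln e).
pose y := 16 + 16 * B + `|ln e| + z.
have y0 : 0 <= y by rewrite /y; lra.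
exists (maxn J (Num.truncn y).+1) => k; rewrite geq_max => /andP[Jk yk] t tE.
have ky : y <= k%:R by apply: le_trans (le_truncnS y0) _; rewrite ler_nat.
have n1 : (1 : R) <= (log_count c k)%:R by rewrite ler1n.
have n0 := lt_le_trans ltr01 n1.
have nB := log_count_affine k c0.
have t0 : 0 < t by rewrite tE !mulr_gt0 ?expR_gt0.
have [k16 kBB ke kz] : [/\ (16 : R) <= k%:R, 16 * B <= k%:R, `|ln e| <= k%:R & z <= k%:R].
  by move: ky; rewrite /y => ky; split; lra.
have kB3 : 3 <= B * k%:R by rewrite -zB mulrC ler_pM2l.
have tlt : t <= expR (- k%:R).
  rewrite tE; apply: (@le_trans _ _ (expR (k%:R / 2) * expR (- (B * k%:R ^+ 2)))).
    rewrite ler_pM2r ?expR_gt0 //; apply: le_trans (hJ k Jk).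
    by have := ler_wpM2l (ltW e0) nB; rewrite mulrDr mulr1 mulrA.
  rewrite -expRD ler_expR expr2.
  have : 3 * k%:R <= B * k%:R * k%:R by rewrite ler_wpM2r.
  by rewrite mulrA; lra.
have lnt : k%:R <= `|ln t| by apply: abs_ln_gt.
have t1 : t < 1 by apply: le_lt_trans tlt _; rewrite -[ltRHS]expR0 ltr_expR; lra.
split=> //; first by apply: ln_gt0; lra.
have lnup : `|ln t| <= (k.+1%:R) ^+ 3.
  rewrite ltr0_norm ?ln_lt0 ?t0 // tE !lnM ?posrE ?mulr_gt0 ?expR_gt0 // expRK.
  have lnn : 0 <= ln ((log_count c k)%:R : R) by apply: ln_ge0.
  have lne : - ln e <= k%:R by apply: le_trans ke; rewrite -normrN ler_norm.
  have : 16 * B * (k%:R * k%:R) <= k%:R * (k%:R * k%:R) by rewrite ler_wpM2r // mulr_ge0.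
  have : 0 <= k%:R * k%:R :> R by rewrite mulr_ge0.
  have kkk : 0 <= k%:R * (k%:R * k%:R) :> R by rewrite !mulr_ge0.
  rewrite -[k.+1%:R]natr1 [k%:R ^+ 2]expr2.
  rewrite (_ : (k%:R + 1) ^+ 3 = k%:R * (k%:R * k%:R) + 3 * (k%:R * k%:R) + 3 * k%:R + 1);
    last by ring.
  lra.
have : ln `|ln t| <= ln (k.+1%:R ^+ 3) by rewrite ler_ln ?posrE ?exprn_gt0 ?ltr0n //; lra.
move=> /le_trans; apply; rewrite lnXn ?ltr0n // -[ln _ *+ 3]mulr_natl.
by have := log_count_ge k c0; lra.
Qed.

Lemma sum_inv_sq_le n : \sum_(0 <= k < n) (k.+1%:R ^- 2 : R) <= 2.
Proof.
(* Telescoping bound; at n = 0 the inverse is 0 by convention. *)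
suff : \sum_(0 <= k < n) (k.+1%:R ^- 2 : R) <= 2 - n%:R^-1.
  by move/le_trans; apply; rewrite gerBl invr_ge0.
elim: n => [|n IH]; first by rewrite big_geq // invr0 subr0.
rewrite big_nat_recr //=; case: n IH => [|n] IH.
  by rewrite big_geq // add0r expr1n invr1; lra.
have n0 : (0 : R) < n.+1%:R by rewrite ltr0n.
have n2 : (0 : R) < n.+2%:R by rewrite ltr0n.
apply: le_trans (lerD IH (lexx _)) _.
suff : (n.+2%:R ^- 2 : R) <= n.+1%:R^-1 - n.+2%:R^-1.
  by move: (_ ^- 2) (n.+1%:R^-1) (n.+2%:R^-1) => u v1 v2; lra.
have -> : n.+1%:R^-1 - n.+2%:R^-1 = (n.+1%:R * n.+2%:R)^-1 :> R.
  have : n.+2%:R = n.+1%:R + 1 :> R by rewrite natr1.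
  move: (n.+1%:R) (n.+2%:R) n0 n2 => u v u0 v0 vE.
  by rewrite vE in v0 *; field; rewrite ?gt_eqF.
by rewrite -exprVn exprVn lef_pV2 ?posrE ?mulr_gt0 ?exprn_gt0 // expr2 ler_pM2r // ler_nat.
Qed.
End Arithmetic.

Section BorelCantelli.
Context {R : realType} {dO : measure_display} {Om : measurableType dO}.

Lemma borel_cantelli (Q : probability Om R) (A : nat -> set Om) (b : nat -> R) (S : R) :
  (forall k, measurable (A k)) -> (forall k, 0 <= b k) ->
  (forall k, (Q (A k) <= (b k)%:E)%E) ->
  (forall n, \sum_(0 <= k < n) b k <= S) ->
  {ae Q, forall w, exists K, forall k, (K <= k)%N -> ~ A k w}.
Proof.
move=> mA b0 Ab Sb.
have fin : (\sum_(0 <= n <oo) Q (A n) < +oo)%E.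
  apply: (@le_lt_trans _ _ S%:E); last by rewrite ltry.
  apply: lime_le; first by apply: is_cvg_nneseries => n _ _; exact: measure_ge0.
  apply: nearW => n; apply: (@le_trans _ _ (\sum_(0 <= k < n) (b k)%:E)%E).
    by apply: lee_sum => k _.
  by rewrite sumEFin lee_fin.
exists (lim_sup_set A); split.
- by apply: bigcapT_measurable => n; apply: bigcup_measurable => k _.
- exact: lim_sup_set_cvg0.
move=> w /= nw n _; apply: contrapT => nA; apply: nw; exists n => k nk Ak.
by apply: nA; exists k.
Qed.
End BorelCantelli.

(** * Geometric sums, harmonic products and superexponential scales *)

Section Series.
Context {R : realType}.
Implicit Types (a b c e t y p q : R) (j k n m : nat).

Lemma sum_geometric_le q n : 0 <= q -> q < 1 ->
  \sum_(0 <= k < n) q ^+ k <= (1 - q)^-1.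
Proof.
move=> q0 q1; have d0 : 0 < 1 - q by rewrite subr_gt0.
suff -> : \sum_(0 <= k < n) q ^+ k = (1 - q ^+ n) / (1 - q).
  by rewrite ler_pdivrMr // mulVf ?gt_eqF // gerBl exprn_ge0.
elim: n => [|n IH]; first by rewrite big_geq // expr0 subrr mul0r.
by rewrite big_nat_recr //= IH exprS; field; rewrite gt_eqF.
Qed.

Lemma mulr_expRN_le1 y : y * expR (- y) <= 1.
Proof.
rewrite expRN ler_pdivrMr ?expR_gt0 // mul1r.
by apply: le_trans (expR_ge1Dx y); rewrite lerDr.
Qed.

(** From 1 - y <= e^(-y) and 1/(m+1) >= ln (m+2) - ln (m+1) the exponent telescopes. *)
Lemma prod_harmonic_le p m j : 0 <= p -> p <= 1 ->
  \prod_(i < j) (1 - p / (m + i).+1%:R) <=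
  expR (- (p * (ln ((m + j).+1%:R : R) - ln (m.+1%:R : R)))).
Proof.
move=> p0 p1; elim: j m => [|j IH] m; first by rewrite big_ord0 addn0 subrr mulr0 oppr0 expR0.
rewrite big_ord_recl /= addn0.
have -> : \prod_(i < j) (1 - p / (m + bump 0 i).+1%:R) =
    \prod_(i < j) (1 - p / (m.+1 + i).+1%:R) :> R.
  by apply: eq_bigr => i _; rewrite /bump leq0n add1n addnS addSn.
have m0 : (0 : R) < m.+1%:R by rewrite ltr0n.
have m20 : (0 : R) < m.+2%:R by rewrite ltr0n.
apply: (@le_trans _ _ (expR (- (p * (ln (m.+2%:R : R) - ln (m.+1%:R : R)))) *
   expR (- (p * (ln ((m.+1 + j).+1%:R : R) - ln (m.+2%:R : R)))))); last first.
  rewrite -expRD ler_expR addSn addnS; lra.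
have fge0 i : 0 <= 1 - p / i.+1%:R.
  by rewrite subr_ge0 ler_pdivrMr ?ltr0n // mul1r (le_trans p1) // ler1n.
apply: (ler_pM (fge0 m) _ _ (IH m.+1)); first by apply: prodr_ge0.
apply: le_trans (expR_ge1Dx _) _; rewrite ler_expR lerN2 ler_wpM2l //.
rewrite -ln_div ?posrE // -natr1 mulrDl mul1r divff ?gt_eqF // .
by apply: le_ln1Dx; apply: lt_trans (_ : 0 < _); rewrite ?ltrN10 ?invr_gt0.
Qed.

(** Divergence of the harmonic series in product form; together with conditional bounds it replaces
    the second Borel-Cantelli lemma, as no independence is available. *)
Lemma prod_harmonic_small p m e : 0 < p -> p <= 1 -> 0 < e ->
  exists j, \prod_(i < j) (1 - p / (m + i).+1%:R) < e.
Proof.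
(* Chosen so that the exponent p (ln y - ln (m+1)) equals 1 - ln e, one more than required. *)
move=> p0 p1 e0; pose y := expR (ln (m.+1%:R : R) + (1 - ln e) / p).
have y0 : 0 <= y by exact: expR_ge0.
exists (Num.truncn y); apply: le_lt_trans (prod_harmonic_le _ _ (ltW p0) p1) _.
set j := Num.truncn y; rewrite -ltr_ln ?posrE ?expR_gt0 // expRK.
have : ln (m.+1%:R : R) + (1 - ln e) / p <= ln ((m + j).+1%:R : R).
  rewrite -[leLHS]expRK ler_ln ?posrE ?expR_gt0 ?ltr0n //.
  apply: le_trans (le_truncnS y0) _; rewrite ler_nat ltnS leq_addl //.
rewrite -lerBrDl ler_pdivrMr // => h.
by move: h; set l1 := ln _; set l2 := ln _; set l3 := ln _; rewrite mulrC; lra.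
Qed.

Lemma upper_time_decreasing c B e : 0 < c -> 1 <= B -> 0 < e -> exists J,
  forall k, (J <= k)%N ->
  e * (log_count c k.+1)%:R * expR (- (B * k.+1%:R ^+ 2)) <
  e * (log_count c k)%:R * expR (- (B * k%:R ^+ 2)).
Proof.
move=> c0 B1 e0; have [J hJ] := affine_le_exp c^-1 (c^-1 + 1).
exists J => k Jk; rewrite -!mulrA ltr_pM2l //.
have n1 : (1 : R) <= (log_count c k)%:R by rewrite ler1n.
apply: (@lt_le_trans _ _ (expR (- (B * k%:R ^+ 2)))); last first.
  by rewrite ler_peMl // expR_ge0.
have -> : - (B * k.+1%:R ^+ 2) = - (B * k%:R ^+ 2) - B * (2 * k%:R + 1) :> R.
  by rewrite -natr1; ring.
rewrite expRD mulrCA gtr_pMr ?expR_gt0 //.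
have h : (log_count c k.+1)%:R <= expR (k%:R / 2 : R).
  apply: le_trans (log_count_affine k.+1 c0) _.
  by apply: le_trans (hJ k Jk); rewrite -[k.+1%:R]natr1 mulrDr mulr1 addrA.
apply: (@le_lt_trans _ _ (expR (k%:R / 2) * expR (- (B * (2 * k%:R + 1))))).
  by rewrite ler_pM2r ?expR_gt0.
rewrite -expRD -[ltRHS]expR0 ltr_expR.
have k0 : (0 : R) <= k%:R by [].
have : 1 * (2 * k%:R + 1) <= B * (2 * k%:R + 1) by rewrite ler_wpM2r //; lra.
by move: (B * _) => z; lra.
Qed.

(** Write (k+1)^2 = k^2 + k + (k+1). The term B k turns A^k into e^(-k), by the choice of B, and the
    term B (k+1) absorbs the logarithmic count. *)
Lemma upper_tail_bound c A B k : 0 < c -> 1 <= A -> B = ln A + 1 ->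
  A ^+ k * ((log_count c k.+1)%:R * expR (- (B * k.+1%:R ^+ 2))) <=
  (c^-1 + 1) * expR (- 1) ^+ k * expR (- (B * k%:R ^+ 2)).
Proof.
move=> c0 A1 BE; have A0 : 0 < A := lt_le_trans ltr01 A1.
have lA : 0 <= ln A by apply: ln_ge0.
have B1 : 1 <= B by rewrite BE lerDr.
have ci : 0 < c^-1 by rewrite invr_gt0.
have -> : - (B * k.+1%:R ^+ 2) = - (B * k%:R ^+ 2) + - (B * k%:R) + - (B * k.+1%:R).
  by rewrite -natr1; ring.
rewrite !expRD; set E := expR (- (B * k%:R ^+ 2)).
have AE : A ^+ k * expR (- (B * k%:R)) = expR (- 1) ^+ k.
  rewrite -[A in A ^+ _]lnK ?posrE // -!expRM_natl -expRD; congr expR.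
  by rewrite BE; ring.
have nE : (log_count c k.+1)%:R * expR (- (B * k.+1%:R)) <= c^-1 + 1.
  apply: (@le_trans _ _ ((c^-1 * k.+1%:R + 1) * expR (- k.+1%:R))).
    apply: ler_pM; rewrite ?expR_ge0 //; first exact: log_count_affine.
    by rewrite ler_expR lerN2 ler_peMl.
  rewrite mulrDl mul1r -mulrA; apply: lerD.
    by rewrite ler_piMr ?mulr_expRN_le1 // ltW.
  by rewrite -[leRHS]expR0 ler_expR lerNl oppr0.
rewrite (_ : A ^+ k * _ = E * (A ^+ k * expR (- (B * k%:R))) *
  ((log_count c k.+1)%:R * expR (- (B * k.+1%:R)))); last by ring.
rewrite AE (_ : (c^-1 + 1) * _ * E = E * expR (- 1) ^+ k * (c^-1 + 1)); last by ring.
by rewrite ler_pM2l // mulr_gt0 ?exprn_gt0 ?expR_gt0.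
Qed.
End Series.

(** * The lower limit at 0 and almost sure constancy *)

Section LiminfAtZero.
Context {R : realType}.
Implicit Types (t u v c : R) (f : R -> R).

Lemma le_liminf_at0 f c : (exists2 e, 0 < e & forall t, 0 < t -> t < e -> c <= f t) ->
  (c%:E <= limf_einf (fun t => (f t)%:E) 0^'+)%E.
Proof.
move=> [e e0 h]; rewrite limf_einfE; apply: le_ereal_sup_tmp.
exists (ereal_inf ((fun t => (f t)%:E) @` [set t | 0 < t < e])).
  exists [set t | 0 < t < e] => //; apply/at_rightP; exists e => // t t0.
  by rewrite add0r /= t0.
by apply: le_ereal_inf_tmp => _ [t /= /andP[t0 te] <-]; rewrite lee_fin h.
Qed.

Lemma lt_liminf_at0 f c : (c%:E < limf_einf (fun t => (f t)%:E) 0^'+)%E ->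
  exists2 c', c < c' & exists2 e, 0 < e & forall t, 0 < t -> t < e -> c' <= f t.
Proof.
rewrite limf_einfE => /ereal_sup_gt[_ [V /at_rightP[e e0 Ve] <-]].
have lV t : 0 < t -> t < e -> (ereal_inf ((fun t => (f t)%:E) @` V) <= (f t)%:E)%E.
  move=> t0 te; apply: ereal_inf_lbound; exists t => //.
  by apply: Ve => //; rewrite add0r.
case: (ereal_inf _) lV => [r| |] lV.
- by rewrite lte_fin => cr; exists r => //; exists e => // t t0 te; rewrite -lee_fin lV.
- have := lV (e / 2) ltac:(by rewrite divr_gt0) ltac:(by rewrite ltr_pdivrMr // ltr_pMr // ltr1n).
  by rewrite leye_eq.
- by [].
Qed.

Lemma ln_abs_ln_gt0 t : 0 < t -> t < expR (-1) -> 0 < ln `|ln t|.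
Proof.
move=> t0 te; have : ln t < -1 by rewrite -[-1]expRK ltr_ln ?posrE ?expR_gt0.
by move=> h; rewrite ln_gt0 // ltr0_norm; lra.
Qed.

(** Continuity of the gauge, valid since t < 1/e keeps log|log t| positive. It allows passing from t
    to a slightly earlier time. *)
Lemma lil_gauge_left t c : 0 < t -> t < expR (-1) -> c < t / ln `|ln t| ->
  exists u, [/\ 0 < u, u < t & forall v, u < v -> v <= t -> c < v / ln `|ln v|].
Proof.
move=> t0 te ct; have l0 := ln_abs_ln_gt0 t0 te.
have cl : {for t, continuous (fun v : R => ln `|ln v|)}.
  have ln0t : 0 < `|ln t|.
    by rewrite normr_gt0; apply: contraTneq l0 => ->; rewrite normr0 ln0 // ltxx.
  have c1 := continuous_comp (continuous_ln t0) (@norm_continuous _ R (ln t)).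
  exact: (continuous_comp c1 (continuous_ln ln0t)).
have cv : (fun v : R => v / ln `|ln v|) @ t --> t / ln `|ln t|.
  by apply: cvgM; [exact: cvg_id|apply: cvgV => //; rewrite gt_eqF].
move/cvgr_gt : cv => /(_ _ ct) /nbhs_ballP[e /= e0 he].
have m0 : 0 < Num.min e t by rewrite lt_min e0 t0.
have me : Num.min e t <= e by rewrite ge_min lexx.
have mt : Num.min e t <= t by rewrite ge_min lexx orbT.
exists (t - Num.min e t / 2); split; [lra|lra|] => v uv vt.
by apply: he; rewrite /ball /= ger0_norm; lra.
Qed.
End LiminfAtZero.

(** The constant is the supremum of the almost sure lower bounds. The dichotomy at each level stands
    in for measurability of [f]. *)
Lemma ae_constant dO (Om : measurableType dO) (R : realType) (Q : probability Om R)
    (f : Om -> \bar R) (lo up : R) :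
  {ae Q, forall w, (lo%:E <= f w <= up%:E)%E} ->
  (forall c : R, {ae Q, forall w, (c%:E <= f w)%E} \/ {ae Q, forall w, (f w <= c%:E)%E}) ->
  exists2 a : R, lo <= a <= up & {ae Q, forall w, f w = a%:E}.
Proof.
move=> lu dich; pose E := [set c : R | {ae Q, forall w, (c%:E <= f w)%E}].
have Elo : E lo by apply: filterS lu => w /andP[].
have Eup c : E c -> c <= up.
  move=> Ec; have [w [/andP[_ wu] cw]] : exists w, (lo%:E <= f w <= up%:E)%E /\ (c%:E <= f w)%E.
    have [N [mN QN hN]] := filterI lu Ec; apply: contrapT => nex.
    have : Q setT = 0%E.
      apply/eqP; rewrite -measure_le0 -QN le_measure ?inE // => w _; apply: hN => h.
      by apply: nex; exists w.
    by rewrite probability_setT => /eqP; rewrite onee_eq0.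
  by rewrite -lee_fin (le_trans cw wu).
have hE : has_sup E by split; [exists lo|exists up => c /Eup].
exists (sup E); first by rewrite sup_upper_bound //= ge_sup //; exists lo.
have lowE n : {ae Q, forall w, ((sup E - n.+1%:R^-1)%:E <= f w)%E}.
  have [|c Ec hc] := @sup_adherent _ E n.+1%:R^-1 _ hE; first by rewrite invr_gt0.
  by apply: filterS Ec => w; apply: le_trans; rewrite lee_fin ltW.
have upE n : {ae Q, forall w, (f w <= (sup E + n.+1%:R^-1)%:E)%E}.
  have [h|//] := dich (sup E + n.+1%:R^-1).
  have := sup_upper_bound hE h; rewrite gerDl leNgt invr_gt0 ltr0n //.
have {}lowE : {ae Q, forall w n, ((sup E - n.+1%:R^-1)%:E <= f w)%E} by apply: ae_foralln.
have {}upE : {ae Q, forall w n, (f w <= (sup E + n.+1%:R^-1)%:E)%E} by apply: ae_foralln.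
apply: filterS2 lowE upE => w hl hu.
have small e : 0 < e -> exists n, n.+1%:R^-1 < e :> R.
  move=> e0; exists (Num.truncn e^-1); rewrite invf_plt ?posrE ?ltr0n //.
  by apply: truncnS_gt; rewrite -?natr1.
apply/eqP; rewrite eq_le; apply/andP; split; apply/lee_addgt0Pr => e /small[n ne].
  by apply: le_trans (hu n) _; rewrite lee_fin lerD2l ltW.
apply: (@le_trans _ _ ((sup E - n.+1%:R^-1)%:E + n.+1%:R^-1%:E)%E).
  by rewrite -EFinD subrK.
by apply: leeD; [exact: hl|rewrite lee_fin ltW].
Qed.

(** The union over [I] may be uncountable, but it only compares [S] with the infimum of [I]: weakly
    if the infimum is attained, strictly otherwise. *)
Lemma sig_reach (R : realType) T (G : set_system T) (S : T -> \bar R) (I : set R) :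
  sigma_algebra setT G -> (forall r, G [set w | (r%:E < S w)%E]) -> has_lbound I ->
  G [set w | exists2 r, I r & (r%:E <= S w)%E].
Proof.
move=> sG GS lbI; have [I0|I0] := pselect (I !=set0); last first.
  rewrite (_ : [set w | _] = [set _ | False]); first exact: sig_cst.
  by apply/seteqP; split=> w //= -[r Ir _]; apply: I0; exists r.
have hI : has_inf I by [].
have [II|nI] := pselect (I (inf I)).
  rewrite (_ : [set w | _] = [set w | forall n, ((inf I - 2^-1 ^+ n)%:E < S w)%E]).
    by apply: (sig_all sG (F := fun n => [set w | ((inf I - 2^-1 ^+ n)%:E < S w)%E])).
  apply/seteqP; split=> w /=.
    move=> [r Ir rS] n; apply: lt_le_trans rS; rewrite lte_fin.
    have := ge_inf lbI Ir; have : 0 < 2^-1 ^+ n :> R by rewrite exprn_gt0 // invr_gt0.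
    by lra.
  move=> h; exists (inf I) => //; apply/lee_addgt0Pr => e e0.
  have [n /(_ n (leqnn _)) hn] := exists_halfpow_lt e0.
  rewrite -leeBlDr // -EFinB; apply: le_trans (ltW (h n)).
  by rewrite lee_fin; lra.
rewrite (_ : [set w | _] = [set w | ((inf I)%:E < S w)%E]) //.
apply/seteqP; split=> w /=.
  move=> [r Ir]; apply: lt_le_trans; rewrite lte_fin lt_neqAle ge_inf // andbT.
  by apply: contra_not_neq nI => ->.
move=> lS; have [e [e0 he]] : exists e, 0 < e /\ ((inf I + e)%:E <= S w)%E.
  case: (S w) lS => [s| |] //=; last by exists 1; rewrite leey.
  by rewrite lte_fin => ls; exists (s - inf I); rewrite subr_gt0 ls addrC subrK lexx.
have [r Ir hr] := inf_adherent e0 hI; exists r => //.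
by apply: le_trans he; rewrite lee_fin ltW.
Qed.

(** * Blumenthal's law and suprema over dyadic times *)

Section ZeroOne.
Context {R : realType} {dM : measure_display} {M : measurableType dM}
  (d : M -> M -> R)
  {dO : measure_display} {Om : measurableType dO}
  (Ft : R -> set_system Om) (X : R -> Om -> option M)
  (theta : R -> Om -> Om) (P : option M -> probability Om R).
Context (lcs : lcs_borel_metric_space d) (bsp : borel_standard_process d Ft X theta P).

(** By right continuity of the filtration the event lies in [Ft 0]. The Markov property at time 0,
    where the shifted path is the path itself, then gives p <= p * p. *)
Lemma blumenthal_zero_one x (L : set (R -> option M)) : path_event L ->
  (forall s, 0 < s -> Ft s [set w | L (fun u => X u w)]) ->
  P (Some x) [set w | L (fun u => X u w)] = 0%E \/
  P (Some x) [set w | L (fun u => X u w)] = 1%E.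
Proof.
move=> pL FL; set A := [set w | _].
have mA : measurable A := path_event_measurable0 bsp pL.
have FA : Ft 0 A by apply: (filtration_right_continuous bsp).
have F0 : Ft 0 (A `&` [set w | X 0 w = Some x]).
  apply: sigI; [exact: (filtration_sigma bsp)|exact: FA|].
  exact: (filtration_start lcs bsp).
have := @markov_le _ _ _ _ _ _ _ _ _ _ bsp 0 _ L (Some x) [set Some x] (P (Some x) A)
  (lexx 0) F0 pL (measure_ge0 _ _).
rewrite (_ : _ `&` _ `&` _ = A `&` [set w | X 0 w = Some x]); last first.
  apply/seteqP; split=> w /=; first by case.
  by move=> [Aw X0]; split=> //; under eq_fun do rewrite addr0.
rewrite -(start_setI lcs bsp x mA) => /(_ _ _)/wrap[w []//|o ->//|pp].
suff zo (q : \bar R) : (0 <= q -> q <= 1 -> q <= q * q -> q = 0 \/ q = 1)%E.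
  by apply: zo pp; [exact: measure_ge0|exact: probability_le1].
case: q => [q| |] //; rewrite -EFinM !lee_fin => q0 q1 qq.
have [->|qn] := eqVneq q 0; [by left|right; congr EFin].
have q_gt0 : 0 < q by rewrite lt_neqAle eq_sym qn.
by apply/eqP; rewrite eq_le q1 -(ler_pM2l q_gt0) mulr1.
Qed.

Definition dyadic_sup x t (p : R -> option M) : \bar R :=
  ereal_sup [set odist d x (p u) | u in
    [set u | exists m k, [/\ u = dyadic m k, 0 < u & u <= t]]].

Lemma sig_lt_dyadic_sup T (G : set_system T) (Y : R -> T -> option M) x t r :
  sigma_algebra setT G -> (forall u, 0 <= u -> u <= t -> observable G (Y u)) ->
  G [set w | (r%:E < dyadic_sup x t (fun u => Y u w))%E].
Proof.
move=> sG obs.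
rewrite (_ : [set w | _] = [set w | exists m k, (0 < (dyadic m k : R) /\ dyadic m k <= t) /\
   (r%:E < odist d x (Y (dyadic m k) w))%E]).
  apply: sig_ex => // m; apply: sig_ex => // k; apply: sig_if => // -[u0 ut].
  by apply: (sig_lt_odist lcs) => //; apply: obs => //; exact: ltW.
apply/seteqP; split=> w /=.
  by move=> /ereal_sup_gt[_ [_ [m [k [-> u0 ut]]] <-] h]; exists m, k.
move=> [m [k [[u0 ut] h]]]; apply: lt_le_trans h _; apply: ereal_sup_ubound.
by exists (dyadic m k) => //; exists m, k.
Qed.

Lemma dyadic_sup_le x t w : (dyadic_sup x t (fun u => X u w) <= sup_disp d X x w t)%E.
Proof.
apply: le_ereal_sup => _ [u [_ [_ [_ u0 ut]]] <-]; exists u => //.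
by rewrite /= u0 ut.
Qed.

(** The strict inequality leaves room for a grid time just after any u <= s, where right continuity
    preserves the distance. *)
Lemma sup_disp_le_dyadic_sup x s t w : s < t ->
  (sup_disp d X x w s <= dyadic_sup x t (fun u => X u w))%E.
Proof.
move=> st; apply/ereal_supP => _ [u /= /andP[u0 us] <-]; rewrite leNgt.
apply/negP => lt'; case E : (dyadic_sup _ _ _) lt' => [r| |] lt'.
- have [h h0 hh] := path_lt_odist lcs (process_regular bsp w) (ltW u0) lt'.
  have [|m [k [k1 k2]]] := @dyadic_dense R u (Num.min (u + h) t) (ltW u0).
    by rewrite lt_min ltrDl h0 (le_lt_trans us).
  move: k2; rewrite lt_min => /andP[kh kt].
  have := hh _ (ltW k1) kh; rewrite ltNge -E => /negP; apply.
  apply: ereal_sup_ubound; exists (dyadic m k) => //; exists m, k; split=> //.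
    exact: lt_trans k1.
  exact: ltW.
- by move: lt'; rewrite ltNge leey.
- have : (dyadic_sup x t (fun u => X u w) = -oo)%E by [].
  have [m [k [k1 k2]]] := @dyadic_dense R 0 t (lexx 0) (le_lt_trans (le_trans (ltW u0) us) st).
  move=> /eqP; rewrite -leeNy_eq => /(le_trans _) hle.
  have := hle (odist d x (X (dyadic m k) w)); rewrite leeNy_eq.
  have : (odist d x (X (dyadic m k) w) <= dyadic_sup x t (fun u => X u w))%E.
    by apply: ereal_sup_ubound; exists (dyadic m k) => //; exists m, k; split=> //; exact: ltW.
  by move=> h1 /(_ h1); case: (X _ w).
Qed.
End ZeroOne.

(** * The level sets of the lower limit as germ events *)

Section EventuallyAbove.
Context {R : realType} {dM : measure_display} {M : measurableType dM}
  (d : M -> M -> R) (lcs : lcs_borel_metric_space d).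
Context (phi : R -> R) (R0 : R) (x : M).

(* The path is read at dyadic times only, which makes this a path event, while
   it still decides whether the liminf exceeds [c]; [phi] need not be measurable. *)
Definition eventually_above c : set (R -> option M) :=
  [set p | exists n, forall m k, 0 < (dyadic m k : R) -> dyadic m k < 2^-1 ^+ n :> R ->
    exists2 r, 0 < r /\ r < R0 /\ c * (dyadic m k / ln `|ln (dyadic m k)|) <= phi r &
      (r%:E <= dyadic_sup d x (dyadic m k) p)%E].

(** The threshold 2^-n may always be lowered below s, so the path up to any s > 0 decides the
    event. *)
Lemma sig_eventually_above T (G : set_system T) (Y : R -> T -> option M) s c :
  sigma_algebra setT G -> 0 < s -> (forall u, 0 <= u -> u <= s -> observable G (Y u)) ->
  G [set w | eventually_above c (fun u => Y u w)].
Proof.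
move=> sG s0 obs; have [n0 hn0] := exists_halfpow_lt s0.
rewrite (_ : [set w | _] = [set w | exists n, forall m k, (0 < (dyadic m k : R) /\
    dyadic m k < 2^-1 ^+ (n0 + n) :> R) ->
    exists2 r, 0 < r /\ r < R0 /\ c * (dyadic m k / ln `|ln (dyadic m k)|) <= phi r &
      (r%:E <= dyadic_sup d x (dyadic m k) (fun u => Y u w))%E]).
  apply: sig_ex => // n; apply: sig_all => // m; apply: sig_all => // k.
  apply: sig_when => // -[k0 kn]; apply: sig_reach => //; last by exists 0 => r [/ltW].
  move=> r; apply: (sig_lt_dyadic_sup lcs) => // u u0 uk; apply: obs => //.
  apply: le_trans uk (ltW (lt_trans kn _)).
  by apply: hn0; rewrite leq_addr.
apply/seteqP; split=> w /= [n h].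
  exists n => m k [k0 kn]; apply: h => //; apply: lt_le_trans kn _.
  by rewrite ler_wiXn2l ?leq_addl // ?invr_ge0 // invf_le1 // ler1n.
by exists (n0 + n)%N => m k k0 kn; apply: h.
Qed.
End EventuallyAbove.

Lemma expRN_lt {R : realType} (a b e : R) : 0 < a -> 0 < b -> 0 < e ->
  exists2 n : nat, (1 <= n)%N & a * expR (- b * n%:R) < e.
Proof.
move=> a0 b0 e0; pose y := a / (b * e).
have y0 : 0 <= y by rewrite divr_ge0 ?mulr_ge0 // ltW.
exists (Num.truncn y).+1 => //.
have /andP[_ yn] := truncn_itv y0; set n := (Num.truncn y).+1 in yn *.
have bn : 0 < 1 + b * n%:R by rewrite ltr_pwDl // mulr_ge0 // ltW.
rewrite mulNr expRN; apply: (@le_lt_trans _ _ (a / (1 + b * n%:R))).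
  by rewrite ler_pM2l // lef_pV2 ?posrE ?expR_gt0 // expR_ge1Dx.
rewrite ltr_pdivrMr //; move: yn; rewrite /y ltr_pdivrMr ?mulr_gt0 // => yn.
apply: lt_le_trans yn _; rewrite (_ : e * _ = e + n%:R * (b * e)); last by ring.
by rewrite lerDr ltW.
Qed.

(** N + 4 halvings of r go below a quarter of the annulus width r/(2N+1). *)
Lemma annuli_count_le N : ((2 * N).+1 * 4 <= 2 ^ N * 2 ^ 4)%N.
Proof.
have := ltn_expl N (isT : (1 < 2)%N); rewrite -[(2 ^ 4)%N]/16%N.
by move: (2 ^ N)%N => e; lia.
Qed.

(** * Consequences of (A1)-(A4) for mean exit times *)

Section LocalScale.
Context {R : realType} {dM : measure_display} {M : measurableType dM}
  (d : M -> M -> R)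
  {dO : measure_display} {Om : measurableType dO}
  (Ft : R -> set_system Om) (X : R -> Om -> option M)
  (theta : R -> Om -> Om) (P : option M -> probability Om R)
  (Jm : M -> {measure set M -> \bar R}) (kill : M -> \bar R)
  (U : set M) (R0 C0 : R).
Context (lcs : lcs_borel_metric_space d).
Context (bsp : borel_standard_process d Ft X theta P).
Context (levy : levy_system d X P Jm kill).
Context (openU : mopen d U) (R0_gt0 : 0 < R0) (C0_gt0 : 0 < C0).
Context (C1 C2 C3 C4 C5 C6 C7 : R).
Context (C1_gt1 : 1 < C1) (C2_gt0 : 0 < C2) (C3_gt0 : 0 < C3) (C4_gt0 : 0 < C4)
  (C5_gt0 : 0 < C5) (C6_gt0 : 0 < C6) (C7_gt0 : 0 < C7).
Context (condA : forall x r, U x -> small_radius d U R0 C0 x r ->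
    [/\
        (forall y, mball d x r y ->
           ((C1^-1)%:E * Etau d X P y r <= Etau d X P x r)%E /\
           (Etau d X P x r <= C1%:E * Etau d X P y r)%E),
        (Etau d X P x @ 0%R^'+ --> 0%E) /\
          (Etau d X P x r <= C2%:E * Etau d X P x (r / 2))%E,
        (Jm x (~` mball d x r) + kill x <= C3%:E * (Etau d X P x r)^-1)%E &
        (forall n : nat, (1 <= n)%N ->
           ((C4 * expR (- C5 * n%:R))%:E
             <= P (Some x) [set w | n%:R%:E * Etau d X P x r <= exit_time X (mball d x r) w])%E
           /\ (P (Some x) [set w | n%:R%:E * Etau d X P x r <= exit_time X (mball d x r) w]
             <= (C6 * expR (- C7 * n%:R))%:E)%E)]).
Implicit Types (s t u v r e q a c L rho : R) (x y z : M) (w : Om).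

Definition mean_exit y rho : R := fine (Etau d X P y rho).

Lemma exit_time_ge0 (D : set M) w : (0 <= exit_time X D w)%E.
Proof. by apply/ereal_infP => _ [t [t0 _] <-]; rewrite lee_fin ltW. Qed.

Lemma Etau_ge0 y rho : (0 <= Etau d X P y rho)%E.
Proof. by apply: integral_ge0 => w _; exact: exit_time_ge0. Qed.

Lemma Etau_mono y r s : r <= s -> (Etau d X P y r <= Etau d X P y s)%E.
Proof.
move=> rs; apply: ge0_le_integral_nomeas => w _; first exact: exit_time_ge0.
apply: ereal_inf_le_tmp => _ [t [t0 nt] <-]; exists t => //; split=> //.
by move=> [z Xz dz]; apply: nt; exists z => //; exact: lt_le_trans dz rs.
Qed.

Section Admissible.
Context (y : M) (rho : R) (Uy : U y) (sm : small_radius d U R0 C0 y rho).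

(** Both degenerate values contradict (A4). For mean 0 the tail events are the whole space although
    their probability drops below 1; for mean +oo they all coincide although the upper bound at n
    drops below the lower bound at 1. *)
Lemma mean_exitE : Etau d X P y rho = (mean_exit y rho)%:E /\ 0 < mean_exit y rho.
Proof.
have [_ _ _ tail] := condA Uy sm.
have [n n1] : exists2 n : nat, (1 <= n)%N & C6 * expR (- C7 * n%:R) < Num.min 1 (C4 * expR (- C5 * 1)).
  by apply: expRN_lt => //; rewrite lt_min ltr01 mulr_gt0 ?expR_gt0.
rewrite lt_min => /andP[tail1 tail4].
have := Etau_ge0 y rho; rewrite /mean_exit; case E : (Etau d X P y rho) => [a| |] //=.
  rewrite lee_fin le_eqVlt => /predU1P[a0|a0]; last by split.
  exfalso; have [_] := tail n n1; rewrite E -a0 mule0.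
  rewrite (_ : [set w | _] = setT) ?probability_setT; last first.
    by apply/seteqP; split=> w // _; exact: exit_time_ge0.
  by rewrite lee_fin leNgt tail1.
move=> _; exfalso; have [low _] := tail 1%N isT; have [_ up] := tail n n1.
have H k : (1 <= k)%N -> (k%:R%:E * +oo = +oo :> \bar R)%E.
  by move=> k1; rewrite gt0_muley // lte_fin ltr0n.
move: low up; rewrite E !H // => low /(le_trans low).
by rewrite lee_fin leNgt tail4.
Qed.

Lemma exit_tail n : (1 <= n)%N ->
  ((C4 * expR (- C5 * n%:R))%:E <=
    P (Some y) [set w | (n%:R * mean_exit y rho)%:E <= exit_time X (mball d y rho) w])%E /\
  (P (Some y) [set w | (n%:R * mean_exit y rho)%:E <= exit_time X (mball d y rho) w] <=
    (C6 * expR (- C7 * n%:R))%:E)%E.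
Proof.
have [_ _ _ tail] := condA Uy sm; have [E _] := mean_exitE.
by move=> /tail; rewrite E.
Qed.

Lemma escape_mean_exit_le n t : (1 <= n)%N -> t <= n%:R * mean_exit y rho ->
  (P (Some y) [set w | escape d rho t (fun u => X u w)] <=
   (1 - C4 * expR (- C5 * n%:R))%:E)%E.
Proof.
move=> n1 tn; have [rho0 _ _] := sm.
apply: le_trans (escape_le_exit lcs bsp y tn (ltW rho0)) _.
by rewrite EFinB; apply: leeB => //; exact: (exit_tail n1).1.
Qed.

Lemma jump_rate_le : (Jm y (~` mball d y rho) + kill y <= (C3 / mean_exit y rho)%:E)%E.
Proof.
have [_ _ + _] := condA Uy sm; have [-> h0] := mean_exitE.
by rewrite EFinM inver gt_eqF.
Qed.
End Admissible.

Lemma mean_exit_double y rho : U y -> small_radius d U R0 C0 y rho ->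
  small_radius d U R0 C0 y (rho / 2) ->
  mean_exit y rho <= C2 * mean_exit y (rho / 2).
Proof.
move=> Uy sm sm2; have [_ [_ h] _ _] := condA Uy sm.
have [E1 _] := mean_exitE Uy sm; have [E2 _] := mean_exitE Uy sm2.
by move: h; rewrite E1 E2 -EFinM lee_fin.
Qed.

(** One admissible pair is required, because C4 and C5 are tied to a probability only through
    (A4). *)
Lemma exit_lower_le1 n : (exists y rho, U y /\ small_radius d U R0 C0 y rho) ->
  (1 <= n)%N -> C4 * expR (- C5 * n%:R) <= 1.
Proof.
move=> [y [rho [Uy sm]]] n1; rewrite -lee_fin.
apply: le_trans (exit_tail Uy sm n1).1 _; apply: probability_le1.
exact: (exit_time_ge_measurable lcs bsp).
Qed.

(** * Uniform estimates in a neighbourhood of a point *)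

Section AroundPoint.
Context (x : M) (rx : R) (rx0 : 0 < rx).
Context (near_x : forall y rho, d x y <= rx -> 0 < rho -> rho <= rx ->
  U y /\ small_radius d U R0 C0 y rho).
Context (compact_x : sequentially_compact_in d (mball d x rx)).

Lemma mean_exit_gt0 y rho : d x y <= rx -> 0 < rho -> rho <= rx -> 0 < mean_exit y rho.
Proof. by move=> xy r0 rr; have [Uy sm] := near_x xy r0 rr; case: (mean_exitE Uy sm). Qed.

Lemma mean_exit_mono y r s : d x y <= rx -> 0 < r -> r <= s -> s <= rx ->
  mean_exit y r <= mean_exit y s.
Proof.
move=> xy r0 rs srx.
have [Uy sm] := near_x xy r0 (le_trans rs srx).
have [_ sm'] := near_x xy (lt_le_trans r0 rs) srx.
have [E1 _] := mean_exitE Uy sm; have [E2 _] := mean_exitE Uy sm'.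
by rewrite -lee_fin -E1 -E2; exact: Etau_mono.
Qed.

Lemma mean_exit_compare y r : d x y < r -> r <= rx ->
  mean_exit x r <= C1 * mean_exit y r /\ mean_exit y r <= C1 * mean_exit x r.
Proof.
move=> xy rr; have r0 : 0 < r by exact: le_lt_trans (dist_ge0 lcs x y) xy.
have xy' : d x y <= rx by exact: ltW (lt_le_trans xy rr).
have [Ux smx] := @near_x x r ltac:(by rewrite (distxx lcs) ltW) r0 rr.
have [Uy smy] := near_x xy' r0 rr.
have [E1 _] := mean_exitE Ux smx; have [E2 _] := mean_exitE Uy smy.
have [+ _ _ _] := condA Ux smx; move=> /(_ y xy); rewrite E1 E2 -!EFinM !lee_fin.
by case=> h1 h2; split=> //; rewrite -ler_pdivrMl // (lt_trans ltr01 C1_gt1).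
Qed.

Lemma mean_exit_halving y r m : d x y <= rx -> 0 < r -> r <= rx ->
  mean_exit y r <= C2 ^+ m * mean_exit y (r * 2^-1 ^+ m).
Proof.
move=> xy r0 rr.
have pos k : 0 < r * 2^-1 ^+ k :> R by rewrite mulr_gt0 // exprn_gt0.
have le_rx k : r * 2^-1 ^+ k <= rx.
  by apply: le_trans rr; rewrite ger_pMr // exprn_ile1 // ?invr_ge0 // invf_le1 // ler1n.
elim: m => [|m IH]; first by rewrite !expr0 mul1r mulr1.
apply: le_trans IH _; rewrite exprSr -mulrA ler_pM2l ?exprn_gt0 //.
have [Uy sm] := near_x xy (pos m) (le_rx m).
have [_ sm'] := near_x xy (pos m.+1) (le_rx m.+1).
have := mean_exit_double Uy sm; rewrite -mulrA -exprSr; apply; exact: sm'.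
Qed.

Lemma C2_ge1 : 1 <= C2.
Proof.
have xx : d x x <= rx by rewrite (distxx lcs) ltW.
have r2 : rx / 2 <= rx by rewrite ler_pdivrMr // ler_peMr ?ler1n // ltW.
have r20 : 0 < rx / 2 by rewrite divr_gt0.
have h0 := mean_exit_gt0 xx r20 r2.
have [Ux sm] := near_x xx rx0 (lexx _).
have [_ sm'] := near_x xx r20 r2.
have := le_trans (mean_exit_mono xx r20 r2 (lexx _)) (mean_exit_double Ux sm sm').
by rewrite -{1}[mean_exit x (rx / 2)]mul1r ler_pM2r.
Qed.

(** The centre is changed at the large radius r, where (A1) applies, and the radius is then halved
    at z. *)
Lemma mean_exit_lower r m z s : 0 < r -> r <= rx -> d x z < r ->
  r * 2^-1 ^+ m <= s -> s <= rx ->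
  mean_exit x r <= C1 * C2 ^+ m * mean_exit z s.
Proof.
move=> r0 rr xz ms sr; have xz' : d x z <= rx by exact: ltW (lt_le_trans xz rr).
have [h1 _] := mean_exit_compare xz rr; apply: le_trans h1 _.
rewrite -mulrA ler_pM2l ?(lt_trans ltr01 C1_gt1) //.
apply: le_trans (mean_exit_halving m xz' r0 rr) _.
rewrite ler_pM2l ?exprn_gt0 //; apply: mean_exit_mono => //.
by rewrite mulr_gt0 // exprn_gt0.
Qed.

Lemma exits_before_bound r N t : 0 < r -> r <= rx -> 0 < t ->
  (P (Some x) (exits_before d X x r t) <=
   ((1 - C4 * expR (- C5 * 1)) ^+ N +
    (C3 + 1) * (C1 * C2 ^+ (N + 4)) / mean_exit x r * t)%:E)%E.
Proof.
move=> r0 rr t0; have C1_gt0 := lt_trans ltr01 C1_gt1.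
have xx : d x x <= rx by rewrite (distxx lcs) ltW.
have hx0 := mean_exit_gt0 xx r0 rr.
have witness : exists y rho, U y /\ small_radius d U R0 C0 y rho.
  by exists x, rx; apply: near_x.
set q := 1 - _; have q0 : 0 <= q by rewrite subr_ge0; exact: (@exit_lower_le1 1%N).
set B := C1 * C2 ^+ (N + 4); have B0 : 0 < B by rewrite mulr_gt0 // exprn_gt0.
(* For large t the right-hand side is at least 1; the factor C3 + 1 instead of C3 ensures this. For
   small t, the time is at most one mean exit time of each ball of radius L/4, so n = 1 in the lower
   tail gives q. *)
have [t_large|t_small] := ltP (mean_exit x r) (B * t).
  apply: le_trans (probability_le1 _ _) _; first exact: (measurable_exits_before lcs bsp).
  rewrite lee_fin; apply: ler_wpDl; first exact: exprn_ge0.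
  apply: (@le_trans _ _ (B / mean_exit x r * t)).
    by rewrite mulrAC ler_pdivlMr // mul1r ltW.
  rewrite ler_pM2r // ler_pM2r ?invr_gt0 //; rewrite ler_peMl //; first exact: ltW.
  by rewrite lerDr ltW.
pose K := (2 * N).+1; pose L := r / K%:R.
have K0 : (0 : R) < K%:R by rewrite ltr0n.
have K1 : (1 : R) <= K%:R by rewrite ler1n.
have L0 : 0 < L by rewrite divr_gt0.
have KL : K%:R * L = r by rewrite mulrC divfK // gt_eqF.
have Lr : L <= r by rewrite ler_pdivrMr // ler_peMr // ltW.
have L40 : 0 < L / 4 by rewrite divr_gt0.
have L4L : L / 4 <= L by rewrite ler_pdivrMr // ler_peMr ?ler1n // ltW.
have pow_bound : r * 2^-1 ^+ (N + 4) <= L / 4.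
  rewrite /L -mulrA ler_pM2l // exprVn -invfM lef_pV2 ?posrE ?exprn_gt0 ?mulr_gt0 //.
  rewrite exprD -natrX -[2 ^+ 4]natrX -[4]/(4%:R) -!natrM ler_nat.
  exact: annuli_count_le.
have lowL z : d x z < r -> mean_exit x r <= B * mean_exit z (L / 4).
  move=> xz; apply: mean_exit_lower => //.
  exact: le_trans L4L (le_trans Lr rr).
have near_z z : d x z < r -> d x z <= rx by move=> xz; exact: ltW (lt_le_trans xz rr).
rewrite -KL; apply: (exits_before_le lcs bsp levy (r := L / 4)) => //.
- by rewrite -mulrDl -[4]/((2 * 2)%:R) natrM; lra.
- by rewrite KL ltW // divr_gt0 // mulr_gt0 // addr_gt0.
- rewrite KL => z xz; have Lrx := le_trans Lr rr.
  have [Uz sm] := near_x (near_z z xz) L0 Lrx.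
  apply: le_trans (jump_rate_le Uz sm) _; rewrite lee_fin.
  have hz0 := mean_exit_gt0 (near_z z xz) L0 Lrx.
  rewrite ler_pdivrMr // mulrAC ler_pdivlMr //.
  apply: (@le_trans _ _ (C3 * (B * mean_exit z L))).
    rewrite ler_pM2l //; apply: le_trans (lowL z xz) _; rewrite ler_pM2l //.
    by apply: mean_exit_mono => //; exact: near_z.
  rewrite mulrA ler_pM2r // ler_pM2r // lerDl; exact: ler01.
- rewrite KL => z xz; have L4rx := le_trans L4L (le_trans Lr rr).
  have [Uz sm] := near_x (near_z z xz) L40 L4rx.
  apply: (escape_mean_exit_le Uz sm (n := 1%N)) => //.
  rewrite mul1r -(ler_pM2l B0); exact: le_trans t_small (lowL z xz).
(* At a tiny radius s the time t spans many mean exit times, but at most n uniformly in z; the lower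
   tail at n still keeps the escape probability below 1. *)
- rewrite KL => e e0; pose s := Num.min (e / 4) rx.
  have s0 : 0 < s by rewrite lt_min divr_gt0.
  have srx : s <= rx by rewrite ge_min lexx orbT.
  have se : s <= e / 4 by rewrite ge_min lexx.
  have [|m hm] := @exists_halfpow_lt R (s / r); first by rewrite divr_gt0.
  have ms : r * 2^-1 ^+ m <= s.
    by have := hm m (leqnn m); rewrite ltr_pdivlMr // mulrC; exact: ltW.
  pose n := (Num.truncn (C1 * C2 ^+ m * t / mean_exit x r)).+1.
  have n_ge : C1 * C2 ^+ m * t / mean_exit x r <= n%:R.
    have y0 : 0 <= C1 * C2 ^+ m * t / mean_exit x r.
      by apply/ltW; rewrite divr_gt0 // !mulr_gt0 // exprn_gt0.
    by have /andP[_ /ltW] := truncn_itv y0.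
  exists s, (1 - C4 * expR (- C5 * n%:R)); split.
  + by lra.
  + by rewrite subr_ge0; exact: exit_lower_le1.
  + by rewrite gtrBl mulr_gt0 // expR_gt0.
  move=> z xz; have [Uz sm] := near_x (near_z z xz) s0 srx.
  apply: (escape_mean_exit_le Uz sm) => //.
  have := mean_exit_lower r0 rr xz ms srx.
  move: n_ge; rewrite ler_pdivrMr // => n_ge low.
  have Cm0 : 0 < C1 * C2 ^+ m by rewrite mulr_gt0 // exprn_gt0.
  rewrite -(ler_pM2l Cm0); apply: le_trans n_ge _.
  by rewrite mulrCA ler_pM2l // ltr0n.
- by rewrite KL => u hu; apply: compact_x => n; exact: lt_le_trans (hu n) rr.
Qed.
End AroundPoint.

Lemma good_neighbourhood x : U x -> exists2 rx, 0 < rx & [/\ rx < R0,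
  forall y rho, d x y <= rx -> 0 < rho -> rho <= rx -> U y /\ small_radius d U R0 C0 y rho &
  sequentially_compact_in d (mball d x rx)].
Proof.
move=> Ux; have [e e0 eU] := openU Ux.
have [r r0 cr] : exists2 r, 0 < r & mcompact d (cball d x r) by case: lcs => _ + _ _; exact.
(* Points within e/2 of x stay at distance at least e/2 from the complement of [U], whence the bound
   C0 (e/2) on radii. The final radius m/2 makes the inequalities strict. *)
pose m := Num.min (Num.min (e / 2) R0) (Num.min (C0 * (e / 2)) r).
have m0 : 0 < m by rewrite !lt_min divr_gt0 // R0_gt0 r0 mulr_gt0 // divr_gt0.
have [me mR mC mr] : [/\ m <= e / 2, m <= R0, m <= C0 * (e / 2) & m <= r].
  by split; rewrite !ge_min lexx ?orbT.
exists (m / 2); first by rewrite divr_gt0.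
split.
- by lra.
- move=> y rho xy rho0 rhom; split; first by apply: eU; rewrite /mball /=; lra.
  split=> //; first by lra.
  apply: (@lt_le_trans _ _ (C0%:E * (e / 2)%:E)%E).
    by rewrite -EFinM lte_fin; lra.
  apply: lee_wpmul2l; first by rewrite lee_fin ltW.
  apply/ereal_infP => _ [z nUz <-]; rewrite lee_fin leNgt; apply/negP => yz.
  by apply: nUz; apply: eU; rewrite /mball /=; have := dist_triangle lcs y x z; lra.
- move=> u hu; have [n|l _ h] := cr u; last by exists l.
  by have := hu n; rewrite /mball /cball /=; lra.
Qed.
Section RadiusChoice.
Context (x : M) (rx : R) (rx0 : 0 < rx) (rxR0 : rx < R0).
Context (near_x : forall y rho, d x y <= rx -> 0 < rho -> rho <= rx ->
  U y /\ small_radius d U R0 C0 y rho).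
Context (compact_x : sequentially_compact_in d (mball d x rx)).

Let xx : d x x <= rx. Proof. by rewrite (distxx lcs) ltW. Qed.
Let Ux : U x. Proof. by have [] := near_x xx rx0 (lexx _). Qed.

Lemma mean_exit_small e : 0 < e -> exists m, mean_exit x (rx * 2^-1 ^+ m) < e.
Proof.
move=> e0; have [_ sm] := near_x xx rx0 (lexx _).
have [_ [cvg0 _] _ _] := condA Ux sm.
have : nbhs (0%E : \bar R) [set y | (y < e%:E)%E].
  by apply: open_nbhs_nbhs; split; [exact: open_ereal_lt_ereal|rewrite /= lte_fin].
move=> /cvg0 /at_rightP[h h0 hh].
have [|m hm] := @exists_halfpow_lt R (h / rx); first by rewrite divr_gt0.
have pos : 0 < rx * 2^-1 ^+ m by rewrite mulr_gt0 // exprn_gt0.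
have le_rx : rx * 2^-1 ^+ m <= rx.
  by rewrite ger_pMr // exprn_ile1 // ?invr_ge0 // invf_le1 // ler1n.
exists m; have [_ smm] := near_x xx pos le_rx.
have [E _] := mean_exitE Ux smm; rewrite -lte_fin -E.
apply: hh => //; rewrite add0r.
by have := hm m (leqnn m); rewrite ltr_pdivlMr // mulrC.
Qed.

(** The mean exit time need not be continuous in the radius, so a prescribed value is met only up to
    C2: the first halving that drops to e or below is taken, and doubling bounds the drop. *)
Lemma radius_for e : 0 < e -> e < mean_exit x rx -> exists r,
  [/\ 0 < r, r <= rx, e / C2 <= mean_exit x r & mean_exit x r <= e].
Proof.
move=> e0 e_lt.
pose Q m := mean_exit x (rx * 2^-1 ^+ m) <= e.
have exQ : exists m, Q m by have [m /ltW] := mean_exit_small e0; exists m.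
case: (ex_minnP exQ) => -[|m] Qm minm.
  by move: Qm; rewrite /Q expr0 mulr1 leNgt e_lt.
have pos k : 0 < rx * 2^-1 ^+ k by rewrite mulr_gt0 // exprn_gt0.
have le_rx k : rx * 2^-1 ^+ k <= rx.
  by rewrite ger_pMr // exprn_ile1 // ?invr_ge0 // invf_le1 // ler1n.
exists (rx * 2^-1 ^+ m.+1); split=> //.
have [_ sm] := near_x xx (pos m) (le_rx m).
have [_ sm'] := near_x xx (pos m.+1) (le_rx m.+1).
have h := mean_exit_double Ux sm; rewrite -mulrA -exprSr in h.
rewrite ler_pdivrMr // mulrC; apply: le_trans (h sm'); rewrite leNgt.
by apply/negP => /ltW /minm; rewrite ltnn.
Qed.

Lemma sup_disp_ge w r t : (exit_time X (mball d x r) w < t%:E)%E ->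
  (r%:E <= sup_disp d X x w t)%E.
Proof.
move=> /exit_time_ltP[s [s0 st rs]]; apply: le_ereal_sup_tmp.
by exists (odist d x (X s w)) => //; exists s => //=; rewrite s0 ltW.
Qed.

Lemma sup_disp_small w e : X 0 w = Some x -> 0 < e -> exists2 t0, 0 < t0 &
  forall t, t < t0 -> (sup_disp d X x w t <= e%:E)%E.
Proof.
move=> X0 e0; have [h h0 hh] := path_near lcs (process_regular bsp w) (lexx 0) X0 e0.
exists h => // t th; apply/ereal_supP => _ [s /= /andP[s0 st] <-].
have [||z -> dz] := hh s; [exact: ltW| |by rewrite lee_fin ltW].
by rewrite add0r; exact: le_lt_trans st th.
Qed.
End RadiusChoice.

(** * Almost sure bounds for the lower limit *)

Section LiminfBounds.
Context (x : M) (rx : R) (rx0 : 0 < rx) (rxR0 : rx < R0).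
Context (near_x : forall y rho, d x y <= rx -> 0 < rho -> rho <= rx ->
  U y /\ small_radius d U R0 C0 y rho).
Context (compact_x : sequentially_compact_in d (mball d x rx)).
Context (phi : M -> R -> R) (C : R) (C_ge1 : 1 <= C).
Context (phi_mono : forall x r s, U x -> (0 < r)%R -> (r <= s)%R -> (s < R0)%R ->
         (phi x r <= phi x s)%R).
Context (phi_bounds : forall x r, U x -> small_radius d U R0 C0 x r ->
          ((C^-1)%:E * Etau d X P x r <= (phi x r)%:E)%E /\
          ((phi x r)%:E <= C%:E * Etau d X P x r)%E).

Let xx : d x x <= rx. Proof. by rewrite (distxx lcs) ltW. Qed.
Let Ux : U x. Proof. by have [] := near_x xx rx0 (lexx _). Qed.
Let C_gt0 : 0 < C. Proof. exact: lt_le_trans ltr01 C_ge1. Qed.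
Let C2ge1 : 1 <= C2. Proof. exact: (C2_ge1 rx0 near_x). Qed.
Let witness : exists y rho, U y /\ small_radius d U R0 C0 y rho.
Proof. by exists x, rx; apply: near_x. Qed.

Lemma phi_mean_exit r : 0 < r -> r <= rx ->
  C^-1 * mean_exit x r <= phi x r /\ phi x r <= C * mean_exit x r.
Proof.
move=> r0 rr; have [_ sm] := near_x xx r0 rr; have [E _] := mean_exitE Ux sm.
by have := phi_bounds Ux sm; rewrite E -!EFinM !lee_fin.
Qed.

Definition lil_ratio w t : R := phi x (fine (sup_disp d X x w t)) / (t / ln `|ln t|).

(** C comes from admissibility, C2 from [radius_for], e from the ratio of consecutive scales, and
    the last factor from [lower_scale] at c = C7/2. *)
Definition lil_lower : R := (C * C2)^-1 / (expR 1 * (2 / (C7 / 2) + 4)).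

Lemma lil_lower_gt0 : 0 < lil_lower.
Proof. by rewrite divr_gt0 ?invr_gt0 ?mulr_gt0 ?expR_gt0 ?addr_gt0 ?divr_gt0. Qed.

Lemma start_ae : {ae P (Some x), forall w, X 0 w = Some x}.
Proof.
exists (~` [set w | X 0 w = Some x]); split => //.
  by apply: measurableC; exact: (measurable_start lcs bsp).
rewrite probability_setC; last exact: (measurable_start lcs bsp).
by rewrite (start_at bsp) subee.
Qed.

(** The first conjunct keeps the displacement finite and in (0, rx], the range in which monotonicity
    of [phi] may be used; later arguments rely on it. *)
Lemma eventually_lower : {ae P (Some x), forall w, exists2 t0, 0 < t0 &
  forall t, 0 < t -> t < t0 -> (exists s, [/\ sup_disp d X x w t = s%:E, 0 < s & s <= rx]) /\
    lil_lower <= lil_ratio w t}.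
Proof.
have hx0 : 0 < mean_exit x rx by apply: (mean_exit_gt0 near_x).
have [k0 _ hk0] := @expRN_lt R 1 1 _ ltr01 ltr01 hx0.
have /choice[r hr] : forall k : nat, exists r, (k0 <= k)%N ->
    [/\ 0 < r, r <= rx, expR (- k%:R) / C2 <= mean_exit x r & mean_exit x r <= expR (- k%:R)].
  move=> k; have [kk|_] := leqP k0 k; last by exists 0.
  have [||r hr] := radius_for rx0 near_x (e := expR (- k%:R)); last by exists r.
    exact: expR_gt0.
  apply: le_lt_trans hk0; rewrite mul1r mulN1r ler_expR lerN2 ler_nat //.
(* Half of C7 turns the upper tail of (A4) into C6 (k+1)^(-2). *)
pose c := C7 / 2; have c0 : 0 < c by rewrite divr_gt0.
pose n k := log_count c k.
pose A k : set Om := [set w | (k0 <= k)%N /\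
   ((n k)%:R * mean_exit x (r k))%:E <= exit_time X (mball d x (r k)) w]%E.
have mA k : measurable (A k).
  apply: sig_if => [|_]; first exact: sigma_algebra_measurable.
  exact: (exit_time_ge_measurable lcs bsp).
have PA k : (P (Some x) (A k) <= (C6 * k.+1%:R ^- 2)%:E)%E.
  have [kk|kk] := leqP k0 k; last first.
    rewrite (_ : A k = set0) ?measure0 ?lee_fin ?mulr_ge0 ?invr_ge0 ?exprn_ge0 //; first exact: ltW.
    by apply/seteqP; split=> w //= -[]; rewrite leqNgt kk.
  have [r0 rr _ _] := hr k kk; have [_ sm] := near_x xx r0 rr.
  apply: (@le_trans _ _ (C6 * expR (- C7 * (n k)%:R))%:E).
    apply: le_trans (exit_tail Ux sm (n := n k) isT).2.
    by apply: le_measure; rewrite ?inE //; [exact: (exit_time_ge_measurable lcs bsp)|move=> w []].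
  rewrite lee_fin ler_pM2l //.
  have k1 : (0 : R) < k.+1%:R by rewrite ltr0n.
  rewrite -[X in _ <= X ^-1]lnK ?posrE ?exprn_gt0 // -expRN ler_expR lnXn //.
  by rewrite mulNr lerN2 mulr2n; have := log_count_ge k c0; rewrite -/(n k) /c; lra.
have bc := @borel_cantelli _ _ _ (P (Some x)) A (fun k => C6 * k.+1%:R ^- 2) (C6 * 2)
  mA _ PA _.
have {}bc : {ae P (Some x), forall w, exists K, forall k, (K <= k)%N -> ~ A k w}.
  apply: bc => [k|m]; first by rewrite mulr_ge0 ?invr_ge0 ?exprn_ge0 // ltW.
  by rewrite -mulr_sumr ler_pM2l // sum_inv_sq_le.
apply: filterS2 start_ae bc => w X0 [K hK].
have [h h0 hsmall] := sup_disp_small X0 rx0.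
have [J hJ] := lower_scale c0.
pose K1 := maxn (maxn K k0) J.
have [KK1 k0K1 JK1] : [/\ (K <= K1)%N, (k0 <= K1)%N & (J <= K1)%N].
  by rewrite !leq_max !leqnn ?orbT.
pose tm k : R := (n k)%:R * expR (- k%:R).
have tm0 k : 0 < tm k by rewrite mulr_gt0 ?expR_gt0 // ltr0n.
exists (Num.min h (tm K1)); first by rewrite lt_min h0 tm0.
move=> t t0; rewrite lt_min => /andP[th ttm].
have tm_exp k : (J <= k)%N -> tm k <= expR (- (k%:R / 2)).
  by move=> Jk; have [] := hJ k Jk (tm k) (tm0 k) (lexx _).
have exk : exists k, (K1 <= k)%N && (tm k <= t).
  have [m _ hm] := @expRN_lt R 1 2^-1 t ltr01 ltac:(by rewrite invr_gt0) t0.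
  exists (maxn K1 m); rewrite leq_maxl /=; apply: le_trans (tm_exp _ _) _.
    by rewrite (leq_trans JK1) // leq_maxl.
  apply: le_trans (ltW hm); rewrite mul1r mulNr ler_expR lerN2 mulrC ler_pM2r ?invr_gt0 //.
  by rewrite ler_nat leq_maxr.
(* Minimality places t between [tm j.+1] and [tm j], without monotonicity of [tm]. *)
case: (ex_minnP exk) => -[|j] /andP[K1k tk] mink.
  by move: K1k tk; rewrite leqn0 => /eqP <-; rewrite leNgt ttm.
have K1j : (K1 <= j)%N.
  move: K1k; rewrite leq_eqVlt => /predU1P[E|//].
  by move: tk; rewrite -E leNgt ttm.
have tj : t < tm j.
  rewrite ltNge; apply/negP => tmt.
  by have := mink j; rewrite K1j tmt ltnn => /(_ isT).
have k0j : (k0 <= j.+1)%N by rewrite (leq_trans k0K1) // ltnW.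
have [r0 rr hlow hup] := hr j.+1 k0j.
have exit_lt : (exit_time X (mball d x (r j.+1)) w < t%:E)%E.
  rewrite ltNge; apply/negP => te; apply: (hK j.+1).
    by rewrite (leq_trans KK1) // ltnW.
  split=> //; apply: le_trans te; rewrite lee_fin; apply: le_trans tk.
  by rewrite ler_pM2l // ltr0n.
have := hsmall t th; have := sup_disp_ge exit_lt.
rewrite /lil_ratio; case: (sup_disp d X x w t) => [s| |] //; rewrite !lee_fin => rs srx.
split; first by exists s; split=> //; exact: lt_le_trans r0 rs.
have [_ hn] := hJ j (leq_trans JK1 K1j) t t0 (ltW tj).
set u := ln _ in hn *; set al := 2 / c + 4 in hn.
have al0 : 0 < al by rewrite addr_gt0 // divr_gt0.
have n1 : (1 : R) <= (log_count c j)%:R by rewrite ler1n.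
have u0 : 0 < u by rewrite -(pmulr_rgt0 _ al0); lra.
rewrite invf_div mulrA ler_pdivlMr //=.
have phi_low : C^-1 * (expR (- j.+1%:R) / C2) <= phi x s.
  have [h1 _] := phi_mean_exit r0 rr.
  apply: (@le_trans _ _ (phi x (r j.+1))); last first.
    by apply: phi_mono => //; exact: le_lt_trans srx rxR0.
  by apply: le_trans h1; rewrite ler_pM2l ?invr_gt0.
have tu : t <= al * u * (expR 1 * expR (- j.+1%:R)).
  apply: (le_trans (ltW tj)); rewrite /tm -expRD.
  have -> : 1 + - j.+1%:R = - j%:R :> R by rewrite -natr1; ring.
  by rewrite ler_pM2r ?expR_gt0.
apply: (@le_trans _ _ (lil_lower * (al * u * (expR 1 * expR (- j.+1%:R))))).
  by rewrite ler_pM2l ?lil_lower_gt0.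
apply: (@le_trans _ _ (C^-1 * (expR (- j.+1%:R) / C2) * u)); last by rewrite ler_pM2r.
rewrite le_eqVlt; apply/orP; left; apply/eqP.
rewrite /lil_lower -/c -/al; have := expR_gt0 (1 : R); move: (expR 1) (expR (- _)) => E F E0.
by field; rewrite !gt_eqF.
Qed.

(** The loss from [scale k] to the mean exit time of B(y, r_k/2) for y near x: C2 for the choice of
    radius, C1 for the change of centre, C2 for halving the radius. *)
Definition time_factor : R := (C1 * C2 ^+ 2)^-1.
(** The 6 is 3 from [upper_scale] times 2 for evaluating at half of [time k]. *)
Definition lil_upper : R := 6 * C * C5 / time_factor.

Lemma time_factor_gt0 : 0 < time_factor.
Proof. by rewrite invr_gt0 mulr_gt0 ?exprn_gt0 // (lt_trans ltr01 C1_gt1). Qed.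

(** * Superexponential scales for the upper bound *)

Section Scales.
Context (B : R) (BE : B = ln C2 + 1).
Let B_ge1 : 1 <= B. Proof. by rewrite BE lerDr ln_ge0. Qed.

Definition scale k : R := expR (- (B * k%:R ^+ 2)).
Definition time k : R := time_factor * (log_count C5 k)%:R * scale k.

Lemma time_gt0 k : 0 < time k.
Proof. by rewrite !mulr_gt0 ?time_factor_gt0 ?expR_gt0 // ltr0n. Qed.

Context (k0 : nat) (r : nat -> R) (r_scale : forall k, (k0 <= k)%N ->
  [/\ 0 < r k, r k <= rx, scale k / C2 <= mean_exit x (r k) & mean_exit x (r k) <= scale k]).
Context (time_lt : forall k, (k0 <= k)%N -> time k.+1 < time k).

(* Leaving the k-th ball before time about t_{k+1} is summably unlikely, as the
   scales decrease superexponentially, while escaping it during [t_{k+1}, t_k]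
   is avoided with probability at least a harmonic term, given the past. *)
Definition early_exit k : set Om :=
  [set w | (k0 <= k)%N /\ exits_before d X x (r k / 2) (2 * time k.+1) w].

(** [exits_before_bound] is used with N = k: the chains contribute q^k, and in the jump term
    [upper_tail_bound] with A = C2 leaves a multiple of e^(-k). *)
Lemma early_exit_le : exists (b : nat -> R) S, [/\ forall k, 0 <= b k,
  forall k, (P (Some x) (early_exit k) <= (b k)%:E)%E &
  forall n, \sum_(0 <= k < n) b k <= S].
Proof.
pose q := 1 - C4 * expR (- C5 * 1).
have q0 : 0 <= q by rewrite subr_ge0; exact: (@exit_lower_le1 1%N).
have q1 : q < 1 by rewrite gtrBl mulr_gt0 // expR_gt0.
have C1_gt0 := lt_trans ltr01 C1_gt1.
pose D := (C3 + 1) * (C1 * C2 ^+ 4) * C2 ^+ 2 * 2 * time_factor * (C5^-1 + 1).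
have D0 : 0 < D.
  by rewrite !mulr_gt0 ?exprn_gt0 ?time_factor_gt0 ?addr_gt0 ?invr_gt0.
have e0 : 0 <= expR (- 1) :> R by exact: expR_ge0.
have e1 : expR (- 1) < 1 :> R by rewrite expR_lt1 ltrN10.
exists (fun k => q ^+ k + D * expR (- 1) ^+ k), ((1 - q)^-1 + D * (1 - expR (- 1))^-1).
split.
- by move=> k; rewrite addr_ge0 ?exprn_ge0 // mulr_ge0 ?exprn_ge0 // ltW.
- move=> k; have [kk|kk] := leqP k0 k; last first.
    rewrite (_ : early_exit k = set0) ?measure0 ?lee_fin.
      by rewrite addr_ge0 ?exprn_ge0 // mulr_ge0 ?exprn_ge0 // ltW.
    by apply/seteqP; split=> w //= -[]; rewrite leqNgt kk.
  have [r0 rr hlow _] := r_scale kk.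
  have r20 : 0 < r k / 2 by rewrite divr_gt0.
  have r2r : r k / 2 <= rx by apply: le_trans rr; rewrite ler_pdivrMr // ler_peMr ?ler1n // ltW.
  have t0 : 0 < 2 * time k.+1 by rewrite mulr_gt0 ?time_gt0.
  apply: (@le_trans _ _ (P (Some x) (exits_before d X x (r k / 2) (2 * time k.+1)))).
    apply: le_measure; rewrite ?inE //; last by move=> w [].
      apply: sig_if => [|_]; first exact: sigma_algebra_measurable.
      exact: (measurable_exits_before lcs bsp).
    exact: (measurable_exits_before lcs bsp).
  apply: le_trans (exits_before_bound rx0 near_x compact_x k r20 r2r t0) _.
  rewrite lee_fin lerD2l.
  have sk0 : 0 < scale k by exact: expR_gt0.
  have h2 : scale k / C2 ^+ 2 <= mean_exit x (r k / 2).
    have [_ sm] := near_x xx r0 rr; have [_ sm2] := near_x xx r20 r2r.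
    have := le_trans hlow (mean_exit_double Ux sm sm2).
    rewrite ler_pdivrMr // ler_pdivrMr ?exprn_gt0 // => h; apply: le_trans h _.
    by rewrite le_eqVlt; apply/orP; left; apply/eqP; ring.
  have h20 : 0 < scale k / C2 ^+ 2 by rewrite divr_gt0 ?exprn_gt0.
  apply: (@le_trans _ _ ((C3 + 1) * (C1 * C2 ^+ (k + 4)) / (scale k / C2 ^+ 2) * (2 * time k.+1))).
    rewrite ler_pM2r // ler_pM2l; first by rewrite lef_pV2 ?posrE // (lt_le_trans h20).
    by rewrite !mulr_gt0 ?exprn_gt0 ?addr_gt0.
  have := upper_tail_bound k C5_gt0 C2ge1 BE; rewrite -/(scale k) -/(scale k.+1).
  set T := C2 ^+ k * _ => hT.
  have -> : (C3 + 1) * (C1 * C2 ^+ (k + 4)) / (scale k / C2 ^+ 2) * (2 * time k.+1) =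
     (C3 + 1) * (C1 * C2 ^+ 4) * C2 ^+ 2 * 2 * time_factor / scale k * T.
    by rewrite /T /time exprD; field; rewrite !gt_eqF.
  have F0 : 0 < (C3 + 1) * (C1 * C2 ^+ 4) * C2 ^+ 2 * 2 * time_factor / scale k.
    by rewrite !mulr_gt0 ?exprn_gt0 ?time_factor_gt0 ?addr_gt0 ?invr_gt0.
  move: hT; rewrite -(ler_pM2l F0) => /le_trans; apply.
  rewrite le_eqVlt; apply/orP; left; apply/eqP.
  by rewrite /D; field; rewrite !gt_eqF.
move=> n; rewrite big_split /= -mulr_sumr; apply: lerD; first exact: sum_geometric_le.
by rewrite ler_pM2l //; exact: sum_geometric_le.
Qed.

(** The position at [time k.+1] is required to be close to x, so that the Markov bound is uniform
    over starting points; the other positions belong to [early_exit]. *)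
Definition late_escape k : set Om :=
  [set w | (odist d x (X (time k.+1) w) <= (r k / 2)%:E)%E] `&`
  [set w | escape d (r k / 2) (time k - time k.+1) (fun u => X (u + time k.+1) w)].

Lemma sig_late_escape k : (k0 <= k)%N -> Ft (time k) (late_escape k).
Proof.
move=> kk; have sF := filtration_sigma bsp (time k).
have t0 := ltW (time_gt0 k.+1).
apply: sigI => //.
  by apply: (sig_le_odist lcs) => //; apply: (process_observable bsp) => //; exact/ltW/time_lt.
apply: sig_ex => // m; apply: sig_ex => // j; apply: sig_if => // jt.
apply: (sig_far lcs) => //; apply: (process_observable bsp).
- by rewrite add0r.
- by rewrite add0r; exact/ltW/time_lt.
- by rewrite addr_ge0 // dyadic_ge0.
- by rewrite -lerBrDr ltW.
Qed.

Lemma late_escape_le k A : (k0 <= k)%N -> Ft (time k.+1) A ->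
  (P (Some x) (late_escape k `&` A) <=
   (1 - C4 * expR (- C5) / k.+1%:R)%:E * P (Some x) A)%E.
Proof.
move=> kk FA; have [r0 rr hlow _] := r_scale kk.
have r20 : 0 < r k / 2 by rewrite divr_gt0.
have r2r : r k / 2 < r k by rewrite ltr_pdivrMr // ltr_pMr ?ltr1n.
have C1_gt0 := lt_trans ltr01 C1_gt1.
have t0 := ltW (time_gt0 k.+1).
have sF := filtration_sigma bsp (time k.+1).
pose A' := [set w | A w /\ (odist d x (X (time k.+1) w) <= (r k / 2)%:E)%E].
have FA' : Ft (time k.+1) A'.
  apply: sigI => //; apply: (sig_le_odist lcs) => //; exact: (process_observable bsp).
set q := 1 - _.
have q0 : 0 <= q.
  rewrite subr_ge0 ler_pdivrMr ?ltr0n // mul1r.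
  apply: (@le_trans _ _ 1); last by rewrite ler1n.
  by have := @exit_lower_le1 1%N witness isT; rewrite mulr1.
apply: (@le_trans _ _ (q%:E * P (Some x) A')%E); last first.
  apply: lee_wpmul2l; first by rewrite lee_fin.
  apply: le_measure; rewrite ?inE; [exact: (filtration_measurable bsp FA')|
    exact: (filtration_measurable bsp FA)|by move=> w []].
rewrite (_ : late_escape k `&` A = A' `&` [set w | escape d (r k / 2)
    (time k - time k.+1) (fun u => X (u + time k.+1) w)]); last first.
  by apply/seteqP; split=> w; [move=> [[? ?] ?]|move=> [[? ?] ?]].
apply: (@markov_le _ _ _ _ _ _ _ _ _ _ bsp _ _ _ _
    [set o | exists2 y, o = Some y & d x y <= r k / 2]) => //.
- exact: (path_event_escape lcs).
- by move=> w [_]; case: (X (time k.+1) w) => [y|] //=; rewrite lee_fin => h; exists y.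
move=> _ [y -> xy].
have xyr : d x y < r k by exact: le_lt_trans xy r2r.
have xyrx : d x y <= rx by exact: ltW (lt_le_trans xyr rr).
have [Uy sm] := near_x xyrx r20 (ltW (lt_le_trans r2r rr)).
(* The whole of [time k] spans at most n = [log_count C5 k] mean exit times at y. As C5 n <= ln
   (k+1) + C5, the lower tail is at least C4 e^(-C5)/(k+1). *)
apply: le_trans (escape_mean_exit_le Uy sm (n := log_count C5 k) isT _) _; last first.
  rewrite lee_fin lerD2l lerN2 -mulrA ler_pM2l //.
  have k1 : (0 : R) < k.+1%:R by rewrite ltr0n.
  rewrite -[X in _ / X]lnK ?posrE // -expRN -expRD ler_expR.
  have := log_count_le k C5_gt0; rewrite -(ler_pM2l C5_gt0) mulrDr mulr1 mulrCA divff ?gt_eqF //.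
  by rewrite mulr1; lra.
have n0 : (0 : R) < (log_count C5 k)%:R by rewrite ltr0n.
apply: (@le_trans _ _ (time k)); first by rewrite gerBl.
rewrite /time [time_factor * _]mulrC -mulrA ler_pM2l // /time_factor.
rewrite ler_pdivrMl ?mulr_gt0 ?exprn_gt0 //.
have [h1 _] := mean_exit_compare rx0 near_x xyr rr.
have [_ smr] := near_x xyrx r0 rr.
have h2 := mean_exit_double Uy smr sm.
move: hlow; rewrite ler_pdivrMr // => hlow; apply: le_trans hlow _.
rewrite expr2 -!mulrA [mean_exit x _ * _]mulrC.
rewrite [C1 * _]mulrCA ler_pM2l //; apply: le_trans h1 _.
by rewrite ler_pM2l.
Qed.

(** Times decrease in the index, so the events of larger index are in the past at [time m.+1];
    conditioning there peels off the factor of index m. *)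
Lemma late_escape_inter_le m j : (k0 <= m)%N ->
  Ft (time m) [set w | forall i, (i < j)%N -> late_escape (m + i) w] /\
  (P (Some x) [set w | forall i, (i < j)%N -> late_escape (m + i) w] <=
   (\prod_(i < j) (1 - C4 * expR (- C5) / (m + i).+1%:R))%:E)%E.
Proof.
elim: j m => [|j IH] m km.
  have sF := filtration_sigma bsp (time m).
  rewrite (_ : [set w | _] = [set _ | True]); last by apply/seteqP; split.
  by split; [exact: sig_cst|rewrite big_ord0; apply: probability_le1; exact: measurableT].
have [FA PA] := IH m.+1 (leqW km).
have sE : [set w | forall i, (i < j.+1)%N -> late_escape (m + i) w] =
    late_escape m `&` [set w | forall i, (i < j)%N -> late_escape (m.+1 + i) w].
  apply/seteqP; split=> w /=.
    move=> h; split; first by have := h 0%N isT; rewrite addn0.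
    by move=> i ij; have := h i.+1 ij; rewrite addnS.
  by move=> [h0 h] [_|i ij]; [rewrite addn0|rewrite addnS; exact: h].
rewrite sE; split.
  apply: sigI; [exact: (filtration_sigma bsp)|exact: sig_late_escape|].
  by apply: (filtration_mono bsp) FA; [exact/ltW/time_gt0|exact/ltW/time_lt].
apply: le_trans (late_escape_le km FA) _.
rewrite big_ord_recl /= addn0 EFinM.
have -> : \prod_(i < j) (1 - C4 * expR (- C5) / (m + bump 0 i).+1%:R) =
    \prod_(i < j) (1 - C4 * expR (- C5) / (m.+1 + i).+1%:R) :> R.
  by apply: eq_bigr => i _; rewrite /bump leq0n add1n addnS addSn.
apply: lee_wpmul2l => //; rewrite lee_fin subr_ge0 ler_pdivrMr ?ltr0n // mul1r.
apply: (@le_trans _ _ 1); last by rewrite ler1n.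
by have := @exit_lower_le1 1%N witness isT; rewrite mulr1.
Qed.

Lemma late_escape_fails : {ae P (Some x), forall w, forall m, exists i,
  (k0 <= m)%N -> ~ late_escape (m + i) w}.
Proof.
apply: ae_foralln => m; have [km|km] := leqP k0 m; last by apply: aeW => w; exists 0%N.
have mN : measurable [set w | forall i, late_escape (m + i) w].
  apply: sig_all; first exact: sigma_algebra_measurable.
  move=> i; apply: (filtration_measurable bsp (sig_late_escape _)).
  by rewrite (leq_trans km) // leq_addr.
exists [set w | forall i, late_escape (m + i) w]; split => //.
  apply/eqP; rewrite -measure_le0; apply/lee_addgt0Pr => e e0; rewrite add0e.
  have p0 : 0 < C4 * expR (- C5) by rewrite mulr_gt0 ?expR_gt0.
  have p1 : C4 * expR (- C5) <= 1.
    by have := @exit_lower_le1 1%N witness isT; rewrite mulr1.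
  have [j hj] := prod_harmonic_small m p0 p1 e0.
  have [FA PA] := late_escape_inter_le j km.
  apply: (@le_trans _ _ (P (Some x) [set w | forall i, (i < j)%N -> late_escape (m + i) w])).
    apply: le_measure; rewrite ?inE //; first exact: (filtration_measurable bsp FA).
    by move=> w h i _; exact: h.
  by apply: le_trans PA _; rewrite lee_fin ltW.
move=> w /= h i; apply: contrapT => nl; apply: h; exists i => _.
exact: nl.
Qed.

(** Both events are tested at dyadic times strictly before their horizons. The factor 2 in
    [early_exit] and the half of [time k] here leave room to move a time slightly to the right. *)
Lemma sup_disp_le_radius k w : (k0 <= k)%N -> ~ early_exit k w -> ~ late_escape k w ->
  (sup_disp d X x w (time k / 2) <= (r k)%:E)%E.
Proof.
move=> kk nE nL; have rp := process_regular bsp w.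
have [r0 rr _ _] := r_scale kk.
have t0 := time_gt0 k; have t10 := time_gt0 k.+1.
have early s : 0 <= s -> s < 2 * time k.+1 -> (odist d x (X s w) <= (r k / 2)%:E)%E.
  move=> s0 st; rewrite leNgt; apply/negP => far_s.
  have [h h0 hh] := path_lt_odist lcs rp s0 far_s.
  have [|m [j [j1 j2]]] := @dyadic_dense R s (Num.min (s + h) (2 * time k.+1)) s0.
    by rewrite lt_min ltrDl h0.
  move: j2; rewrite lt_min => /andP[jh jt]; apply: nE; split=> //.
  by exists m, j; split=> //; apply/ltW/hh => //; exact: ltW.
have at_t : (odist d x (X (time k.+1) w) <= (r k / 2)%:E)%E.
  by apply: early; [exact: ltW|lra].
have nesc : ~ escape d (r k / 2) (time k - time k.+1) (fun u => X (u + time k.+1) w).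
  by move=> h; apply: nL; split.
apply/ereal_supP => _ [s /= /andP[s0 st] <-].
have [sl|sl] := ltP s (2 * time k.+1).
  apply: le_trans (early s (ltW s0) sl) _; rewrite lee_fin.
  by rewrite ler_pdivrMr // ler_peMr ?ler1n // ltW.
rewrite leNgt; apply/negP => far_s; apply: nesc.
case E : (X (time k.+1) w) at_t => [y|] //=; rewrite lee_fin => xy.
have far_y : ((r k / 2)%:E < odist d y (X s w))%E.
  move: far_s; case: (X s w) => [z|] /=; last by rewrite !ltry.
  by rewrite !lte_fin; have := dist_triangle lcs y x z; lra.
have [h h0 hh] := path_lt_odist lcs rp (ltW s0) far_y.
have [||m [j [j1 j2]]] := @dyadic_dense R (s - time k.+1)
    (Num.min (s - time k.+1 + h) (time k - time k.+1)).
- by lra.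
- by rewrite lt_min ltrDl h0 /= ltrD2r; lra.
move: j2; rewrite lt_min => /andP[jh jt]; exists m, j; split=> //.
by rewrite add0r E /=; apply: hh; lra.
Qed.
End Scales.

Lemma frequently_upper : {ae P (Some x), forall w, forall t0, 0 < t0 ->
  exists t, [/\ 0 < t, t < t0 & lil_ratio w t <= lil_upper]}.
Proof.
pose B : R := ln C2 + 1; have BE : B = ln C2 + 1 by [].
have B1 : 1 <= B by rewrite BE lerDr ln_ge0.
have B0 : 0 < B := lt_le_trans ltr01 B1.
have hx0 : 0 < mean_exit x rx by apply: (mean_exit_gt0 near_x).
have [k1 k11 hk1] := @expRN_lt R 1 1 _ ltr01 ltr01 hx0.
have scale_small k : (k1 <= k)%N -> scale B k < mean_exit x rx.
  move=> kk; apply: le_lt_trans hk1; rewrite mul1r mulN1r ler_expR lerN2.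
  have k1R : (1 : R) <= k%:R by rewrite ler1n (leq_trans k11).
  apply: (@le_trans _ _ (k%:R)); first by rewrite ler_nat.
  rewrite expr2 mulrA; apply: (@le_trans _ _ (1 * 1 * k%:R)); first by rewrite !mul1r.
  by rewrite ler_wpM2r // ler_pM.
have /choice[r hr] : forall k : nat, exists r, (k1 <= k)%N ->
    [/\ 0 < r, r <= rx, scale B k / C2 <= mean_exit x r & mean_exit x r <= scale B k].
  move=> k; have [kk|_] := leqP k1 k; last by exists 0.
  have [||r hr] := radius_for rx0 near_x (e := scale B k); last by exists r.
    exact: expR_gt0.
  exact: scale_small.
have [J1 hJ1] := upper_time_decreasing C5_gt0 B1 time_factor_gt0.
pose k0 := maxn k1 J1.
have hr0 k : (k0 <= k)%N -> [/\ 0 < r k, r k <= rx, scale B k / C2 <= mean_exit x (r k) &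
    mean_exit x (r k) <= scale B k].
  by move=> kk; apply: hr; apply: leq_trans kk; exact: leq_maxl.
have time_lt k : (k0 <= k)%N -> time B k.+1 < time B k.
  by move=> kk; apply: hJ1; apply: leq_trans kk; exact: leq_maxr.
have [b [S [b0 Pb Sb]]] := early_exit_le BE hr0.
have mE k : measurable (early_exit B k0 r k).
  apply: sig_if => [|_]; first exact: sigma_algebra_measurable.
  exact: (measurable_exits_before lcs bsp).
have bc := borel_cantelli mE b0 Pb Sb.
have [J2 hJ2] := upper_scale C5_gt0 B0 (divr_gt0 time_factor_gt0 (ltr0n R 2)).
have fail := late_escape_fails hr0 time_lt.
apply: filterS3 eventually_lower bc fail => w [t1 t10 low] [K hK] hfail t0 t00.
have J0 : 0 < Num.min t0 t1 by rewrite lt_min t00.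
have half_time k : time B k / 2 = time_factor / 2 * (log_count C5 k)%:R * expR (- (B * k%:R ^+ 2)).
  by rewrite /time /scale; lra.
have [J3 hJ3] : exists J, forall k, (J <= k)%N -> time B k / 2 < Num.min t0 t1.
  have [Ja hJa] := affine_le_exp (C5^-1 * time_factor) time_factor.
  have [m _ hm] := @expRN_lt R 1 2^-1 _ ltr01 ltac:(by rewrite invr_gt0) J0.
  exists (maxn (maxn Ja m) 1) => k; rewrite !geq_max => /andP[/andP[Jk mk] k_gt0].
  have kR : (1 : R) <= k%:R by rewrite ler1n.
  apply: (@le_lt_trans _ _ (time B k)).
    by rewrite ler_pdivrMr // ler_peMr ?ler1n // ltW // time_gt0.
  apply: le_lt_trans hm; rewrite mul1r /time /scale.
  apply: (@le_trans _ _ (expR (k%:R / 2) * expR (- (B * k%:R ^+ 2)))).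
    rewrite ler_pM2r ?expR_gt0 //; apply: le_trans (hJa k Jk).
    have := log_count_affine k C5_gt0; rewrite -(ler_pM2l time_factor_gt0) mulrDr mulr1.
    by rewrite mulrA [time_factor * C5^-1]mulrC.
  rewrite -expRD ler_expR.
  have : 1 * (k%:R * 1) <= B * (k%:R * k%:R) :> R by rewrite ler_pM // ler_wpM2l.
  have : m%:R <= k%:R :> R by rewrite ler_nat.
  by rewrite expr2; move: (B * _) => z; lra.
pose m := maxn (maxn K k0) (maxn J2 J3).
have [Km k0m J2m J3m] : [/\ (K <= m)%N, (k0 <= m)%N, (J2 <= m)%N & (J3 <= m)%N].
  split; [exact: leq_trans (leq_maxl _ _) (leq_maxl _ _)|
    exact: leq_trans (leq_maxr _ _) (leq_maxl _ _)|
    exact: leq_trans (leq_maxl _ _) (leq_maxr _ _)|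
    exact: leq_trans (leq_maxr _ _) (leq_maxr _ _)].
(* An index beyond all thresholds at which no late escape occurs; an early exit is excluded there by
   the first Borel-Cantelli lemma. *)
have [i /(_ k0m) nL] := hfail m.
set k := (m + i)%N in nL; have mk : (m <= k)%N by rewrite leq_addr.
have kk := leq_trans k0m mk.
have nE := hK k (leq_trans Km mk).
have [r0 rr _ hup] := hr0 k kk.
have := hJ3 k (leq_trans J3m mk); rewrite lt_min => /andP[lt0 lt1].
have [h0 _ u0 hu] := hJ2 k (leq_trans J2m mk) (time B k / 2) (half_time k).
exists (time B k / 2); split=> //.
have [[s [Es s0 srx]] _] := low _ h0 lt1.
have := sup_disp_le_radius hr0 kk nE nL.
rewrite /lil_ratio Es lee_fin /= => srk.
have phi_up : phi x s <= C * scale B k.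
  apply: (@le_trans _ _ (phi x (r k))).
    by apply: phi_mono => //; exact: le_lt_trans rr rxR0.
  by have [_ h] := phi_mean_exit r0 rr; apply: le_trans h _; rewrite ler_pM2l.
set u := ln _ in u0 hu *.
rewrite invf_div mulrA ler_pdivrMr //.
have sk0 : 0 < scale B k by exact: expR_gt0.
apply: (@le_trans _ _ (C * scale B k * u)); first by rewrite ler_pM2r.
apply: (@le_trans _ _ (C * scale B k * (3 * C5 * (log_count C5 k)%:R))).
  by rewrite ler_pM2l // mulr_gt0.
rewrite le_eqVlt; apply/orP; left; apply/eqP.
rewrite /lil_upper /time; have := time_factor_gt0; move: time_factor => tf tf0.
by field; rewrite gt_eqF.
Qed.

(** A failure at t would persist at a dyadic time slightly before t, where the supremum is no larger
    and the gauge hardly smaller. With the next lemma this decides each level up to equality, which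
    is all that [ae_constant] asks. *)
Lemma eventually_above_le w t0 c : 0 < t0 -> 0 < c ->
  (forall t, 0 < t -> t < t0 -> exists s, [/\ sup_disp d X x w t = s%:E, 0 < s & s <= rx]) ->
  eventually_above d (phi x) R0 x c (fun u => X u w) ->
  (c%:E <= lil_liminf d X phi x w)%E.
Proof.
move=> t00 c0 good [n hn]; apply: le_liminf_at0.
have e0 : 0 < Num.min (Num.min t0 (expR (-1))) (2^-1 ^+ n).
  by rewrite !lt_min t00 expR_gt0 exprn_gt0 // invr_gt0.
exists (Num.min (Num.min t0 (expR (-1))) (2^-1 ^+ n)) => // t t_gt0.
rewrite !lt_min => /andP[/andP[tt0 te] tn].
have [s [Es s0 srx]] := good t t_gt0 tt0; rewrite Es /=.
have l0 := ln_abs_ln_gt0 t_gt0 te.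
rewrite ler_pdivlMr ?divr_gt0 // leNgt; apply/negP => lt_phi.
have [|u [u0 ut hu]] := @lil_gauge_left _ t (phi x s / c) t_gt0 te.
  by rewrite ltr_pdivrMr // mulrC.
have [m [k [k1 k2]]] := dyadic_dense (ltW u0) ut.
have [||r [r0 [rR0 hr]] rS] := hn m k; first exact: lt_trans k1.
  exact: lt_trans tn.
have rs : r <= s.
  rewrite -lee_fin -Es; apply: le_trans rS (le_trans (dyadic_sup_le _ _ _ _ _) _).
  apply: le_ereal_sup => _ [v /= /andP[v0 vk] <-]; exists v => //=.
  by rewrite v0 (le_trans vk (ltW k2)).
have := hu _ k1 (ltW k2); rewrite ltNge ler_pdivlMr // => /negP; apply.
rewrite mulrC; apply: le_trans hr _; apply: phi_mono => //.
exact: le_lt_trans srx rxR0.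
Qed.

Lemma lt_eventually_above w t0 c : 0 < t0 -> 0 < c ->
  (forall t, 0 < t -> t < t0 -> exists s, [/\ sup_disp d X x w t = s%:E, 0 < s & s <= rx]) ->
  (c%:E < lil_liminf d X phi x w)%E ->
  eventually_above d (phi x) R0 x c (fun u => X u w).
Proof.
move=> t00 c0 good /lt_liminf_at0[c' cc' [e e0 he]].
have c'0 : 0 < c' := lt_trans c0 cc'.
have [|n /(_ n (leqnn _)) hn] := @exists_halfpow_lt _ (Num.min (Num.min t0 (expR (-1))) e).
  by rewrite !lt_min t00 expR_gt0.
exists n => m k; set t := dyadic m k => t_gt0 tn.
have : t < Num.min (Num.min t0 (expR (-1))) e := lt_trans tn hn.
rewrite !lt_min => /andP[/andP[tt0 te] t_lt_e].
have l0 := ln_abs_ln_gt0 t_gt0 te.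
(* The dyadic supremum at t controls the full supremum only at earlier v; the gap between c and c'
   pays for the change of gauge from t to v. *)
have [|u [u0 ut hu]] := @lil_gauge_left _ t (c / c' * (t / ln `|ln t|)) t_gt0 te.
  by rewrite gtr_pMl ?divr_gt0 // ltr_pdivrMr // mul1r.
have [v uv vt] : exists2 v, u < v & v < t by exists ((u + t) / 2); lra.
have v0 := lt_trans u0 uv.
have [s [Es s0 srx]] := good v v0 (lt_trans vt tt0).
have lv := ln_abs_ln_gt0 v0 (lt_trans vt te).
exists s; last by rewrite -Es; exact: (sup_disp_le_dyadic_sup lcs bsp).
split=> //; split; first exact: le_lt_trans rxR0.
have := he v v0 (lt_trans vt t_lt_e); rewrite Es /= ler_pdivlMr ?divr_gt0 //.
apply: le_trans; have := hu v uv (ltW vt).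
by rewrite mulrAC ltr_pdivrMr // [v / _ * _]mulrC => /ltW.
Qed.

Lemma liminf_constant : exists2 ax, lil_lower <= ax <= lil_upper &
  {ae P (Some x), forall w, lil_liminf d X phi x w = ax%:E}.
Proof.
have bounds : {ae P (Some x), forall w,
    (lil_lower%:E <= lil_liminf d X phi x w <= lil_upper%:E)%E}.
  apply: filterS2 eventually_lower frequently_upper => w [t0 t00 low] up.
  apply/andP; split.
    by apply: le_liminf_at0; exists t0 => // t t_gt0 tt0; have [] := low t t_gt0 tt0.
  rewrite leNgt; apply/negP => /lt_liminf_at0[c' lc [e e0 he]].
  have [t [t_gt0 te]] := up e e0; rewrite leNgt => /negP; apply.
  exact: lt_le_trans lc (he t t_gt0 te).
apply: (ae_constant bounds) => c.
(* Levels up to the known lower bound are immediate; the others are positive, as the two comparisons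
   require. *)
have [cl|lc] := leP c lil_lower.
  by left; apply: filterS bounds => w /andP[+ _]; apply: le_trans; rewrite lee_fin.
have c0 := lt_trans lil_lower_gt0 lc.
have sP := @path_event_sigma R dM M.
have pA : path_event (eventually_above d (phi x) R0 x c).
  apply: (@sig_eventually_above _ _ _ _ lcs (phi x) R0 x _ _ (fun u p => p u) 1 c sP ltr01).
  by move=> u u0 _; exact: path_observable.
have mA := path_event_measurable0 bsp pA.
have FA s : 0 < s -> Ft s [set w | eventually_above d (phi x) R0 x c (fun u => X u w)].
  move=> s0.
  apply: (@sig_eventually_above _ _ _ _ lcs _ _ _ _ _ X s c (filtration_sigma bsp s) s0) => u u0 us.
  exact: (process_observable bsp).
have [PA|PA] := blumenthal_zero_one lcs bsp x pA FA; [right|left].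
  have nA : {ae P (Some x), forall w, ~ eventually_above d (phi x) R0 x c (fun u => X u w)}.
    by exists [set w | eventually_above d (phi x) R0 x c (fun u => X u w)]; split=> // w /= /contrapT.
  apply: filterS2 eventually_lower nA => w [t0 t00 low] nA; rewrite leNgt; apply/negP => lt.
  apply: nA; apply: (lt_eventually_above t00 c0 _ lt) => t t_gt0 tt0.
  by have [] := low t t_gt0 tt0.
have yA : {ae P (Some x), forall w, eventually_above d (phi x) R0 x c (fun u => X u w)}.
  exists (~` [set w | eventually_above d (phi x) R0 x c (fun u => X u w)]); split=> //.
    exact: measurableC.
  by rewrite probability_setC // PA subee.
apply: filterS2 eventually_lower yA => w [t0 t00 low] yA.
apply: (eventually_above_le t00 c0 _ yA) => t t_gt0 tt0.
by have [] := low t t_gt0 tt0.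
Qed.
End LiminfBounds.
End LocalScale.

Theorem mainTheorem1
  (R : realType) (dM : measure_display) (M : measurableType dM)
  (d : M -> M -> R) (mu : {measure set M -> \bar R})
  (dO : measure_display) (Om : measurableType dO)
  (Ft : R -> set_system Om) (X : R -> Om -> option M)
  (theta : R -> Om -> Om) (P : option M -> probability Om R)
  (Jm : M -> {measure set M -> \bar R}) (kill : M -> \bar R)
  (U : set M) (R0 C0 : R) (phi : M -> R -> R) :
  lcs_borel_metric_space d ->
  radon_full_support d mu ->
  borel_standard_process d Ft X theta P ->
  levy_system d X P Jm kill ->
  mopen d U ->
  conditions_A d X P Jm kill U R0 C0 ->
  admissible d X P U R0 C0 phi ->
  exists a1 a2 : R, 0 < a1 /\ a1 <= a2 /\
    forall x, U x -> exists2 ax : R, a1 <= ax <= a2 &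
      {ae P (Some x), forall w, lil_liminf d X phi x w = ax%:E}.
Proof.
move=> lcs _ bsp levy openU [R0_gt0 C0_gt0 _ [C1 [C2 [C3 [C4 [C5 [C6 [C7 cst]]]]]]]].
case: cst => -[C1_gt1 [C2_gt0 C3_gt0]] [C4_gt0 C5_gt0] [C6_gt0 C7_gt0] condA.
case=> _ phi_mono [C C_ge1 phi_bounds].
pose a := lil_lower C2 C7 C; pose b := lil_upper C1 C2 C5 C.
(* The inequality between a and b is known only through a point of [U], which may be empty; hence
   the maximum. *)
exists a, (Num.max a b); split; first by apply: lil_lower_gt0.
split=> [|x Ux]; first by rewrite le_max lexx.
have [rx rx0 [rxR0 near_x compact_x]] := good_neighbourhood lcs openU R0_gt0 C0_gt0 Ux.
have [ax /andP[a_ax ax_b] h] := liminf_constant lcs bsp levy C1_gt1 C2_gt0 C3_gt0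
  C4_gt0 C5_gt0 C6_gt0 C7_gt0 condA rx0 rxR0 near_x compact_x C_ge1 phi_mono phi_bounds.
by exists ax => //; rewrite a_ax le_max ax_b orbT.
Qed.
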